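(* (i) Let $\alpha\in(0,1]$, $r\in(0,1)$, $\mu>0$. Then the generalized gamma distribution with parameters $r,\alpha,\mu$ is a mixed exponential distribution; more precisely, $$G^*_{r,\alpha,\mu}\stackrel{d}{=} W_1\cdot\big(S_{\alpha,1}Z_{r,\mu}^{1/\alpha}\big)^{-1},$$ where the random variables $W_1$, $S_{\alpha,1}$, $Z_{r,\mu}$ on the right-hand side are independent. (ii) Let $\alpha>0$, $r>0$, $\mu>0$ with $\alpha r>1$. Then the generalized gamma distribution with parameters $r,\alpha,\mu$ cannot be represented as a mixed exponential distribution.
   Context: For $r>0$, $\lambda>0$ and real $\alpha\neq 0$, the generalized gamma (GG) distribution is the distribution on $[0,\infty)$ with density $g^*(x;r,\alpha,\lambda)=\frac{|\alpha|\lambda^r}{\Gamma(r)}x^{\alpha r-1}e^{-\lambda x^{\alpha}}$, $x\ge 0$; $G^*_{r,\alpha,\lambda}$ denotes a random variable with this density. $G_{r,\lambda}$ denotes a gamma random variable with density $\frac{\lambda^r}{\Gamma(r)}x^{r-1}e^{-\lambda x}$, $x\ge0$. $W_1$ is a standard exponential random variable. For $0<\alpha\le 1$, $S_{\alpha,1}$ denotes a random variable with the one-sided strictly stable distribution with characteristic function $\exp\{-|t|^{\alpha}\exp(-\tfrac12 i\pi\alpha\,\mathrm{sign}\,t)\}$ (for $\alpha=1$ this is the distribution degenerate at $1$). For $r\in(0,1)$ and $\mu>0$, $Z_{r,\mu}=\mu(G_{r,1}+G_{1-r,1})/G_{r,1}$ with $G_{r,1}$, $G_{1-r,1}$ independent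 (equivalently, $Z_{r,\mu}$ has density $\frac{\mu^r}{\Gamma(1-r)\Gamma(r)}\cdot\frac{\mathbf 1(z\ge\mu)}{(z-\mu)^r z}$). A distribution with distribution function $F$ on $[0,\infty)$ is called mixed exponential if $1-F(x)=\int_0^\infty e^{-zx}\,dH(z)$, $x\ge 0$, for some probability distribution $H$ on $(0,\infty)$, i.e. it is the distribution of $W_1/V$ for some positive random variable $V$ independent of $W_1$. *)

(* Defs.v *)
From HB Require Import structures.
From mathcomp Require Import all_boot all_order all_algebra.
From mathcomp Require Import all_classical all_reals all_analysis.
Set Implicit Arguments. Unset Strict Implicit. Unset Printing Implicit Defensive.
Import Order.TTheory GRing.Theory Num.Theory.
Import numFieldNormedType.Exports.
Local Open Scope classical_set_scope.
Local Open Scope ring_scope.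

Section Defs.
Variable R : realType.

Definition Gammaf (r : R) : R :=
  Rintegral lebesgue_measure `]0, +oo[ (fun t => t `^ (r - 1) * expR (- t)).

Definition gg_density (r a l : R) (x : R) : R :=
  `|a| * l `^ r / Gammaf r * x `^ (a * r - 1) * expR (- (l * x `^ a)).

Definition gg_law (r a l : R) : set R -> \bar R :=
  fun A => (\int[lebesgue_measure]_(x in A `&` `[0%R, +oo[) (gg_density r a l x)%:E)%E.

(* density of Z_{r,mu} (supported on [mu, +oo)) *)
Definition Z_density (r mu : R) (z : R) : R :=
  mu `^ r / (Gammaf (1 - r) * Gammaf r) / ((z - mu) `^ r * z).

Definition mixed_exponential (mu : set R -> \bar R) : Prop :=
  exists H : probability R R,
    H `]0%R, +oo[%classic = 1%E /\
    forall x : R, 0 <= x ->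
      mu `]x, +oo[%classic = (\int[H]_(z in `]0%R, +oo[) (expR (- (z * x)))%:E)%E.

Definition indep3 {d} {T : measurableType d} (P : probability T R)
  (X Y Z : T -> R) : Prop :=
  forall A B C : set R, measurable A -> measurable B -> measurable C ->
    P (X @^-1` A `&` Y @^-1` B `&` Z @^-1` C) =
    (P (X @^-1` A) * P (Y @^-1` B) * P (Z @^-1` C))%E.

Definition is_std_exponential {d} {T : measurableType d} (P : probability T R)
  (X : T -> R) : Prop :=
  forall A : set R, measurable A ->
    P (X @^-1` A) = (\int[lebesgue_measure]_(x in A `&` `[0%R, +oo[) (expR (- x))%:E)%E.

Definition is_Z_law {d} {T : measurableType d} (P : probability T R)
  (r mu : R) (X : T -> R) : Prop :=
  forall A : set R, measurable A ->
    P (X @^-1` A) = (\int[lebesgue_measure]_(z in A `&` `[mu, +oo[) (Z_density r mu z)%:E)%E.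

(* X has the one-sided strictly stable law S_{alpha,1}: its characteristic
   function E[exp(itX)] equals exp{-|t|^alpha exp(-i pi alpha sign(t)/2)};
   written via real and imaginary parts:
   exp{-|t|^a cos(pi a/2)} * (cos + i sin)(|t|^a sin(pi a/2) sign t). *)
Definition is_stable_one_sided {d} {T : measurableType d} (P : probability T R)
  (a : R) (X : T -> R) : Prop :=
  forall t : R,
    (\int[P]_w (cos (t * X w))%:E)%E =
      (expR (- (`|t| `^ a * cos (pi * a / 2))) *
       cos (`|t| `^ a * sin (pi * a / 2) * Num.sg t))%:E /\
    (\int[P]_w (sin (t * X w))%:E)%E =
      (expR (- (`|t| `^ a * cos (pi * a / 2))) *
       sin (`|t| `^ a * sin (pi * a / 2) * Num.sg t))%:E.

End Defs.

(* Main.v *)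
(** (ii) A mixed exponential law has a convex tail [T], so
    [T 0 - T h >= T 1 - T (1 + h)].  When [a * r > 1] the density vanishes at [0]
    like [x ^ (a * r - 1)], so the left-hand side is [o(h)] while the right-hand side
    is at least a constant times [h].

    (i) Writing [(y ^ a) ^ (r - 1)] as a gamma integral, Tonelli gives the tail of the
    generalized gamma law as [E exp (- x ^ a Z)].  This is the tail of
    [W / (S Z ^ (1 / a))] as soon as [S > 0] almost surely and
    [E exp (- u S) = exp (- u ^ a)].

    The link between the characteristic function and the Laplace transform of [S] goes
    through the test functions [exp (- u x) - exp (- v x)] on [x >= 0], extended by [0].
    Their Fourier transform is integrable, so their mean is an explicit linear functional
    of the characteristic function.  For the stable characteristic function that
    functional is evaluated on approximants: normalised sums of i.i.d. ratios of an
    exponential variable by a heavy-tailed one, whose Laplace transform and characteristic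
    function are explicit and converge to the stable ones.  Letting [v] tend to infinity
    and [u] to [0] yields the Laplace transform of [S] and [S > 0].  For [a < 1] the stable
    law exists because the Fourier inverse of its characteristic function is a pointwise
    limit of smoothed laws of the approximants, hence nonnegative; for [a = 1] it is
    the Dirac mass at [1]. *)
Require Import Defs.
From HB Require Import structures.
From mathcomp Require Import all_boot all_order all_algebra.
From mathcomp Require Import all_classical all_reals all_analysis.
From mathcomp Require Import measurable_realfun ring lra.
Import Order.TTheory GRing.Theory Num.Theory.
Import numFieldNormedType.Exports.
Set Implicit Arguments. Unset Strict Implicit. Unset Printing Implicit Defensive.
Local Open Scope classical_set_scope.
Local Open Scope ring_scope.

(** * Improper integrals, substitution and Fubini *)

(** A single exponential cut off at 0 jumps there, and its transform decays only like 1/t. The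
    difference of two exponentials is continuous and has an integrable transform, so the inversion
    formula is an absolutely convergent integral and limits of characteristic functions pass through
    it by dominated convergence.

    The approximants are chosen so that both transforms come from one density: given its denominator
    w, the ratio has Laplace transform w / (w + u) and characteristic function w / (w - i t). In the
    limit there remain the integrals of w^(a-1) / (1 + w), w^(a-1) / (1 + w^2) and w^a / (1 + w^2).
    Their quotients, the cosine and sine of pi a / 2, come from rotating the half-line of
    integration, which is done by differentiating a real integral with respect to the angle.

    In (i), the mixing distribution H requires a stable law to be constructed, whereas in the
    product representation S is given by its characteristic function alone, so that even S > 0 has
    to be proved. The rotation and the Fourier inverse both rely on a < 1. *)

Section improper_FTC.
Context {R : realType}.
Notation mu := (@lebesgue_measure R).
Variables (F f : R -> R) (a l0 l : R).
Hypothesis dF : forall x, a < x -> is_derive x 1 F (f x).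
Hypothesis cf : forall x, a < x -> {for x, continuous f}.
Hypothesis Fa : F x @[x --> a^'+] --> l0.
Hypothesis Fl : F x @[x --> +oo] --> l.

(** Compact intervals exhausting the open half-line. The upper end uses [n.+2] because with [n.+1]
    the interval would be a single point for n = 0. *)
Let I n : set R := `[a + n.+1%:R^-1, a + n.+2%:R].

Let ltI n : a + n.+1%:R^-1 < a + n.+2%:R :> R.
Proof.
rewrite ltrD2l (@le_lt_trans _ _ 1) ?invf_le1 ?ler1n ?ltr1n//.
Qed.

Let gtI n : a < a + n.+1%:R^-1 :> R.
Proof. by rewrite ltrDl invr_gt0. Qed.

Let ndI : {homo I : n m / (n <= m)%N >-> (n <= m)%O}.
Proof.
move=> n m nm; apply/subsetPset => x /=; rewrite /I/= !in_itv/= => /andP[h1 h2].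
apply/andP; split.
  by apply: le_trans h1; rewrite lerD2l lef_pV2 ?posrE// ler_nat.
by apply: (le_trans h2); rewrite lerD2l ler_nat.
Qed.

Let bigI : \bigcup_n I n = `]a, +oo[%classic.
Proof.
apply/seteqP; split => x /=.
  by move=> [n _]; rewrite /I/= !in_itv/= andbT => /andP[h _]; apply: lt_le_trans h.
rewrite in_itv/= andbT => ax.
have xa : 0 < x - a by rewrite subr_gt0.
exists (Num.truncn ((x - a)^-1) + Num.truncn (x - a))%N => //.
rewrite /I/= in_itv/= -lerBrDl -[x <= _]lerBlDl.
have h1 := truncnS_gt (x - a)^-1; have h2 := truncnS_gt (x - a).
apply/andP; split.
  rewrite -[leRHS]invrK lef_pV2 ?posrE ?invr_gt0//.
  by apply: ltW; apply: lt_le_trans h1 _; rewrite ler_nat ltnS leq_addr.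
by apply: ltW; apply: lt_le_trans h2 _; rewrite ler_nat ltnS leqW // leq_addl.
Qed.

Let FTCn n : (\int[mu]_(x in I n) (f x)%:E)%E
  = (F (a + n.+2%:R) - F (a + n.+1%:R^-1))%:E.
Proof.
have cF x : a < x -> {for x, continuous F}.
  by move=> /dF dFx; apply/differentiable_continuous/derivable1_diffP.
rewrite EFinB; apply: continuous_FTC2 => //.
- apply: continuous_in_subspaceT => x; rewrite inE/= in_itv/= => /andP[h _].
  by apply: cf; apply: lt_le_trans h.
- split.
  + by move=> x; rewrite in_itv/= => /andP[/(lt_trans (gtI n)) /dF].
  + by apply: cvg_at_right_filter; apply: cF.
  + by apply: cvg_at_left_filter; apply: cF; apply: lt_trans (ltI n).
- move=> x; rewrite in_itv/= => /andP[/(lt_trans (gtI n)) /dF h _].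
  by rewrite derive1E derive_val.
Qed.

Let cvgF : (F (a + n.+2%:R) - F (a + n.+1%:R^-1))%:E @[n --> \oo] --> (l - l0)%:E.
Proof.
apply: cvg_EFin; first exact: nearW.
apply: cvgB.
  move/cvg_pinftyP : Fl; apply.
  apply/cvgryPge => A; near=> n; rewrite -lerBlDl.
  apply: (@le_trans _ _ n%:R); last by rewrite ler_nat -addn2 leq_addr.
  by near: n; exact: nbhs_infty_ger.
move/cvg_at_rightP : Fa; apply; split => //.
rewrite -[X in _ --> X]addr0; apply: cvgD; first exact: cvg_cst.
exact: cvg_harmonic.
Unshelve. all: by end_near. Qed.

Let mf : measurable_fun `]a, +oo[ f.
Proof.
apply: open_continuous_measurable_fun => // x; rewrite inE/= in_itv/= andbT.
exact: cf.
Qed.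

Let mI n : measurable (I n). Proof. exact: measurable_itv. Qed.

Let subI n : I n `<=` `]a, +oo[.
Proof. by rewrite -bigI; apply: bigcup_sup. Qed.

(** Monotone convergence along the compact intervals [I n], on each of which the fundamental theorem
    of calculus applies. *)
Lemma ge0_FTCy : (forall x, a < x -> 0 <= f x) ->
  (\int[mu]_(x in `]a, +oo[) (f x)%:E = (l - l0)%:E)%E.
Proof.
move=> f0; rewrite -bigI.
have := @ge0_nondecreasing_set_cvg_integral _ (measurableTypeR R) R I (EFin \o f) mu ndI mI.
rewrite (_ : (fun i => _) = (fun n => (F (a + n.+2%:R) - F (a + n.+1%:R^-1))%:E));
  last by apply/funext => n; exact: FTCn.
move=> h; have {}h := h _ _.
have h1 := h (fun n => measurable_funS (measurable_itv _) (@subI n)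
  (proj2 (measurable_EFinP _ _) mf)).
have h2 : forall (i : nat) (x : R), I i x -> (0 <= (EFin \o f) x)%E.
  by move=> i x /subI/=; rewrite in_itv/= andbT lee_fin; exact: f0.
by apply: (cvg_unique _ (h1 h2) cvgF).
Qed.

(** For a signed integrand the same exhaustion works by dominated convergence, the restrictions of f
    being bounded by its absolute value. *)
Lemma FTCy : mu.-integrable `]a, +oo[ (EFin \o f) ->
  (\int[mu]_(x in `]a, +oo[) (f x)%:E = (l - l0)%:E)%E.
Proof.
move=> intf.
have mO : measurable (`]a, +oo[%classic : set R) by exact: measurable_itv.
have := @dominated_cvg _ (measurableTypeR R) R mu _ mO (fun n => (EFin \o f) \_ (I n)) (EFin \o f)
  (abse \o (EFin \o f)).
rewrite (_ : (fun n => _) = (fun n => (F (a + n.+2%:R) - F (a + n.+1%:R^-1))%:E));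
  last first.
  apply/funext => n; rewrite -FTCn -integral_mkcondr setIidr//.
move=> h; apply: (cvg_unique _ (h _ _ _ _ _) cvgF) => //.
- move=> n; apply/measurable_restrict => //; first exact: mI.
  by apply: (measurable_funS mO); [exact: subIsetl|exact/measurable_EFinP].
- move=> x; rewrite -bigI => -[n _ Inx].
  apply: cvg_near_cst; exists n => // m /= nm; rewrite patchE mem_set//.
  by move: Inx; apply/subsetPset; exact: ndI.
- exact: integrable_abse.
- move=> n x _ /=; rewrite patchE; case: ifPn => _//.
  by rewrite (_ : point = 0%E)// abse0 lee_fin.
Qed.
End improper_FTC.

Section measurability.
Context {R : realType}.

(** Since x^-1 = x (x^2)^-1, including at 0 where the inverse is 0 by convention, this follows from
    the measurability of real powers. *)
Lemma measurable_inv : measurable_fun [set: R] (@GRing.inv R).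
Proof.
rewrite (_ : GRing.inv = (fun x => x * (x ^+ 2) `^ (-1))); last first.
  apply/funext => x; rewrite powR_inv1 ?sqr_ge0//.
  have [->|x0] := eqVneq x 0; first by rewrite invr0 mul0r.
  by rewrite expr2 invfM mulrA divff// mul1r.
apply: measurable_funM => //.
by apply: (measurableT_comp (f := (@powR R)^~ (-1))).
Qed.

Lemma measurable_funV d (T : measurableType d) (D : set T) (f : T -> R) :
  measurable_fun D f -> measurable_fun D (fun x => (f x)^-1).
Proof. by move=> mf; exact: (measurableT_comp measurable_inv mf). Qed.

Lemma measurable_fun_powRl d (T : measurableType d) (D : set T) (f : T -> R) p :
  measurable_fun D f -> measurable_fun D (fun x => f x `^ p).
Proof. by move=> mf; exact: (measurableT_comp (measurable_powR p) mf). Qed.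

Lemma measurable_fun_expR d (T : measurableType d) (D : set T) (f : T -> R) :
  measurable_fun D f -> measurable_fun D (fun x => expR (f x)).
Proof. by move=> mf; exact: (measurableT_comp (@measurable_expR R) mf). Qed.

Lemma measurable_fun_cos d (T : measurableType d) (D : set T) (f : T -> R) :
  measurable_fun D f -> measurable_fun D (fun x => cos (f x)).
Proof.
move=> mf; apply: (measurableT_comp (f := cos)) mf.
apply: continuous_measurable_fun; exact: continuous_cos.
Qed.

Lemma measurable_fun_sin d (T : measurableType d) (D : set T) (f : T -> R) :
  measurable_fun D f -> measurable_fun D (fun x => sin (f x)).
Proof.
move=> mf; apply: (measurableT_comp (f := sin)) mf.
apply: continuous_measurable_fun; exact: continuous_sin.
Qed.

Lemma measurable_fun_norm d (T : measurableType d) (D : set T) (f : T -> R) :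
  measurable_fun D f -> measurable_fun D (fun x => `|f x|).
Proof. by move=> mf; exact: (measurableT_comp (@normr_measurable R setT) mf). Qed.
End measurability.

(** Recursion on the body of the function. The cases such as [Num.norm] and [-%R] catch functions
    that appear in eta-reduced form. *)
Ltac mfun :=
  lazymatch goal with
  | |- measurable_fun _ (fun x => EFin _) => apply/measurable_EFinP; mfun
  | |- measurable_fun _ (EFin \o _) => apply/measurable_EFinP; mfun
  | |- measurable_fun _ (fun x => x) => exact: measurable_id
  | |- measurable_fun _ (fun x => x.1) => exact: measurable_fst
  | |- measurable_fun _ (fun x => x.2) => exact: measurable_snd
  | |- measurable_fun _ (fun x => _ - _) => apply: measurable_funB; mfun
  | |- measurable_fun _ (fun x => _ + _) => apply: measurable_funD; mfun
  | |- measurable_fun _ (fun x => _ * _) => apply: measurable_funM; mfun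
  | |- measurable_fun _ (fun x => - _) => apply: measurable_funN; mfun
  | |- measurable_fun _ (fun x => `|_|) => apply: measurable_fun_norm; mfun
  | |- measurable_fun _ Num.norm => exact: normr_measurable
  | |- measurable_fun _ (fun x => _^-1) => apply: measurable_funV; mfun
  | |- measurable_fun _ (fun x => _ ^+ _) => apply: measurable_funX; mfun
  | |- measurable_fun _ (fun x => expR _) => apply: measurable_fun_expR; mfun
  | |- measurable_fun _ (fun x => cos _) => apply: measurable_fun_cos; mfun
  | |- measurable_fun _ (fun x => sin _) => apply: measurable_fun_sin; mfun
  | |- measurable_fun _ (fun x => _ `^ _) => apply: measurable_fun_powRl; mfun
  | |- measurable_fun _ ( *%R _) => exact: mulrl_measurable
  | |- measurable_fun _ (?f \o ?g) => change (measurable_fun _ (fun x => f (g x))); mfun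
  | |- measurable_fun _ ( +%R ?c) =>
      apply: (@measurable_funD _ _ _ _ (fun=> c) (fun x => x)); mfun
  | |- measurable_fun _ -%R => exact: oppr_measurable
  | |- _ => try solve [exact: measurable_cst | assumption | by [] | by apply: measurable_funTS]
  end.

Definition image_measure d d' (T1 : measurableType d) (T2 : measurableType d')
    (R : realType) (m : {measure set T1 -> \bar R}) (f : T1 -> T2)
    (mf : measurable_fun setT f) : {measure set T2 -> \bar R} :=
  measure_function_pushforward__canonical__measure_function_Measure m mf.

Section affine.
Context {R : realType}.
Notation mu := (@lebesgue_measure R).
Variables (k b : R).
Hypothesis k0 : 0 < k.

Let h (x : measurableTypeR R) : measurableTypeR R := k * x + b.

Let mh : measurable_fun setT h.
Proof. by rewrite /h; mfun. Qed.

(** The image of Lebesgue measure under the affine map, scaled by k, gives every half-open interval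
    its length; uniqueness of Lebesgue measure does the rest. *)
Lemma lebesgue_measure_affine (A : set R) : measurable A ->
  mu A = (k%:E * mu (h @^-1` A))%E.
Proof.
move=> mA; have k0' : 0 <= k by exact: ltW.
pose m := mscale (NngNum k0') (image_measure mu mh).
rewrite (@lebesgue_measure_unique _ m _ A mA)// => X [[x y] _ <-].
rewrite /m/= /mscale/= /image_measure/= /pushforward.
rewrite (_ : h @^-1` _ = `](x - b) / k, (y - b) / k]%classic); last first.
  apply/seteqP; split => z; rewrite /h/= !in_itv/= ltr_pdivrMr// ler_pdivlMr// (mulrC k);
   by rewrite ltrBlDr lerBrDr.
rewrite !lebesgue_measure_itv/= !lte_fin.
rewrite ltr_pM2r ?invr_gt0// ltrD2r; case: ifPn => _; last by rewrite mule0.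
by rewrite -!EFinB -EFinM -mulrBl mulrC divfK ?gt_eqF// opprB addrA subrK.
Qed.

Lemma ge0_integral_affine (f : R -> \bar R) : measurable_fun setT f ->
  (forall x, 0 <= f x)%E ->
  (\int[mu]_y f y = k%:E * \int[mu]_x f (k * x + b)%R)%E.
Proof.
move=> mf f0; have k0' : 0 <= k by exact: ltW.
pose m := mscale (NngNum k0') (image_measure mu mh).
rewrite (@eq_measure_integral _ _ _ _ m); last first.
  by move=> A mA _; exact: lebesgue_measure_affine.
rewrite ge0_integral_mscale// ; congr (_ * _)%E; exact: ge0_integral_pushforward.
Qed.

Lemma ge0_integral_itv_affine (a : R) (f : R -> R) :
  measurable_fun setT f -> (forall x, 0 <= f x) ->
  (\int[mu]_(y in `](k * a + b)%R, +oo[) (f y)%:E =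
   k%:E * \int[mu]_(x in `]a, +oo[) (f (k * x + b)%R)%:E)%E.
Proof.
move=> mf f0; rewrite integral_mkcond [in RHS]integral_mkcond.
rewrite ge0_integral_affine; first last.
- by move=> x; rewrite patchE; case: ifPn => // _; rewrite lee_fin.
- apply/(measurable_restrictT _ _).1 => //.
  by apply/measurable_EFinP; exact: measurable_funTS.
congr (_ * _)%E; apply: eq_integral => x _; rewrite !patchE; congr (if _ then _ else _).
by apply/idP/idP; rewrite !inE/= !in_itv/= !andbT ltrD2r ltr_pM2l.
Qed.

End affine.

Section fubini_on_sets.
Context {R : realType} d1 d2 {T1 : measurableType d1} {T2 : measurableType d2}.
Variables (m1 : {sigma_finite_measure set T1 -> \bar R})
  (m2 : {sigma_finite_measure set T2 -> \bar R}) (D1 : set T1) (D2 : set T2).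
Hypotheses (mD1 : measurable D1) (mD2 : measurable D2).

(** Extending f by 0 outside the rectangle turns iterated integrals over D1 and D2 into iterated
    integrals over the whole spaces, where the theorems of Fubini and Tonelli are stated. *)
Let patch12 (f : T1 * T2 -> \bar R) (x : T1) :
  (\int[m2]_y (f \_ (D1 `*` D2)) (x, y) = ((fun x => \int[m2]_(y in D2) f (x, y)) \_ D1) x)%E.
Proof.
rewrite patchE; case: ifPn => xD1.
  rewrite [RHS]integral_mkcond; apply: eq_integral => y _; rewrite !patchE.
  by congr (if _ then _ else _); apply/idP/idP; rewrite !inE /setX/= => //; [case|split => //; exact: set_mem].
rewrite (_ : (fun y => _) = cst 0%E) ?integral0//; apply/funext => y; rewrite patchE ifN//.
by apply: contra xD1; rewrite !inE/= => -[].
Qed.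

Let patch21 (f : T1 * T2 -> \bar R) (y : T2) :
  (\int[m1]_x (f \_ (D1 `*` D2)) (x, y) = ((fun y => \int[m1]_(x in D1) f (x, y)) \_ D2) y)%E.
Proof.
rewrite patchE; case: ifPn => yD2.
  rewrite [RHS]integral_mkcond; apply: eq_integral => x _; rewrite !patchE.
  by congr (if _ then _ else _); apply/idP/idP; rewrite !inE /setX/= => //; [case|split => //; exact: set_mem].
rewrite (_ : (fun y => _) = cst 0%E) ?integral0//; apply/funext => x; rewrite patchE ifN//.
by apply: contra yD2; rewrite !inE/= => -[].
Qed.

Let mD12 : measurable (D1 `*` D2). Proof. exact: measurableX. Qed.

Lemma tonelli_on (f : T1 * T2 -> R) : measurable_fun setT f ->
  (forall x y, D1 x -> D2 y -> 0 <= f (x, y)) ->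
  (\int[m1]_(x in D1) \int[m2]_(y in D2) (f (x, y))%:E =
   \int[m2]_(y in D2) \int[m1]_(x in D1) (f (x, y))%:E)%E.
Proof.
move=> mf f0; rewrite integral_mkcond [RHS]integral_mkcond.
rewrite -(eq_integral _ _ (fun x _ => patch12 (EFin \o f) x)).
rewrite -[RHS](eq_integral _ _ (fun x _ => patch21 (EFin \o f) x)).
apply: fubini_tonelli.
  apply/(measurable_restrictT _ _).1 => //.
  by apply: measurable_funTS; apply/measurable_EFinP.
move=> [x y]; rewrite patchE; case: ifPn => //; rewrite inE => -[/= ? ?].
by rewrite lee_fin; exact: f0.
Qed.

Let integrableT_prod (a : T1 -> \bar R) (b : T2 -> \bar R) :
  m1.-integrable setT a -> m2.-integrable setT b ->
  (m1 \x m2)%E.-integrable setT (fun z => a z.1 * b z.2)%E.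
Proof.
move=> /integrableP[ma aoo] /integrableP[mb boo].
have mab : measurable_fun setT (fun z : T1 * T2 => a z.1 * b z.2)%E.
  by apply: emeasurable_funM; apply: measurableT_comp.
apply/integrable12ltyP => //=.
have B0 : (0 <= \int[m2]_y `|b y|)%E by apply: integral_ge0.
rewrite (eq_integral (fun x => `|a x| * \int[m2]_y `|b y|)%E); last first.
  move=> x _; rewrite -ge0_integralZl//; last exact: measurableT_comp.
  by apply: eq_integral => y _; rewrite abseM.
rewrite ge0_integralZr//; last exact: measurableT_comp.
by apply: lte_mul_pinfty => //; [apply: integral_ge0|rewrite ge0_fin_numE//; apply: integral_ge0].
Qed.

(** A bound by a product of integrable functions of one variable each makes f integrable on the
    product. The applications below all have this form: a constant, a test function or an
    exponential in each variable. *)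
Lemma fubini_bounded (f : T1 * T2 -> R) (a : T1 -> R) (b : T2 -> R) :
  measurable_fun setT f ->
  m1.-integrable D1 (EFin \o a) -> m2.-integrable D2 (EFin \o b) ->
  (forall x y, D1 x -> D2 y -> `|f (x, y)| <= a x * b y) ->
  (\int[m1]_(x in D1) \int[m2]_(y in D2) (f (x, y))%:E =
   \int[m2]_(y in D2) \int[m1]_(x in D1) (f (x, y))%:E)%E.
Proof.
move=> mf /(integrable_mkcond _ mD1) ia /(integrable_mkcond _ mD2) ib fab.
rewrite integral_mkcond [RHS]integral_mkcond.
rewrite -(eq_integral _ _ (fun x _ => patch12 (EFin \o f) x)).
rewrite -[RHS](eq_integral _ _ (fun x _ => patch21 (EFin \o f) x)).
apply: (@Fubini _ _ _ _ _ m1 m2).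
apply: le_integrable (integrableT_prod ia ib) => //.
  apply/(measurable_restrictT _ _).1 => //.
  by apply: measurable_funTS; apply/measurable_EFinP.
move=> -[x y] _ /=; rewrite !patchE; case: ifPn => [/set_mem[/= xD yD]|_].
  by rewrite !mem_set// -EFinM lee_fin (le_trans (fab _ _ xD yD))// ler_norm.
by rewrite [X in (`|X| <= _)%E](_ : _ = 0%E)// abse0 abse_ge0.
Qed.

End fubini_on_sets.

Section dominated.
Context {R : realType} d {T : measurableType d} (m : {measure set T -> \bar R}).

Lemma dominated_cvgR (D : set T) (f_ : (T -> R)^nat) (f g : T -> R) :
  measurable D -> (forall n, measurable_fun D (f_ n)) ->
  (forall x, D x -> f_ n x @[n --> \oo] --> f x) ->
  m.-integrable D (EFin \o g) ->
  (forall n x, D x -> `|f_ n x| <= g x) ->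
  (\int[m]_(x in D) (f_ n x)%:E)%E @[n --> \oo] --> (\int[m]_(x in D) (f x)%:E)%E.
Proof.
move=> mD mf_ f_f ig fg.
apply: (@dominated_cvg _ _ _ m D mD (fun n => EFin \o f_ n) (EFin \o f) (EFin \o g)) => //.
- by move=> n; apply/measurable_EFinP.
- by move=> x Dx /=; apply: cvg_EFin; [exact: nearW|exact: f_f].
Qed.

Lemma le_integrableR (D : set T) (f g : T -> R) : measurable D ->
  measurable_fun D f -> (forall x, D x -> `|f x| <= g x) ->
  m.-integrable D (EFin \o g) -> m.-integrable D (EFin \o f).
Proof.
move=> mD mf fg; apply: le_integrable => //; first exact/measurable_EFinP.
by move=> x Dx /=; rewrite lee_fin (le_trans (fg x Dx)) ?ler_norm.
Qed.

Lemma integrable_ge0 (D : set T) (f : T -> R) (r : R) : measurable D ->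
  measurable_fun D f -> (forall x, D x -> 0 <= f x) ->
  (\int[m]_(x in D) (f x)%:E = r%:E)%E -> m.-integrable D (EFin \o f).
Proof.
move=> mD mf f0 fr; apply/integrableP; split; first exact/measurable_EFinP.
rewrite (_ : integral _ _ _ = r%:E) ?ltry// -fr; apply: eq_integral => x /set_mem Dx /=.
by rewrite ger0_norm// f0.
Qed.

End dominated.

Lemma cvg_EFinI {R : realType} (u : R^nat) (l : R) :
  (u n)%:E @[n --> \oo] --> l%:E -> u n @[n --> \oo] --> l.
Proof. by move=> /fine_cvgP[]. Qed.

(** * Measures given by a density *)

Section density_measure.
Context {R : realType} d {T : measurableType d} (m : {measure set T -> \bar R}).
Variable f : T -> R.
Hypotheses (mf : measurable_fun setT f) (f0 : forall x, 0 <= f x).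

Definition density_measure_fun (A : set T) : \bar R := (\int[m]_(x in A) (f x)%:E)%E.

Let density0 : density_measure_fun set0 = 0%E.
Proof. exact: integral_set0. Qed.

Let density_ge0 A : (0 <= density_measure_fun A)%E.
Proof. by apply: integral_ge0 => x _; rewrite lee_fin. Qed.

Let density_sigma_additive : semi_sigma_additive density_measure_fun.
Proof.
move=> F mF tF mUF; rewrite /density_measure_fun ge0_integral_bigcup//; last 2 first.
- by apply: measurable_funTS; exact/measurable_EFinP.
- by move=> x _; rewrite lee_fin.
by apply: is_cvg_ereal_nneg_natsum_cond => n _ _; exact: density_ge0.
Qed.

HB.instance Definition _ := isMeasure.Build _ _ _ density_measure_fun
  density0 density_ge0 density_sigma_additive.

Definition density_measure : {measure set T -> \bar R} := density_measure_fun.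

End density_measure.

Section integral_density.
Context {R : realType} d {T : measurableType d} (m : {measure set T -> \bar R}).
Variable f : T -> R.
Hypotheses (mf : measurable_fun setT f) (f0 : forall x, 0 <= f x).
Local Notation nu := (density_measure m mf f0).

Import HBNNSimple.

Let integral_density_nnsfun (h : {nnsfun T >-> R}) :
  (\int[nu]_x (h x)%:E = \int[m]_x ((h x)%:E * (f x)%:E))%E.
Proof.
have mif r : measurable_fun setT (fun x => (r * \1_(h @^-1` [set r]) x * f x)%:E).
  apply/measurable_EFinP; apply: measurable_funM => //; apply: measurable_funM => //.
transitivity (\int[m]_x \sum_(r \in range h) (r * \1_(h @^-1` [set r]) x * f x)%:E)%E.
  rewrite ge0_integral_fsum//; last first.
    by move=> r x _; rewrite lee_fin mulr_ge0// -lee_fin; exact: nnfun_muleindic_ge0.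
  rewrite integralT_nnsfun sintegralE; apply: eq_fsbigr => r /set_mem[y _ hyr].
  have r0 : 0 <= r by rewrite -hyr.
  rewrite /nu/= /density_measure_fun.
  rewrite integral_mkcond -ge0_integralZl//; first last.
  - by move=> x _; rewrite patchE; case: ifPn => // _; rewrite lee_fin.
  - apply/(measurable_restrictT _ _).1 => //.
    by apply: measurable_funTS; exact/measurable_EFinP.
  apply: eq_integral => x _; rewrite patchE indicE; case: ifPn => _.
    by rewrite mulr1 EFinM.
  by rewrite mulr0 mul0r mule0.
apply: eq_integral => x _; rewrite -EFinM [in RHS]fimfunE /=.
by rewrite fsumEFin// mulr_fsuml.
Qed.

Lemma ge0_integral_density (h : T -> \bar R) : measurable_fun setT h ->
  (forall x, 0 <= h x)%E ->
  (\int[nu]_x h x = \int[m]_x (h x * (f x)%:E))%E.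
Proof.
move=> mh h0; pose g := nnsfun_approx measurableT mh.
have gh x : (g n x)%:E @[n --> \oo] --> h x.
  exact: (@cvg_nnsfun_approx _ _ _ _ measurableT _ mh (fun x _ => h0 x) x).
have ndg x : {homo (fun n => (g n x)%:E) : n k / (n <= k)%N >-> (n <= k)%E}.
  by move=> a b ab; rewrite lee_fin; exact/lefP/nd_nnsfun_approx.
transitivity (\int[nu]_x limn (fun n => (g n x)%:E))%E.
  by apply: eq_integral => x _; apply/esym/cvg_lim.
transitivity (\int[m]_x limn (fun n => (g n x)%:E * (f x)%:E))%E; last first.
  by apply: eq_integral => x _; apply/cvg_lim => //; apply: cvgeZr.
rewrite monotone_convergence//; last 2 first.
- by move=> n; exact/measurable_EFinP.
- by move=> n x _; rewrite lee_fin.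
rewrite monotone_convergence//; last 3 first.
- by move=> n; apply: emeasurable_funM; exact/measurable_EFinP.
- by move=> n x _; rewrite mule_ge0// lee_fin.
- by move=> x _ a b ab; rewrite lee_wpmul2r ?lee_fin//; exact/lefP/nd_nnsfun_approx.
by congr (limn _); apply/funext => n; exact: integral_density_nnsfun.
Qed.

Lemma integral_density (h : T -> R) : measurable_fun setT h ->
  (\int[nu]_x (h x)%:E = \int[m]_x (h x * f x)%:E)%E.
Proof.
move=> mh; rewrite integralE [RHS]integralE.
rewrite !ge0_integral_density//; last 2 first.
- by apply: measurable_funeneg; exact/measurable_EFinP.
- by apply: measurable_funepos; exact/measurable_EFinP.
congr (_ - _)%E; apply: eq_integral => x _.
  rewrite !funeposE -!EFin_max -EFinM; congr EFin.
  by rewrite maxr_pMl// mul0r.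
rewrite !funenegE -!EFinN -!EFin_max -EFinM; congr EFin.
by rewrite maxr_pMl// mul0r mulNr.
Qed.

End integral_density.

(** * Derivatives and Laplace transforms *)

Section derivative_rules.
Context {R : realType}.
Implicit Types (f g : R -> R) (x a b c : R).

(** Separates computing a derivative from simplifying it: [mder] fills a with the raw expression
    given by the rules, and the remaining equation is left to [field]. *)
Lemma is_derive_eq1 f x a b : is_derive x 1 f a -> a = b -> is_derive x 1 f b.
Proof. by move=> h <-. Qed.

Lemma derD f g x a b : is_derive x 1 f a -> is_derive x 1 g b ->
  is_derive x 1 (fun y => f y + g y) (a + b).
Proof. exact: is_deriveD. Qed.

Lemma derB f g x a b : is_derive x 1 f a -> is_derive x 1 g b ->
  is_derive x 1 (fun y => f y - g y) (a - b).
Proof. exact: is_deriveB. Qed.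

Lemma derN f x a : is_derive x 1 f a -> is_derive x 1 (fun y => - f y) (- a).
Proof. exact: is_deriveN. Qed.

Lemma derM f g x a b : is_derive x 1 f a -> is_derive x 1 g b ->
  is_derive x 1 (fun y => f y * g y) (a * g x + f x * b).
Proof.
move=> h1 h2; apply: is_derive_eq1 (is_deriveM h1 h2) _.
by rewrite addrC /GRing.scale/= (mulrC (g x)).
Qed.

Lemma derV f x a : f x != 0 -> is_derive x 1 f a ->
  is_derive x 1 (fun y => (f y)^-1) (- (a / f x ^+ 2)).
Proof.
move=> h1 h2; apply: is_derive_eq1 (is_deriveV h1 h2) _.
by rewrite /GRing.scale/= mulNr mulrC.
Qed.

Lemma der_comp f g x a b : is_derive (g x) 1 f a -> is_derive x 1 g b ->
  is_derive x 1 (fun y => f (g y)) (a * b).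
Proof. by move=> h1 h2; exact: is_derive1_comp. Qed.

Lemma derX f n x a : is_derive x 1 f a ->
  is_derive x 1 (fun y => f y ^+ n) (n%:R * f x ^+ n.-1 * a).
Proof.
move=> h; rewrite (_ : (fun y => _) = f ^+ n); first exact: is_deriveX.
by apply/funext => y; rewrite exprfctE.
Qed.

Lemma der_expR f x a : is_derive x 1 f a ->
  is_derive x 1 (fun y => expR (f y)) (expR (f x) * a).
Proof. exact: (der_comp (is_derive_expR (f x))). Qed.

Lemma der_cos f x a : is_derive x 1 f a ->
  is_derive x 1 (fun y => cos (f y)) (- sin (f x) * a).
Proof. exact: (der_comp (is_derive_cos (f x))). Qed.

Lemma der_sin f x a : is_derive x 1 f a ->
  is_derive x 1 (fun y => sin (f y)) (cos (f x) * a).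
Proof. exact: (der_comp (is_derive_sin (f x))). Qed.

Lemma der_atan f x a : is_derive x 1 f a ->
  is_derive x 1 (fun y => atan (f y)) ((1 + f x ^+ 2)^-1 * a).
Proof. exact: (der_comp (is_derive1_atan (f x))). Qed.

Lemma der_powR f p x a : 0 < f x -> is_derive x 1 f a ->
  is_derive x 1 (fun y => f y `^ p) (p * f x `^ (p - 1) * a).
Proof. by move=> h; exact: (der_comp (f := (@powR R)^~ p) (is_derive1_powR p h)). Qed.

Lemma der_cst c x : is_derive x 1 (fun=> c) 0.
Proof. exact: is_derive_cst. Qed.

Lemma der_id x : is_derive x 1 (fun y => y) 1.
Proof. exact: is_derive_id. Qed.

Lemma derMid c x : is_derive x 1 ( *%R c) c.
Proof. by apply: is_derive_eq1 (derM (der_cst c x) (der_id x)) _; rewrite mul0r add0r mulr1. Qed.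

Lemma derDid c x : is_derive x 1 ( +%R c) 1.
Proof. by apply: is_derive_eq1 (derD (der_cst c x) (der_id x)) _; rewrite add0r. Qed.

Lemma der_continuous f x a : is_derive x 1 f a -> {for x, continuous f}.
Proof.
by move=> [h _]; apply/differentiable_continuous/derivable1_diffP.
Qed.

Lemma der_cvg_right f x a : is_derive x 1 f a -> f y @[y --> x^'+] --> f x.
Proof. by move=> h; apply: cvg_at_right_filter; exact: der_continuous h. Qed.

End derivative_rules.

(** Constants are tried first, so that constant subterms are not taken apart. Side conditions,
    namely nonzero denominators and positive bases of powers, are left as goals. *)
Ltac mder :=
  first [exact: der_cst | mder_step]
with mder_step :=
  lazymatch goal with
  | |- is_derive _ _ (fun y => y) _ => exact: der_id
  | |- is_derive _ _ (fun y => _ - _) _ => eapply derB; mder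
  | |- is_derive _ _ (fun y => _ + _) _ => eapply derD; mder
  | |- is_derive _ _ (fun y => _ * _) _ => eapply derM; mder
  | |- is_derive _ _ (fun y => - _) _ => eapply derN; mder
  | |- is_derive _ _ (fun y => _^-1) _ => eapply derV; mder
  | |- is_derive _ _ (fun y => _ ^+ _) _ => eapply derX; mder
  | |- is_derive _ _ (fun y => expR _) _ => eapply der_expR; mder
  | |- is_derive _ _ (fun y => cos _) _ => eapply der_cos; mder
  | |- is_derive _ _ (fun y => sin _) _ => eapply der_sin; mder
  | |- is_derive _ _ (fun y => atan _) _ => eapply der_atan; mder
  | |- is_derive _ _ (fun y => _ `^ _) _ => eapply der_powR; mder
  | |- is_derive _ _ ( *%R _) _ => exact: derMid
  | |- is_derive _ _ ( +%R _) _ => exact: derDid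
  | |- is_derive _ _ -%R _ => exact: is_deriveNid
  | |- is_derive _ _ expR _ => exact: is_derive_expR
  | |- is_derive _ _ cos _ => exact: is_derive_cos
  | |- is_derive _ _ sin _ => exact: is_derive_sin
  | |- is_derive _ _ atan _ => exact: is_derive1_atan
  | |- is_derive _ _ _ _ => eassumption
  | |- _ => idtac
  end.

Ltac mcont := eapply der_continuous; mder.

Section laplace_integrals.
Context {R : realType}.
Notation mu := (@lebesgue_measure R).

Lemma ge0_FTCcy (F f : R -> R) (a l : R) :
  (forall x, a <= x -> is_derive x 1 F (f x)) ->
  (forall x, a < x -> {for x, continuous f}) -> F x @[x --> +oo] --> l ->
  (forall x, a < x -> 0 <= f x) ->
  (\int[mu]_(x in `]a, +oo[) (f x)%:E = (l - F a)%:E)%E.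
Proof.
move=> dF cf Fl f0; apply: (ge0_FTCy (fun x ax => dF x (ltW ax)) cf _ Fl f0).
exact: (der_cvg_right (dF a (lexx a))).
Qed.

Lemma FTCcy (F f : R -> R) (a l : R) :
  (forall x, a <= x -> is_derive x 1 F (f x)) ->
  (forall x, a < x -> {for x, continuous f}) -> F x @[x --> +oo] --> l ->
  mu.-integrable `]a, +oo[ (EFin \o f) ->
  (\int[mu]_(x in `]a, +oo[) (f x)%:E = (l - F a)%:E)%E.
Proof.
move=> dF cf Fl fi; apply: (FTCy (fun x ax => dF x (ltW ax)) cf _ Fl fi).
exact: (der_cvg_right (dF a (lexx a))).
Qed.

Lemma cvg_expRNy (s : R) : 0 < s -> expR (- (s * t)) @[t --> +oo] --> 0.
Proof.
move=> s0; apply: (@cvg_comp _ _ _ (fun t => s * t) (fun t => expR (- t)) _ +oo).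
  by apply: gt0_cvgMry => //; exact: cvg_id.
exact: cvgr_expR.
Qed.

Lemma integral_expRN (s a : R) : 0 < s ->
  (\int[mu]_(t in `]a, +oo[) (expR (- (s * t)))%:E = (expR (- (s * a)) / s)%:E)%E.
Proof.
move=> s0; have s0' : s != 0 by rewrite gt_eqF.
rewrite -[X in _ = X%:E]opprK -sub0r.
apply: (@ge0_FTCcy (fun t => - (expR (- (s * t)) / s))).
- by move=> t _; eapply is_derive_eq1; [mder|rewrite /=; field].
- by move=> t _; mcont.
- rewrite -oppr0; apply: cvgN; rewrite -(mul0r s^-1); apply: cvgMr_tmp.
  exact: cvg_expRNy.
- by move=> t _; exact: expR_ge0.
Qed.

Lemma integrable_expRN (s a : R) : 0 < s ->
  mu.-integrable `]a, +oo[ (EFin \o (fun t => expR (- (s * t)))).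
Proof.
move=> s0; apply: (integrable_ge0 _ _ _ (integral_expRN a s0)) => //.
by mfun.
Qed.

Lemma bounded_cvgM0 (f g : R -> R) (M : R) : (forall t, `|f t| <= M) ->
  g t @[t --> +oo] --> 0 -> g t * f t @[t --> +oo] --> 0.
Proof.
move=> fM g0; apply: norm_cvg0.
have g0' : `|g t| * M @[t --> +oo] --> 0.
  by rewrite -(mul0r M); apply: cvgMr_tmp; rewrite -(@normr0 _ R); exact: cvg_norm.
apply: (@squeeze_cvgr _ _ _ _ (cst 0) (fun t => `|g t| * M)) => //.
- by apply: nearW => t; rewrite /= normr_ge0 normrM ler_wpM2l.
- exact: cvg_cst.
Qed.

Lemma integrable_expRN_bounded (s a : R) (f : R -> R) (M : R) : 0 < s ->
  measurable_fun setT f -> (forall t, `|f t| <= M) ->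
  mu.-integrable `]a, +oo[ (EFin \o (fun t => expR (- (s * t)) * f t)).
Proof.
move=> s0 mf fM.
apply: (@le_integrableR R _ (measurableTypeR R) mu _ _ (fun t => M * expR (- (s * t)))) => //.
- by mfun.
- by move=> t _; rewrite normrM mulrC (ger0_norm (expR_ge0 _)) ler_wpM2r ?expR_ge0.
- rewrite (_ : EFin \o _ = (fun t => M%:E * (expR (- (s * t)))%:E)%E); last first.
    by apply/funext => t /=; rewrite EFinM.
  by apply: integrableZl => //; exact: integrable_expRN.
Qed.

Let sqr2_gt0 (s x : R) : 0 < s -> 0 < s ^+ 2 + x ^+ 2.
Proof. by move=> s0; rewrite ltr_wpDr ?sqr_ge0// exprn_gt0. Qed.

Let trig_bound (s x t a b : R) : `|a * sin (t * x) + b * cos (t * x)| <= `|a| + `|b|.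
Proof.
rewrite (le_trans (ler_normD _ _))// !normrM lerD//.
  by rewrite -[leRHS]mulr1 ler_wpM2l// sin_max.
by rewrite -[leRHS]mulr1 ler_wpM2l// cos_max.
Qed.

(** The antiderivative is the real part of - exp (- (s - i x) t) / (s - i x); the sine integral that
    follows uses the imaginary part. *)
Lemma integral_expRN_cos (s x : R) : 0 < s ->
  (\int[mu]_(t in `]0%R, +oo[) (expR (- (s * t)) * cos (t * x))%:E
   = (s / (s ^+ 2 + x ^+ 2))%:E)%E.
Proof.
move=> s0; have s0' := lt0r_neq0 (sqr2_gt0 x s0).
have := @FTCcy (fun t => expR (- (s * t)) * (x * sin (t * x) + (- s) * cos (t * x))
    / (s ^+ 2 + x ^+ 2)) (fun t => expR (- (s * t)) * cos (t * x)) 0 0.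
move=> h; apply: etrans (h _ _ _ _) _; clear h; last 1 first.
- by rewrite !(mulr0, mul0r) oppr0 expR0 sin0 cos0; congr EFin; field.
- by move=> t _; eapply is_derive_eq1; [mder|rewrite /=; field].
- by move=> t _; mcont.
- rewrite -(mul0r (s ^+ 2 + x ^+ 2)^-1); apply: cvgMr_tmp.
  apply: (@bounded_cvgM0 _ _ (`|x| + `|- s|)); last exact: cvg_expRNy.
  by move=> t; exact: trig_bound.
- apply: (@integrable_expRN_bounded _ _ _ 1) => //.
  + by mfun.
  + by move=> t; exact: cos_max.
Qed.

Lemma integral_expRN_sin (s x : R) : 0 < s ->
  (\int[mu]_(t in `]0%R, +oo[) (expR (- (s * t)) * sin (t * x))%:E
   = (x / (s ^+ 2 + x ^+ 2))%:E)%E.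
Proof.
move=> s0; have s0' := lt0r_neq0 (sqr2_gt0 x s0).
have := @FTCcy (fun t => expR (- (s * t)) * ((- s) * sin (t * x) + (- x) * cos (t * x))
    / (s ^+ 2 + x ^+ 2)) (fun t => expR (- (s * t)) * sin (t * x)) 0 0.
move=> h; apply: etrans (h _ _ _ _) _; clear h; last 1 first.
- by rewrite !(mulr0, mul0r) oppr0 expR0 sin0 cos0; congr EFin; field.
- by move=> t _; eapply is_derive_eq1; [mder|rewrite /=; field].
- by move=> t _; mcont.
- rewrite -(mul0r (s ^+ 2 + x ^+ 2)^-1); apply: cvgMr_tmp.
  apply: (@bounded_cvgM0 _ _ (`|- s| + `|- x|)); last exact: cvg_expRNy.
  by move=> t; exact: trig_bound.
- apply: (@integrable_expRN_bounded _ _ _ 1) => //.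
  + by mfun.
  + by move=> t; exact: sin_max.
Qed.

Lemma integral_cauchy (v : R) : 0 < v ->
  (\int[mu]_(t in `]0%R, +oo[) ((v ^+ 2 + t ^+ 2)^-1)%:E = (pi / 2 / v)%:E)%E.
Proof.
move=> v0; have v0' : v != 0 by rewrite gt_eqF.
have := @ge0_FTCcy (fun t => atan (v^-1 * t) / v) (fun t => (v ^+ 2 + t ^+ 2)^-1) 0 (pi / 2 / v).
rewrite mulr0 atan0 mul0r subr0; apply.
- move=> t _; have h := lt0r_neq0 (sqr2_gt0 t v0).
  have h2 : 1 + (v^-1 * t) ^+ 2 != 0 by rewrite gt_eqF// ltr_wpDr ?sqr_ge0.
  by eapply is_derive_eq1; [mder|rewrite /=; field; rewrite h v0'].
- by move=> t _; have h := lt0r_neq0 (sqr2_gt0 t v0); mcont.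
- apply: cvgMr_tmp; apply: (@cvg_comp _ _ _ (fun t => v^-1 * t) atan _ +oo).
    by apply: gt0_cvgMry; [rewrite invr_gt0|exact: cvg_id].
  exact: cvgy_atan.
- by move=> t _; rewrite invr_ge0 ltW// sqr2_gt0.
Qed.

Lemma integrable_cauchy (v : R) : 0 < v ->
  mu.-integrable `]0%R, +oo[ (EFin \o (fun t => (v ^+ 2 + t ^+ 2)^-1)).
Proof.
move=> v0; apply: (integrable_ge0 _ _ _ (integral_cauchy v0)) => //.
- by mfun.
- by move=> t _; rewrite invr_ge0 ltW// sqr2_gt0.
Qed.

End laplace_integrals.

(** * Fourier inversion for test functions *)

Section test_function.
Context {R : realType}.
Notation mu := (@lebesgue_measure R).
Implicit Types (u v x t : R).

(* [test u v x] is [exp (- u x) - exp (- v x)] for [x > 0] and [0] for [x <= 0];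
   [test_cos] and [test_sin] are its cosine and sine transforms. *)
Definition ramp x := (x + `|x|) / 2.
Definition test u v x := expR (- (u * ramp x)) - expR (- (v * ramp x)).
Definition test_cos u v t := u / (u ^+ 2 + t ^+ 2) - v / (v ^+ 2 + t ^+ 2).
Definition test_sin u v t := t / (u ^+ 2 + t ^+ 2) - t / (v ^+ 2 + t ^+ 2).

Lemma ramp_pos x : 0 <= x -> ramp x = x.
Proof. by move=> x0; rewrite /ramp ger0_norm//; field. Qed.

Lemma ramp_neg x : x <= 0 -> ramp x = 0.
Proof. by move=> x0; rewrite /ramp ler0_norm// subrr mul0r. Qed.

Lemma ramp_ge0 x : 0 <= ramp x.
Proof. by case: (leP 0 x) => x0; [rewrite ramp_pos|rewrite ramp_neg// ltW]. Qed.

Lemma measurable_ramp : measurable_fun setT ramp.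
Proof.
apply: measurable_funM => //; apply: measurable_funD => //.
Qed.

Lemma test_pos u v x : 0 <= x -> test u v x = expR (- (u * x)) - expR (- (v * x)).
Proof. by move=> x0; rewrite /test ramp_pos. Qed.

Lemma test_neg u v x : x <= 0 -> test u v x = 0.
Proof. by move=> x0; rewrite /test ramp_neg// !mulr0 subrr. Qed.

Lemma measurable_test u v : measurable_fun setT (test u v).
Proof.
by apply: measurable_funB; apply: measurable_fun_expR; apply: measurable_funN;
  apply: measurable_funM => //; exact: measurable_ramp.
Qed.

Lemma test_ge0 u v x : u <= v -> 0 <= test u v x.
Proof.
by move=> uv; rewrite subr_ge0 ler_expR lerN2 ler_wpM2r// ramp_ge0.
Qed.

Lemma test_le u v x : test u v x <= expR (- (u * ramp x)).
Proof. by rewrite lerBlDr lerDl expR_ge0. Qed.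

Lemma test_le1 u v x : 0 <= u -> test u v x <= 1.
Proof.
move=> u0; rewrite (le_trans (test_le _ _ _))// -expR0 ler_expR oppr_le0.
by rewrite mulr_ge0// ramp_ge0.
Qed.

Lemma cvg_test u v x (y : R^nat) : y n @[n --> \oo] --> x ->
  test u v (y n) @[n --> \oo] --> test u v x.
Proof.
move=> yx; have ry : ramp (y n) @[n --> \oo] --> ramp x.
  by apply: cvgMr_tmp; apply: cvgD => //; exact: cvg_norm.
have h w : expR (- (w * ramp (y n))) @[n --> \oo] --> expR (- (w * ramp x)).
  apply: (@cvg_comp _ _ _ (fun n => - (w * ramp (y n))) expR _ (nbhs (- (w * ramp x)))).
    by apply: cvgN; apply: cvgMl_tmp.
  exact: continuous_expR.
by apply: cvgB.
Qed.

Lemma test_cosE u v t : 0 < u -> 0 < v ->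
  (\int[mu]_(y in `]0%R, +oo[) (cos (t * y) * test u v y)%:E = (test_cos u v t)%:E)%E.
Proof.
move=> u0 v0; rewrite /test_cos EFinB -!integral_expRN_cos// -integralB_EFin//; last 2 first.
- by apply: (@integrable_expRN_bounded _ _ _ _ 1) => // [|y]; [mfun|exact: cos_max].
- by apply: (@integrable_expRN_bounded _ _ _ _ 1) => // [|y]; [mfun|exact: cos_max].
apply: eq_integral => y; rewrite inE/= in_itv/= andbT => y0.
by rewrite test_pos ?ltW// (mulrC t) -EFinB; congr EFin; ring.
Qed.

Lemma test_sinE u v t : 0 < u -> 0 < v ->
  (\int[mu]_(y in `]0%R, +oo[) (sin (t * y) * test u v y)%:E = (test_sin u v t)%:E)%E.
Proof.
move=> u0 v0; rewrite /test_sin EFinB -!integral_expRN_sin// -integralB_EFin//; last 2 first.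
- by apply: (@integrable_expRN_bounded _ _ _ _ 1) => // [|y]; [mfun|exact: sin_max].
- by apply: (@integrable_expRN_bounded _ _ _ _ 1) => // [|y]; [mfun|exact: sin_max].
apply: eq_integral => y; rewrite inE/= in_itv/= andbT => y0.
by rewrite test_pos ?ltW// (mulrC t) -EFinB; congr EFin; ring.
Qed.

Lemma integrable_test u v : 0 < u -> u <= v ->
  mu.-integrable `]0, +oo[ (EFin \o test u v).
Proof.
move=> u0 uv; apply: (@le_integrableR R _ (measurableTypeR R) mu _ _ (fun t => expR (- (u * t)))) => //.
- by apply: measurable_funTS; exact: measurable_test.
- move=> x /=; rewrite in_itv/= andbT => x0.
  by rewrite ger0_norm ?test_ge0// (le_trans (test_le _ _ _))// ramp_pos// ltW.
- exact: integrable_expRN.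
Qed.

(* a bound on both transforms, integrable on the half-line *)
Definition test_dom u v t := u * (u ^+ 2 + t ^+ 2)^-1 + v * (v ^+ 2 + t ^+ 2)^-1
  + (v ^+ 2 - u ^+ 2) / u * (v ^+ 2 + t ^+ 2)^-1.

Lemma measurable_test_cos u v : measurable_fun setT (test_cos u v).
Proof. by rewrite /test_cos; mfun. Qed.

Lemma measurable_test_sin u v : measurable_fun setT (test_sin u v).
Proof. by rewrite /test_sin; mfun. Qed.

Lemma integrable_test_dom u v : 0 < u -> 0 < v ->
  mu.-integrable `]0, +oo[ (EFin \o test_dom u v).
Proof.
move=> u0 v0.
have h k w : 0 < w -> mu.-integrable `]0, +oo[
    (EFin \o (fun t => k * (w ^+ 2 + t ^+ 2)^-1)).
  move=> w0; rewrite (_ : EFin \o _ = (fun t => k%:E * ((w ^+ 2 + t ^+ 2)^-1)%:E)%E).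
    by apply: integrableZl => //; exact: integrable_cauchy.
  by apply/funext => t /=; rewrite EFinM.
rewrite (_ : EFin \o _ = (fun t => ((u * (u ^+ 2 + t ^+ 2)^-1)%:E +
    (v * (v ^+ 2 + t ^+ 2)^-1)%:E) + ((v ^+ 2 - u ^+ 2) / u * (v ^+ 2 + t ^+ 2)^-1)%:E)%E).
  by apply: integrableD => //; [apply: integrableD => //|]; exact: h.
by apply/funext => t /=; rewrite !EFinD.
Qed.

Lemma test_dom_ge u v t : 0 < u -> u <= v -> 0 < t ->
  `|test_cos u v t| + `|test_sin u v t| <= test_dom u v t.
Proof.
move=> u0 uv t0; have v0 := lt_le_trans u0 uv.
have a0 : 0 < u ^+ 2 + t ^+ 2 by rewrite ltr_wpDr ?sqr_ge0// exprn_gt0.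
have b0 : 0 < v ^+ 2 + t ^+ 2 by rewrite ltr_wpDr ?sqr_ge0// exprn_gt0.
apply: lerD.
  apply: le_trans (ler_normB _ _) _.
  by rewrite !ger0_norm// divr_ge0// ltW.
have vu : 0 <= v ^+ 2 - u ^+ 2 by rewrite subr_ge0 lerXn2r// nnegrE ltW.
(* Each of the two fractions of [test_sin] decays only like 1/t. Over a common denominator the
   leading terms cancel, and t / (u^2 + t^2) <= 1/u then gives an integrable bound. *)
have -> : test_sin u v t = (v ^+ 2 - u ^+ 2) * (t / (u ^+ 2 + t ^+ 2)) * (v ^+ 2 + t ^+ 2)^-1.
  by rewrite /test_sin; field; rewrite !gt_eqF.
have t1 : 0 <= t / (u ^+ 2 + t ^+ 2) by rewrite divr_ge0 ?ltW.
rewrite ger0_norm; last by apply: divr_ge0; [exact: mulr_ge0|exact: ltW].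
rewrite ler_wpM2r ?invr_ge0 ?(ltW b0)//; apply: ler_wpM2l => //.
rewrite ler_pdivrMr// mulrC ler_pdivlMr//.
by have := sqr_ge0 (u - t); rewrite sqrrB; have := mulr_gt0 u0 t0; lra.
Qed.

Lemma trig_test_bound u v x t : 0 < u -> u <= v -> 0 < t ->
  `|cos (t * x) * test_cos u v t + sin (t * x) * test_sin u v t| <= test_dom u v t.
Proof.
move=> u0 uv t0; apply: le_trans (test_dom_ge u0 uv t0).
rewrite (le_trans (ler_normD _ _))// !normrM lerD//.
  by rewrite -[leRHS]mul1r ler_wpM2r// cos_max.
by rewrite -[leRHS]mul1r ler_wpM2r// sin_max.
Qed.

End test_function.

Section inversion.
Context {R : realType}.
Notation mu := (@lebesgue_measure R).
Implicit Types (u v s x t : R).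

Lemma integralT_cauchy : (\int[mu]_x ((1 + x ^+ 2)^-1)%:E = (pi : R)%:E)%E.
Proof.
rewrite ge0_symfun_integralT//=; first last.
- by move=> x /=; rewrite sqrrN.
- move=> x; apply: (@cvgV _ _ _ _ (fun y => 1 + y ^+ 2)).
    by rewrite gt_eqF// ltr_wpDr// sqr_ge0.
  by apply: (@der_continuous _ (fun y => 1 + y ^+ 2)); mder.
- by move=> x; rewrite invr_ge0 addr_ge0// sqr_ge0.
rewrite (_ : [set x | _] = `[0%R, +oo[%classic); last first.
  by apply/seteqP; split => x /=; rewrite in_itv/= andbT.
rewrite -integral_itv_obnd_cbnd; last first.
  by apply/measurable_EFinP; mfun.
have := @integral_cauchy R 1 ltr01; rewrite expr1n => ->.
by rewrite divr1 -EFinM; congr EFin; field.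
Qed.

Lemma integrableT_cauchy : mu.-integrable setT (EFin \o (fun x : R => (1 + x ^+ 2)^-1)).
Proof.
apply: (integrable_ge0 _ _ _ integralT_cauchy) => //.
- by mfun.
- by move=> x _; rewrite invr_ge0 addr_ge0// sqr_ge0.
Qed.

(** The factor exp (- s t) makes the double integral in t and y absolutely convergent. Integrating
    in t first yields the Poisson kernel s / (s^2 + (x - y)^2), and y = s w + x turns it into the
    fixed Cauchy weight. *)
Lemma smoothed_inversion u v s x : 0 < u -> u <= v -> 0 < s ->
  (\int[mu]_(t in `]0%R, +oo[)
     (expR (- (s * t)) * (cos (t * x) * test_cos u v t + sin (t * x) * test_sin u v t))%:E
   = \int[mu]_w (test u v (s * w + x) * (1 + w ^+ 2)^-1)%:E)%E.
Proof.
move=> u0 uv s0; have v0 := lt_le_trans u0 uv.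
have mg := measurable_test u v.
pose f (z : measurableTypeR R * measurableTypeR R) :=
  expR (- (s * z.1)) * cos (z.1 * (x - z.2)) * test u v z.2.
have mf : measurable_fun setT f.
  rewrite /f; apply: measurable_funM; last exact: (measurableT_comp mg).
  by mfun.
transitivity (\int[mu]_(t in `]0%R, +oo[) \int[mu]_(y in `]0%R, +oo[) (f (t, y))%:E)%E.
  apply: eq_integral => t _; rewrite /f/=.
  rewrite (eq_integral (fun y : measurableTypeR R => (expR (- (s * t)) * cos (t * x))%:E * (cos (t * y) * test u v y)%:E
    + (expR (- (s * t)) * sin (t * x))%:E * (sin (t * y) * test u v y)%:E)%E); last first.
    by move=> y _ /=; rewrite (mulrBr t x y) cosB -!EFinM -EFinD; congr EFin; ring.
  have ic : mu.-integrable `]0%R, +oo[ (fun y => (cos (t * y) * test u v y)%:E).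
    apply: (@le_integrableR R _ (measurableTypeR R) mu _ _ (test u v)) => //.
    - by apply: measurable_funTS; mfun.
    - move=> y _; rewrite normrM (ger0_norm (test_ge0 _ uv)) -[leRHS]mul1r.
      by rewrite ler_wpM2r ?test_ge0// cos_max.
    - exact: integrable_test.
  have is_ : mu.-integrable `]0%R, +oo[ (fun y => (sin (t * y) * test u v y)%:E).
    apply: (@le_integrableR R _ (measurableTypeR R) mu _ _ (test u v)) => //.
    - by apply: measurable_funTS; mfun.
    - move=> y _; rewrite normrM (ger0_norm (test_ge0 _ uv)) -[leRHS]mul1r.
      by rewrite ler_wpM2r ?test_ge0// sin_max.
    - exact: integrable_test.
  rewrite integralD//; [|exact: integrableZl..].
  rewrite !integralZl// test_cosE// test_sinE// -!EFinM -EFinD; congr EFin; ring.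
rewrite (@fubini_bounded _ _ _ _ _ mu mu _ _ _ _ f (fun t => expR (- (s * t))) (test u v))//;
  first last.
- move=> t y _ _; rewrite /f/= !normrM (ger0_norm (expR_ge0 _)) (ger0_norm (test_ge0 _ uv)).
  rewrite ler_wpM2r ?test_ge0// -[leRHS]mulr1 ler_wpM2l ?expR_ge0// cos_max//.
- exact: integrable_test.
- exact: integrable_expRN.
transitivity (\int[mu]_(y in `]0%R, +oo[) (test u v y * (s / (s ^+ 2 + (x - y) ^+ 2)))%:E)%E.
  apply: eq_integral => y _; rewrite /f/=.
  rewrite (eq_integral (fun t : measurableTypeR R => (test u v y)%:E * (expR (- (s * t)) * cos (t * (x - y)))%:E)%E); last first.
    by move=> t _; rewrite -EFinM; congr EFin; ring.
  rewrite integralZl//; first by rewrite integral_expRN_cos.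
  by apply: (@integrable_expRN_bounded _ _ _ _ 1) => // [|t]; [mfun|exact: cos_max].
(* The test function vanishes for y <= 0, so the integral extends to the whole line, where the
   affine substitution applies. *)
transitivity (\int[mu]_y (test u v y * (s / (s ^+ 2 + (x - y) ^+ 2)))%:E)%E.
  rewrite integral_mkcond; apply: eq_integral => y _; rewrite patchE.
  case: ifPn => //; rewrite notin_setE/= in_itv/= andbT => /negP; rewrite -leNgt => y0.
  by rewrite test_neg// mul0r.
rewrite (@ge0_integral_affine _ s x s0); first last.
- move=> y; rewrite lee_fin mulr_ge0 ?test_ge0// divr_ge0 ?(ltW s0)//.
  by rewrite addr_ge0 ?sqr_ge0.
- by mfun.
rewrite -ge0_integralZl_EFin ?(ltW s0)//; last 2 first.
- move=> y _; rewrite lee_fin mulr_ge0 ?test_ge0// divr_ge0 ?(ltW s0)//.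
  by rewrite addr_ge0 ?sqr_ge0.
- apply/measurable_EFinP; apply: measurable_funM; last by mfun.
  by apply: (measurableT_comp mg); mfun.
apply: eq_integral => w _; rewrite -EFinM; congr EFin.
have w1 : 1 + w ^+ 2 != 0 by rewrite gt_eqF// ltr_wpDr// sqr_ge0.
have s1 : s != 0 by rewrite gt_eqF.
have -> : x - (s * w + x) = - (s * w) by ring.
have -> : s ^+ 2 + (- (s * w)) ^+ 2 = s ^+ 2 * (1 + w ^+ 2) by ring.
by field; rewrite ?w1 ?s1.
Qed.

(** Let s tend to 0 in the smoothed formula. On the left [test_dom] dominates; on the right the test
    function is continuous and at most 1, so the Cauchy density dominates and its total mass pi
    appears. *)
Lemma inversion u v x : 0 < u -> u <= v ->
  (\int[mu]_(t in `]0%R, +oo[)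
     (cos (t * x) * test_cos u v t + sin (t * x) * test_sin u v t)%:E
   = (pi * test u v x)%:E)%E.
Proof.
move=> u0 uv; have v0 := lt_le_trans u0 uv.
have mg := measurable_test u v.
pose s n : R := n.+1%:R^-1.
have s0 n : 0 < s n by rewrite invr_gt0.
have scvg : s n @[n --> \oo] --> 0 by exact: cvg_harmonic.
pose G t := cos (t * x) * test_cos u v t + sin (t * x) * test_sin u v t.
have mG : measurable_fun setT G.
  by rewrite /G; apply: measurable_funD; apply: measurable_funM;
    [mfun|exact: measurable_test_cos|mfun|exact: measurable_test_sin].
have L : (\int[mu]_(t in `]0%R, +oo[) (expR (- (s n * t)) * G t)%:E)%E @[n --> \oo]
    --> (\int[mu]_(t in `]0%R, +oo[) (G t)%:E)%E.
  apply: (@dominated_cvgR R _ (measurableTypeR R) mu _ (fun n t => expR (- (s n * t)) * G t) _ (test_dom u v)) => //.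
  - by move=> n; apply: measurable_funTS; mfun.
  - move=> t _; rewrite -[X in _ --> X]mul1r -expR0; apply: cvgMr_tmp.
    apply: (@cvg_comp _ _ _ (fun n => - (s n * t)) expR _ (nbhs (0 : R))).
      by rewrite -oppr0 -(mul0r t); apply: cvgN; apply: cvgMr_tmp.
    exact: continuous_expR.
  - exact: integrable_test_dom.
  - move=> n t /=; rewrite in_itv/= andbT => t0.
    rewrite normrM (ger0_norm (expR_ge0 _)) (le_trans _ (trig_test_bound x u0 uv t0))//.
    rewrite -[leRHS]mul1r ler_wpM2r// -expR0 ler_expR oppr_le0 mulr_ge0// ltW//.
have Rr : (\int[mu]_w (test u v (s n * w + x) * (1 + w ^+ 2)^-1)%:E)%E @[n --> \oo]
    --> (\int[mu]_w (test u v x * (1 + w ^+ 2)^-1)%:E)%E.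
  apply: (@dominated_cvgR R _ (measurableTypeR R) mu _ (fun n w => test u v (s n * w + x) * (1 + w ^+ 2)^-1) _ (fun w => (1 + w ^+ 2)^-1)) => //.
  - move=> n; apply: measurable_funM; last by mfun.
    by apply: (measurableT_comp mg); mfun.
  - move=> w _; apply: cvgMr_tmp; apply: cvg_test.
    by rewrite -[X in _ --> X]add0r -(mul0r w); apply: cvgD; [exact: cvgMr_tmp|exact: cvg_cst].
  - exact: integrableT_cauchy.
  - move=> n w _; rewrite normrM (ger0_norm (test_ge0 _ uv)).
    rewrite ger0_norm ?invr_ge0 ?addr_ge0 ?sqr_ge0// -[leRHS]mul1r.
    by rewrite ler_wpM2r ?invr_ge0 ?addr_ge0 ?sqr_ge0// test_le1// ltW.
rewrite (_ : (fun n => _) = (fun n =>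
   (\int[mu]_w (test u v (s n * w + x) * (1 + w ^+ 2)^-1)%:E)%E)) in L; last first.
  by apply/funext => n; rewrite -smoothed_inversion.
rewrite (cvg_unique _ L Rr)//.
rewrite (eq_integral (fun w : measurableTypeR R => (test u v x)%:E * ((1 + w ^+ 2)^-1)%:E)%E)//.
rewrite integralZl//; last exact: integrableT_cauchy.
by rewrite integralT_cauchy -EFinM mulrC.
Qed.

(** Only positive frequencies are recorded: by parity they determine the negative ones, and the
    inversion formula integrates over t > 0. *)
Definition has_cf d (T : measurableType d) (P : probability T R) (X : T -> R)
    (C S : R -> R) : Prop :=
  forall t, 0 < t ->
    (\int[P]_w (cos (t * X w))%:E)%E = (C t)%:E /\
    (\int[P]_w (sin (t * X w))%:E)%E = (S t)%:E.

(** Write the test function at X w by the inversion formula and exchange the expectation with the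
    integral in t. The right-hand side involves the law of X only through C and S. *)
Lemma integral_test d (T : measurableType d) (P : probability T R) (X : T -> R)
    (C S : R -> R) u v : measurable_fun setT X ->
  has_cf P X C S ->
  0 < u -> u <= v ->
  (\int[P]_w (test u v (X w))%:E =
   (pi^-1)%:E * \int[mu]_(t in `]0%R, +oo[) (C t * test_cos u v t + S t * test_sin u v t)%:E)%E.
Proof.
move=> mX hCS u0 uv.
have mtX (f : R -> R) : measurable_fun setT f -> measurable_fun setT (fun w => f (X w)).
  by move=> mf; exact: measurableT_comp.
have bint (f : R -> R) : measurable_fun setT f -> (forall x, `|f x| <= 1) ->
    P.-integrable setT (fun w => (f (X w))%:E).
  move=> mf f1; apply: (@le_integrableR _ _ _ _ _ _ (cst 1)) => //.
    exact: mtX.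
  exact: finite_measure_integrable_cst.
pose f (z : T * measurableTypeR R) :=
  cos (z.2 * X z.1) * test_cos u v z.2 + sin (z.2 * X z.1) * test_sin u v z.2.
have mX1 : measurable_fun setT (fun z : T * measurableTypeR R => X z.1).
  exact: measurableT_comp.
have mf : measurable_fun setT f.
  rewrite /f; apply: measurable_funD; apply: measurable_funM.
  - by mfun.
  - exact: (measurableT_comp (measurable_test_cos u v)).
  - by mfun.
  - exact: (measurableT_comp (measurable_test_sin u v)).
transitivity ((pi^-1)%:E * \int[P]_w \int[mu]_(t in `]0%R, +oo[) (f (w, t))%:E)%E.
  rewrite -integralZl//; last first.
    rewrite (_ : (fun w => _) = (fun w => (pi * test u v (X w))%:E)); last first.
      by apply/funext => w; rewrite /f /= inversion.
    apply: (@le_integrableR _ _ _ _ _ _ (cst pi)) => //.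
    - by apply: measurable_funM => //; apply: mtX; exact: measurable_test.
    - move=> w _; rewrite ger0_norm ?mulr_ge0 ?test_ge0 ?pi_ge0//.
      by rewrite -[leRHS]mulr1 ler_wpM2l ?pi_ge0// test_le1// ltW.
    - exact: finite_measure_integrable_cst.
  by apply: eq_integral => w _; rewrite /f /= inversion// -EFinM mulKf// gt_eqF// pi_gt0.
congr (_ * _)%E.
rewrite (@fubini_bounded _ _ _ _ _ P mu _ _ _ _ f (cst 1) (test_dom u v))//; first last.
- move=> w t _ /=; rewrite in_itv/= andbT => t0; rewrite mul1r; exact: trig_test_bound.
- exact/integrable_test_dom/(lt_le_trans u0).
- exact: finite_measure_integrable_cst.
apply: eq_integral => t; rewrite inE/= in_itv/= andbT => t0; rewrite /f/=.
have iC : P.-integrable setT (fun w => (cos (t * X w))%:E).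
  by apply: (bint (fun x => cos (t * x))) => [|x]; [mfun|exact: cos_max].
have iS : P.-integrable setT (fun w => (sin (t * X w))%:E).
  by apply: (bint (fun x => sin (t * x))) => [|x]; [mfun|exact: sin_max].
rewrite (eq_integral (fun w => (test_cos u v t)%:E * (cos (t * X w))%:E
   + (test_sin u v t)%:E * (sin (t * X w))%:E)%E); last first.
  by move=> w _; rewrite -!EFinM -EFinD; congr EFin; ring.
rewrite integralD//; [|exact: integrableZl..].
have [hC hS] := hCS t t0.
by rewrite !integralZl// hC hS -!EFinM -EFinD; congr EFin; ring.
Qed.

End inversion.

(** * Power integrals by contour rotation *)

Section power_integrals.
Context {R : realType}.
Notation mu := (@lebesgue_measure R).
Implicit Types (a b w x K : R).

Lemma cvg_powR0 (T : Type) (F : set_system T) (FF : Filter F) (f : T -> R) b :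
  0 < b -> (\forall x \near F, 0 <= f x) -> f x @[x --> F] --> 0 ->
  f x `^ b @[x --> F] --> 0.
Proof.
move=> b0 f0 ff; apply/cvgr0Pnorm_le => e e0.
have e'0 : 0 < e `^ b^-1 by rewrite powR_gt0.
have {}ff : \forall x \near F, `|f x| <= e `^ b^-1.
  by move/cvgr0Pnorm_le : ff; exact.
near=> x; rewrite ger0_norm ?powR_ge0//.
have fx0 : 0 <= f x by near: x.
have fxe : f x <= e `^ b^-1 by rewrite -(ger0_norm fx0); near: x.
rewrite (le_trans (ge0_ler_powR (ltW b0) _ _ fxe)) ?nnegrE ?powR_ge0//.
by rewrite -powRrM mulVf ?gt_eqF// powRr1// ltW.
Unshelve. all: by end_near. Qed.

Lemma powRD_gt0 x a b : 0 < x -> x `^ (a + b) = x `^ a * x `^ b.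
Proof. by move=> x0; rewrite powRD// (gt_eqF x0) implybT. Qed.

Lemma powR_div x a : 0 < x -> x `^ (a - 1) = x `^ a / x.
Proof. by move=> x0; rewrite powRD_gt0// powR_inv1// ltW. Qed.

Lemma cvg_ratio K : 0 < K -> w / (w + K) @[w --> +oo] --> (1 : R).
Proof.
move=> K0; apply/cvgrPdist_le => e e0; near=> w.
have w0 : 0 < w by near: w; exact: nbhs_pinfty_gt.
have wK : 0 < w + K by rewrite addr_gt0.
rewrite (_ : 1 - w / (w + K) = K / (w + K)); last by field; rewrite gt_eqF.
rewrite ger0_norm ?divr_ge0 ?(ltW K0) ?(ltW wK)// ler_pdivrMr// -ler_pdivrMl//.
by rewrite mulrC (@le_trans _ _ w)// lerDl ltW.
Unshelve. all: by end_near. Qed.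

Lemma cvg_invDy x : (x + w)^-1 @[w --> +oo] --> (0 : R).
Proof.
apply/cvgr0Pnorm_le => e e0; near=> w.
have w0 : 0 < x + w by rewrite -ltrBlDl sub0r; near: w; apply: nbhs_pinfty_gt; exact: num_real.
rewrite ger0_norm ?invr_ge0 ?(ltW w0)// -[leRHS]invrK lef_pV2 ?posrE ?invr_gt0//.
by rewrite -lerBlDl; near: w; apply: nbhs_pinfty_ge; exact: num_real.
Unshelve. all: by end_near. Qed.

(** If the integral were 0, then f would vanish almost everywhere, although it is positive on a set
    of infinite measure. *)
Lemma Rintegral_pos (f : R -> R) : mu.-integrable `]0, +oo[ (EFin \o f) ->
  (forall x, 0 < x -> 0 < f x) -> 0 < \int[mu]_(x in `]0%R, +oo[) f x.
Proof.
move=> fi f0; have f0' x : (`]0%R, +oo[%classic : set R) x -> 0 < f x.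
  by rewrite /= in_itv/= andbT; exact: f0.
rewrite lt_neqAle Rintegral_ge0 ?andbT; last by move=> x /f0'/ltW.
apply/eqP => If0.
have mD : measurable (`]0%R, +oo[%classic : set (measurableTypeR R)) by exact: measurable_itv.
have : (\int[mu]_(x in `]0%R, +oo[) `|(f x)%:E| = 0)%E.
  transitivity (\int[mu]_(x in `]0%R, +oo[) (f x)%:E)%E.
    by apply: eq_integral => x /set_mem/f0' fx; rewrite /= gtr0_norm.
  by rewrite -(fineK (integrable_fin_num mD fi)); congr EFin; exact: esym If0.
move/(ae_eq_integral_abs mu mD (measurable_int _ fi)) => [N [mN N0 DN]].
have : (mu `]0%R, +oo[%classic <= mu N)%E.
  rewrite le_measure ?inE// => x Dx; apply: DN => /= h.
  by have [fx0] : (f x)%:E = 0%:E := h Dx; have := f0' x Dx; rewrite fx0 ltxx.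
by rewrite N0 lebesgue_measure_itv/= ltry.
Qed.

(* density of a heavy-tailed law at scale [K]; its antiderivative is [(w / (w + K)) `^ a] *)
Definition heavy a K w := a * (w / (w + K)) `^ (a - 1) * (K / (w + K) ^+ 2).

Lemma heavy_ge0 a K w : 0 < a -> 0 < K -> 0 <= heavy a K w.
Proof.
move=> a0 K0; apply: mulr_ge0; first by rewrite mulr_ge0 ?powR_ge0 ?(ltW a0).
by rewrite divr_ge0 ?sqr_ge0// ltW.
Qed.

Lemma measurable_heavy a K : measurable_fun setT (heavy a K).
Proof. by rewrite /heavy; mfun. Qed.

Lemma integral_heavy a K : 0 < a -> 0 < K ->
  (\int[mu]_(w in `]0%R, +oo[) (heavy a K w)%:E = 1%E)%E.
Proof.
move=> a0 K0; rewrite -[RHS]/(1%:E) -[X in X%:E]subr0.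
apply: (@ge0_FTCy _ (fun w => (w / (w + K)) `^ a)).
- move=> w w0; have wK : 0 < w + K by rewrite addr_gt0.
  eapply is_derive_eq1; [mder|].
  + by rewrite divr_gt0.
  + by rewrite gt_eqF.
  + by rewrite /heavy /=; field; rewrite gt_eqF.
- move=> w w0; have wK : 0 < w + K by rewrite addr_gt0.
  rewrite /heavy; mcont => //.
  + by rewrite divr_gt0.
  + by rewrite gt_eqF.
  + by rewrite expf_neq0// gt_eqF.
- apply: cvg_powR0 => //.
    near=> w; have w0 : 0 < w by near: w; exact: nbhs_right_gt.
    by rewrite divr_ge0 ?addr_ge0 ?(ltW w0) ?(ltW K0).
  have h : is_derive (0 : R) (1 : R) (fun w : R => w / (w + K)) (K^-1).
    eapply is_derive_eq1; [mder|].
      by rewrite add0r gt_eqF.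
    by rewrite /= !add0r; field; rewrite gt_eqF.
  by have := der_cvg_right h; rewrite mul0r.
- have h : {for (1 : R), continuous (fun x : R => x `^ a)} by mcont.
  have {}h : x `^ a @[x --> (1 : R)] --> (1 : R).
    by have E : (1 : R) `^ a = 1 by [rewrite powR1]; rewrite -[X in _ --> X]E; exact: h.
  exact: (cvg_comp (fun w => w / (w + K)) (fun x => x `^ a) (cvg_ratio K0) h).
- by move=> w _; exact: heavy_ge0.
Unshelve. all: by end_near. Qed.

Lemma integrable_heavy a K : 0 < a -> 0 < K ->
  mu.-integrable `]0, +oo[ (EFin \o heavy a K).
Proof.
move=> a0 K0; apply: (integrable_ge0 _ _ _ (integral_heavy a0 K0)) => //.
- by apply: measurable_funTS; exact: measurable_heavy.
- by move=> w _; exact: heavy_ge0.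
Qed.

Lemma integral_powR_shift a : a < 1 ->
  (\int[mu]_(w in `]0%R, +oo[) ((1 - a) * (1 + w) `^ (a - 2))%:E = 1%E)%E.
Proof.
move=> a1; have a1' : 0 < 1 - a by rewrite subr_gt0.
(* The antiderivative - (1 + w)^(a-1) is written as a positive power of the inverse, so that its
   limit at infinity is an instance of [cvg_powR0]. *)
have := @ge0_FTCcy R (fun w => - ((1 + w)^-1 `^ (1 - a))) (fun w => (1 - a) * (1 + w) `^ (a - 2)) 0 0.
rewrite addr0 invr1 powR1 opprK add0r => h; apply: h.
- move=> w w0; have wK : 0 < 1 + w by rewrite ltr_wpDr.
  eapply is_derive_eq1; [mder|].
  + by rewrite invr_gt0.
  + by rewrite gt_eqF.
  + rewrite /= (_ : (1 + w)^-1 = (1 + w) `^ (-1)) ?powR_inv1 ?(ltW wK)//.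
    rewrite -[in LHS]powR_inv1 ?(ltW wK)// -powRrM.
    have -> : (1 + w) `^ (a - 2) = (1 + w) `^ (-1 * (1 - a - 1)) * (1 + w) ^- 2.
      by rewrite -powR_invn ?(ltW wK)// -powRD_gt0//; congr powR; ring.
    by field; rewrite gt_eqF.
- move=> w w0; have wK : 0 < 1 + w by rewrite addr_gt0.
  by mcont.
- rewrite -oppr0; apply: cvgN; apply: cvg_powR0 => //; last exact: cvg_invDy.
  near=> w; have w0 : 0 < w by near: w; exact: nbhs_pinfty_gt.
  by rewrite invr_ge0 addr_ge0// ltW.
- by move=> w _; rewrite mulr_ge0 ?powR_ge0// ltW.
Unshelve. all: by end_near. Qed.

Lemma integrable_powR_frac a : 0 < a -> a < 1 ->
  mu.-integrable `]0, +oo[ (EFin \o (fun w => w `^ (a - 1) / (1 + w))).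
Proof.
move=> a0 a1.
have i1 := integrable_heavy a0 (@ltr01 R).
have a1' : 0 < 1 - a by rewrite subr_gt0.
have i2 : mu.-integrable `]0, +oo[ (EFin \o (fun w => (1 - a) * (1 + w) `^ (a - 2))).
  apply: (integrable_ge0 _ _ _ (integral_powR_shift a1)) => //.
  - by apply: measurable_funTS; mfun.
  - by move=> w _; rewrite mulr_ge0 ?powR_ge0// ltW.
(* Two integrands with known integrals dominate: [heavy a 1] for w <= 1 and (1 + w)^(a-2) for w > 1.
   The factors 1/a and 1/(1-a) undo their normalisation; the factor 2 pays for replacing 1 + w by 1,
   respectively by w, inside a power with exponent of absolute value below 1. *)
apply: (@le_integrableR R _ (measurableTypeR R) mu _ _
  (fun w => 2 / a * heavy a 1 w + 2 / (1 - a) * ((1 - a) * (1 + w) `^ (a - 2)))) => //; last first.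
- rewrite (_ : EFin \o _ = (fun w => (2 / a)%:E * (heavy a 1 w)%:E +
     (2 / (1 - a))%:E * ((1 - a) * (1 + w) `^ (a - 2))%:E)%E).
    by apply: integrableD => //; exact: integrableZl.
  by apply/funext => w /=; rewrite EFinD !EFinM.
- move=> w /=; rewrite in_itv/= andbT => w0.
  have wK : 0 < 1 + w by rewrite addr_gt0.
  rewrite ger0_norm ?divr_ge0 ?powR_ge0 ?(ltW wK)//.
  have E1 : 2 / a * heavy a 1 w = 2 * w `^ (a - 1) * (1 + w) `^ (- a) / (1 + w).
    rewrite /heavy (addrC w) powRM ?invr_ge0 ?(ltW w0) ?(ltW wK)//.
    rewrite -[(1 + w)^-1 in LHS]powR_inv1 ?(ltW wK)// -powRrM.
    have -> : (1 + w) `^ (- a) = (1 + w) `^ (-1 * (a - 1)) / (1 + w).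
      by rewrite -powR_div//; congr powR; ring.
    by field; rewrite !gt_eqF.
  have E2 : 2 / (1 - a) * ((1 - a) * (1 + w) `^ (a - 2)) = 2 * (1 + w) `^ (a - 1) / (1 + w).
    have -> : (1 + w) `^ (a - 2) = (1 + w) `^ (a - 1) / (1 + w).
      by rewrite -powR_div//; congr powR; ring.
    by field; rewrite !gt_eqF.
  rewrite E1 E2 -mulrDl ler_pM2r ?invr_gt0//.
  have half x : 0 <= x -> x <= 1 -> 2^-1 <= (2 : R) `^ (- x).
    move=> x0 x1; rewrite powRN lef_pV2 ?posrE ?powR_gt0//.
    by rewrite -[leRHS]powRr1//; apply: ler_powR => //; rewrite ler1n.
  have [w1|w1] := leP w 1.
    apply: ler_wpDr; first by rewrite mulr_ge0 ?powR_ge0.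
    rewrite mulrAC -[leLHS]mul1r ler_wpM2r ?powR_ge0//.
    rewrite -ler_pdivrMl// mulr1 (le_trans (half a _ _)) ?(ltW a0) ?(ltW a1)//.
    rewrite !powRN lef_pV2 ?posrE ?powR_gt0// ge0_ler_powR ?(ltW a0) ?nnegrE ?(ltW wK)//.
    lra.
  apply: ler_wpDl; first by rewrite !mulr_ge0 ?powR_ge0.
  have -> : w `^ (a - 1) = 2 * (2^-1 * w `^ (a - 1)) by field.
  rewrite ler_pM2l//; apply: (@le_trans _ _ ((2 * w) `^ (a - 1))).
    rewrite powRM ?(ltW w0)// ler_wpM2r ?powR_ge0//.
    have := half (1 - a) (ltW a1'); rewrite opprB; apply; lra.
  rewrite -[a - 1]opprB !powRN lef_pV2 ?posrE ?powR_gt0 ?mulr_gt0//.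
  rewrite ge0_ler_powR ?(ltW a1') ?nnegrE ?(ltW wK) ?mulr_ge0 ?(ltW w0)//.
  lra.
- by apply: measurable_funTS; mfun.
Qed.

End power_integrals.

(** * Rotation of the half-line through the angle pi / 2 *)

Section rotation.
Context {R : realType}.
Notation mu := (@lebesgue_measure R).
Variable a : R.
Hypotheses (a0 : 0 < a) (a1 : a < 1).
Implicit Types (th w x b : R).

(* real and imaginary parts of [z / (z + w)] for [z = exp (i th)] *)
Let den th w := 1 + 2 * w * cos th + w ^+ 2.
Let re th w := (1 + w * cos th) / den th w.
Let im th w := w * sin th / den th w.

Lemma integrable_powR_frac2 :
  mu.-integrable `]0, +oo[ (EFin \o (fun w => w `^ (a - 1) / (1 + w ^+ 2))) /\
  mu.-integrable `]0, +oo[ (EFin \o (fun w => w `^ a / (1 + w ^+ 2))).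
Proof.
have ib : mu.-integrable `]0, +oo[ (fun w => (2%:E * (w `^ (a - 1) / (1 + w))%:E)%E).
  by apply: integrableZl => //; exact: integrable_powR_frac.
split; apply: (@le_integrableR R _ (measurableTypeR R) mu _ _ (fun w => 2 * (w `^ (a - 1) / (1 + w)))) => //;
  try by mfun.
  move=> w /=; rewrite in_itv/= andbT => w0.
  have w1 : 0 < 1 + w by rewrite addr_gt0.
  have w2 : 0 < 1 + w ^+ 2 by rewrite ltr_wpDr// sqr_ge0.
  rewrite ger0_norm ?divr_ge0 ?powR_ge0 ?(ltW w2)// mulrCA ler_wpM2l ?powR_ge0//.
  rewrite -[leLHS]mul1r ler_pdivrMr// mulrAC ler_pdivlMr// mul1r.
  by have := sqr_ge0 (w - 1); have := sqr_ge0 w; rewrite sqrrB; lra.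
move=> w /=; rewrite in_itv/= andbT => w0.
have w1 : 0 < 1 + w by rewrite addr_gt0.
have w2 : 0 < 1 + w ^+ 2 by rewrite ltr_wpDr// sqr_ge0.
rewrite ger0_norm ?divr_ge0 ?powR_ge0 ?(ltW w2)//.
rewrite -(mulr_powRB1 (ltW w0) a0) mulrAC mulrC [leRHS]mulrCA ler_wpM2l ?powR_ge0//.
rewrite ler_pdivrMr// mulrAC ler_pdivlMr//.
by have := sqr_ge0 (w - 1); rewrite sqrrB; nra.
Qed.

Let bnd w := w `^ (a - 1) / (1 + w).

(** A lower bound - 1/2 on the cosine keeps the denominator comparable with 1 + w^2, and it leaves
    room for angles slightly outside [0, pi / 2], so that the integral can be differentiated at both
    end points. *)
Let den_ge th w : - 2^-1 <= cos th -> 0 < w -> (1 + w ^+ 2) / 2 <= den th w.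
Proof.
move=> c0 w0; have := sqr_ge0 (w - 1); rewrite sqrrB => h.
have : 0 <= w * (cos th + 2^-1) by rewrite mulr_ge0 ?(ltW w0)//; lra.
rewrite /den; nra.
Qed.

Let den_gt0 th w : - 2^-1 <= cos th -> 0 < w -> 0 < den th w.
Proof.
move=> c0 w0; apply: lt_le_trans (den_ge c0 w0).
by rewrite divr_gt0// ltr_wpDr// sqr_ge0.
Qed.

(* [\Re (exp (- i (a th - b)) w^(a-1) z / (z + w))]; since [z / (z + w)] is
   homogeneous of degree 0, its [th]-derivative is the [w]-derivative of [prim] *)
Let fth b th w := w `^ (a - 1) * (cos (a * th - b) * re th w + sin (a * th - b) * im th w).
Let prim b th w := w `^ a * (cos (a * th - b) * im th w - sin (a * th - b) * re th w).

Let dfth b th w := w `^ (a - 1) * (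
   - (a * sin (a * th - b)) * re th w + cos (a * th - b) * (w * sin th * (1 - w ^+ 2) / den th w ^+ 2)
   + (a * cos (a * th - b)) * im th w
   + sin (a * th - b) * (w * (cos th * (1 + w ^+ 2) + 2 * w) / den th w ^+ 2)).

Let fth_der b th w : - 2^-1 <= cos th -> 0 < w ->
  is_derive th 1 (fun x => fth b x w) (dfth b th w).
Proof.
move=> c0 w0; have d0 : den th w != 0 by rewrite gt_eqF// den_gt0.
have E : cos th ^+ 2 = 1 - sin th ^+ 2 by rewrite -(cos2Dsin2 th) addrK.
rewrite /fth /re /im /den; eapply is_derive_eq1; [mder => //|].
rewrite /dfth /re /im /= mul0r add0r -/(den th w); congr (_ * _).
have E2 : w * sin th * (1 - w ^+ 2) = w * sin th * (2 * (1 + w * cos th) - den th w).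
  by rewrite /den; ring.
have E3 : w * (cos th * (1 + w ^+ 2) + 2 * w) = w * (cos th * den th w + 2 * w * sin th ^+ 2).
  by rewrite /den; ring: E.
rewrite E2 E3; field; exact: d0.
Qed.

Let prim_der b th w : - 2^-1 <= cos th -> 0 < w ->
  is_derive w 1 (prim b th) (dfth b th w).
Proof.
move=> c0 w0; have d0 : den th w != 0 by rewrite gt_eqF// den_gt0.
have E : cos th ^+ 2 = 1 - sin th ^+ 2 by rewrite -(cos2Dsin2 th) addrK.
rewrite /prim /re /im /den; eapply is_derive_eq1; [mder => //|].
rewrite /dfth /re /im /= -(mulr_powRB1 (ltW w0) a0).
rewrite /den in d0 *; field: E; exact: d0.
Qed.

(** All three bounds reduce to (1 + w)^2 <= 2 (1 + w^2) <= 4 [den th w]. *)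
Let re_im_bound th w : - 2^-1 <= cos th -> 0 < w ->
  `|re th w| <= 4 / (1 + w) /\ `|im th w| <= 4 / (1 + w) /\ w / den th w <= 4 / (1 + w).
Proof.
move=> c0 w0; have d0 := den_gt0 c0 w0; have dge := den_ge c0 w0.
have w1 : 0 < 1 + w by rewrite addr_gt0.
have H : (1 + w) / den th w <= 4 / (1 + w).
  rewrite ler_pdivrMr// mulrAC ler_pdivlMr// -expr2.
  have := sqr_ge0 (w - 1); rewrite sqrrB sqrrD; lra.
split; last split.
- rewrite /re normrM (ger0_norm (_ : 0 <= (den th w)^-1)) ?invr_ge0 ?(ltW d0)//.
  apply: le_trans H; rewrite ler_pM2r ?invr_gt0// (le_trans (ler_normD _ _))// normr1 lerD2l.
  by rewrite normrM (gtr0_norm w0) -[leRHS]mulr1 ler_wpM2l ?(ltW w0)// cos_max.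
- rewrite /im normrM (ger0_norm (_ : 0 <= (den th w)^-1)) ?invr_ge0 ?(ltW d0)//.
  apply: le_trans H; rewrite ler_pM2r ?invr_gt0//.
  rewrite normrM (gtr0_norm w0) (@le_trans _ _ w)//; last by rewrite lerDr.
  by rewrite -[leRHS]mulr1 ler_wpM2l ?(ltW w0)// sin_max.
- by apply: le_trans H; rewrite ler_pM2r ?invr_gt0// lerDr.
Qed.

Let le_norm_trig x y r : `|x| <= 1 -> `|y| <= r -> `|x * y| <= r.
Proof.
move=> x1 yr; rewrite normrM (le_trans _ yr)// -[leRHS]mul1r ler_wpM2r//.
Qed.

Let fth_bound b th w : - 2^-1 <= cos th -> 0 < w -> `|fth b th w| <= 32 * bnd w.
Proof.
move=> c0 w0; have [r4 [i4 _]] := re_im_bound c0 w0.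
rewrite /fth /bnd normrM (ger0_norm (powR_ge0 _ _)) [leRHS]mulrCA ler_wpM2l ?powR_ge0//.
rewrite (le_trans (ler_normD _ _))//.
have h1 := le_norm_trig (cos_max (a * th - b)) r4.
have h2 := le_norm_trig (sin_max (a * th - b)) i4.
have : 0 <= (1 + w)^-1 by rewrite invr_ge0 addr_ge0// ltW.
lra.
Qed.

Let prim_bound b th w : - 2^-1 <= cos th -> 0 < w -> `|prim b th w| <= 8 * (w `^ a / (1 + w)).
Proof.
move=> c0 w0; have [r4 [i4 _]] := re_im_bound c0 w0.
rewrite /prim normrM (ger0_norm (powR_ge0 _ _)) [leRHS]mulrCA ler_wpM2l ?powR_ge0//.
rewrite (le_trans (ler_normB _ _))//.
have h1 := le_norm_trig (cos_max (a * th - b)) i4.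
have h2 := le_norm_trig (sin_max (a * th - b)) r4.
lra.
Qed.

(** The constant is 32 = 4 + 8 + 4 + 16, one summand for each term of [dfth] in order. Being uniform
    in the angle, the bound permits differentiation under the integral. *)
Let dfth_bound b th w : - 2^-1 <= cos th -> 0 < w -> `|dfth b th w| <= 32 * bnd w.
Proof.
move=> c0 w0; have [r4 [i4 w4]] := re_im_bound c0 w0.
have d0 := den_gt0 c0 w0; have dge := den_ge c0 w0.
have w1 : 0 <= (1 + w)^-1 by rewrite invr_ge0 addr_ge0// ltW.
have H : w * (1 + w ^+ 2) / den th w ^+ 2 <= 8 / (1 + w).
  have -> : 8 / (1 + w) = 2 * (4 / (1 + w)) by ring.
  apply: le_trans (ler_wpM2l _ w4); last by [].
  have -> : w * (1 + w ^+ 2) / den th w ^+ 2 = ((1 + w ^+ 2) / den th w) * (w / den th w).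
    by field; rewrite gt_eqF.
  rewrite ler_wpM2r ?divr_ge0 ?(ltW w0) ?(ltW d0)// ler_pdivrMr//; lra.
have d2 : 0 <= (den th w ^+ 2)^-1 by rewrite invr_ge0 sqr_ge0.
have h1 : `|w * sin th * (1 - w ^+ 2) / den th w ^+ 2| <= 8 / (1 + w).
  apply: le_trans H; rewrite normrM (ger0_norm d2) ler_wpM2r// -mulrA normrM (gtr0_norm w0).
  rewrite ler_wpM2l ?(ltW w0)//; apply: le_norm_trig; first exact: sin_max.
  rewrite (le_trans (ler_normB _ _))// normr1 ger0_norm ?sqr_ge0//.
have h2 : `|w * (cos th * (1 + w ^+ 2) + 2 * w) / den th w ^+ 2| <= 16 / (1 + w).
  have -> : 16 / (1 + w) = 2 * (8 / (1 + w)) by ring.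
  apply: le_trans (ler_wpM2l _ H); last by [].
  rewrite normrM (ger0_norm d2) mulrA ler_wpM2r// normrM (gtr0_norm w0) mulrCA.
  rewrite ler_wpM2l ?(ltW w0)// (le_trans (ler_normD _ _))//.
  have : `|cos th * (1 + w ^+ 2)| <= 1 + w ^+ 2.
    by apply: le_norm_trig; [exact: cos_max|rewrite ger0_norm ?addr_ge0 ?sqr_ge0].
  rewrite (ger0_norm (_ : 0 <= 2 * w)) ?mulr_ge0 ?(ltW w0)//.
  have := sqr_ge0 (w - 1); rewrite sqrrB; lra.
have acl : `|a| <= 1 by rewrite ger0_norm ltW.
rewrite /dfth /bnd normrM (ger0_norm (powR_ge0 _ _)) [leRHS]mulrCA ler_wpM2l ?powR_ge0//.
have t1 := le_norm_trig (cos_max (a * th - b)) h1.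
have t2 := le_norm_trig (sin_max (a * th - b)) h2.
have t3 : `|- (a * sin (a * th - b)) * re th w| <= 4 / (1 + w).
  by rewrite mulNr normrN -mulrA; apply: le_norm_trig => //; apply: le_norm_trig => //; exact: sin_max.
have t4 : `|a * cos (a * th - b) * im th w| <= 4 / (1 + w).
  by rewrite -mulrA; apply: le_norm_trig => //; apply: le_norm_trig => //; exact: cos_max.
apply: le_trans (ler_normD _ _) _.
apply: le_trans (lerD (ler_normD _ _) (lexx _)) _.
apply: le_trans (lerD (lerD (ler_normD _ _) (lexx _)) (lexx _)) _.
lra.
Qed.

Let integrable_bnd32 : mu.-integrable `]0, +oo[ (EFin \o (fun w => 32 * bnd w)).
Proof.
rewrite (_ : EFin \o _ = (fun w => 32%:E * (bnd w)%:E)%E); last first.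
  by apply/funext => w; rewrite /= EFinM.
by apply: integrableZl => //; exact: integrable_powR_frac.
Qed.

Let measurable_fth b th : measurable_fun setT (fth b th).
Proof. by rewrite /fth /re /im /den; mfun. Qed.

Let measurable_dfth b th : measurable_fun setT (dfth b th).
Proof. by rewrite /dfth /re /im /den; mfun. Qed.

Let integrable_fth b th : - 2^-1 <= cos th ->
  mu.-integrable `]0, +oo[ (EFin \o fth b th).
Proof.
move=> c0; apply: (@le_integrableR R _ (measurableTypeR R) mu _ _ (fun w => 32 * bnd w)) => //.
- by apply: measurable_funTS; exact: measurable_fth.
- by move=> w /=; rewrite in_itv/= andbT; exact: fth_bound.
Qed.

Let integrable_dfth b th : - 2^-1 <= cos th ->
  mu.-integrable `]0, +oo[ (EFin \o dfth b th).
Proof.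
move=> c0; apply: (@le_integrableR R _ (measurableTypeR R) mu _ _ (fun w => 32 * bnd w)) => //.
- by apply: measurable_funTS; exact: measurable_dfth.
- by move=> w /=; rewrite in_itv/= andbT; exact: dfth_bound.
Qed.

(** As a function of w, [dfth] is the derivative of [prim], which is of order w^a at 0 and w^(a-1)
    at infinity. It vanishes at both ends because 0 < a < 1. *)
Let integral_dfth b th : - 2^-1 <= cos th ->
  (\int[mu]_(w in `]0%R, +oo[) (dfth b th w)%:E = 0%E)%E.
Proof.
move=> c0; rewrite -[RHS]/(0%:E) -[X in X%:E](subr0 (0 : R)).
apply: (@FTCy _ (prim b th)).
- by move=> w w0; exact: prim_der.
- move=> w w0; have d0 : den th w != 0 by rewrite gt_eqF// den_gt0.
  rewrite /dfth /re /im /den in d0 *; mcont => //; exact: expf_neq0.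
- apply: norm_cvg0; apply: (@squeeze_cvgr _ _ _ _ (cst 0) (fun w => 8 * w `^ a)).
  + near=> w; have w0 : 0 < w by near: w; exact: nbhs_right_gt.
    rewrite /= normr_ge0/= (le_trans (prim_bound b c0 w0))// ler_pM2l//.
    by rewrite ler_pdivrMr ?addr_gt0// -[leLHS]mulr1 ler_wpM2l ?powR_ge0// lerDl ltW.
  + exact: cvg_cst.
  + by rewrite -[X in _ --> X](mulr0 8); apply: cvgMl_tmp; exact: powR_cvg0.
- apply: norm_cvg0; apply: (@squeeze_cvgr _ _ _ _ (cst 0) (fun w => 8 * (1 + w)^-1 `^ (1 - a))).
  + near=> w; have w0 : 0 < w by near: w; exact: nbhs_pinfty_gt.
    have w1 : 0 < 1 + w by rewrite addr_gt0.
    rewrite /= normr_ge0/= (le_trans (prim_bound b c0 w0))// ler_pM2l//.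
    rewrite -powR_inv1 ?(ltW w1)// -powRrM.
    have -> : -1 * (1 - a) = a - 1 by ring.
    rewrite powR_div// powR_inv1 ?(ltW w1)// ler_pM2r ?invr_gt0//.
    by rewrite ge0_ler_powR ?nnegrE ?(ltW a0) ?(ltW w0) ?(ltW w1)// lerDr.
  + exact: cvg_cst.
  + rewrite -[X in _ --> X](mulr0 8); apply: cvgMl_tmp; apply: cvg_powR0; last exact: cvg_invDy.
      by rewrite subr_gt0.
    near=> w; have w0 : 0 < w by near: w; exact: nbhs_pinfty_gt.
    by rewrite invr_ge0 addr_ge0// ltW.
- exact: integrable_dfth.
Unshelve. all: by end_near. Qed.

Let cos_lower_bound : exists2 d : R, 0 < d &
  forall th, - d < th -> th < pi / 2 + d -> - 2^-1 <= cos th.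
Proof.
have : \forall x \near (0 : R), `|sin x| <= 2^-1.
  have /cvgr0_norm_le : sin x @[x --> (0 : R)] --> 0 by rewrite -[X in _ --> X]sin0; exact: continuous_sin.
  by apply; rewrite invr_gt0.
move=> /nbhs_ballP[e /= e0 he].
(* The cap at 1 keeps - d above - pi / 2, so that the cosine is nonnegative for the angles up to pi
   / 2. *)
exists (Num.min e 1); first by rewrite lt_min e0 ltr01.
move=> th thl thr; have pi1 := @pihalf_ge1 R.
have [tp|tp] := leP th (pi / 2).
  apply: (@le_trans _ _ 0); first by rewrite oppr_le0 invr_ge0.
  apply: cos_ge0_pihalf; rewrite tp andbT (le_trans _ (ltW thl))// lerN2.
  by rewrite (le_trans _ pi1)// ge_min lexx orbT.
have := he (th - pi / 2); rewrite /ball/= sub0r normrN.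
rewrite gtr0_norm ?subr_gt0// ltrBlDl => /(_ _).
rewrite (lt_le_trans thr) ?lerD2l ?ge_min ?lexx// => /(_ isT).
by rewrite sinBpihalf normrN ler_norml => /andP[].
Qed.

(** The real-variable form of the contour rotation: differentiating under the integral sign gives
    the integral of [dfth], which is 0, so the mean value theorem equates the values at the angles 0
    and pi / 2. *)
Let fth_const b :
  \int[mu]_(w in `]0%R, +oo[) fth b (pi / 2) w = \int[mu]_(w in `]0%R, +oo[) fth b 0 w.
Proof.
have [d d0 hd] := cos_lower_bound; have pi1 := @pihalf_ge1 R.
pose F th := \int[mu]_(w in `]0%R, +oo[) fth b th w.
have dF th : - d < th -> th < pi / 2 + d -> is_derive th 1 F 0.
  move=> thl thr.
  have Ia : (`](- d), (pi / 2 + d)[%classic : set R) th by rewrite /= in_itv/= thl.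
  have ider x w : (`](- d), (pi / 2 + d)[%classic : set R) x ->
      (`]0%R, +oo[%classic : set R) w -> is_derive x 1 (fun x => fth b x w) (dfth b x w).
    rewrite /= !in_itv/= andbT => /andP[xl xr] w0; exact/fth_der/w0/hd.
  have h1 : forall x, (`](- d), (pi / 2 + d)[%classic : set R) x ->
      mu.-integrable `]0%R, +oo[ (EFin \o fth b x).
    by move=> x /=; rewrite in_itv/= => /andP[xl xr]; exact/integrable_fth/hd.
  have h2 : forall x w, (`](- d), (pi / 2 + d)[%classic : set R) x ->
      (`]0%R, +oo[%classic : set R) w -> derivable ((fth b) ^~ w) x 1.
    by move=> x w Ix w0; have [] := ider x w Ix w0.
  have h3 : forall x w, (`](- d), (pi / 2 + d)[%classic : set R) x ->
      (`]0%R, +oo[%classic : set R) w -> `|partial1of2 (fth b) x w| <= `|32 * bnd w|.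
    move=> x w Ix w0; rewrite partial1of2E.
    rewrite (@derive_val _ _ _ _ _ _ _ (ider x w Ix w0)).
    apply: le_trans (ler_norm _).
    by move: Ix w0; rewrite /= !in_itv/= andbT => /andP[xl xr] w0; exact/dfth_bound/w0/hd.
  have ib : mu.-integrable `]0%R, +oo[ (EFin \o (fun w => `|32 * bnd w|)).
    exact: integrable_norm.
  have mD : measurable (`]0%R, +oo[%classic : set (measurableTypeR R)) by exact: measurable_itv.
  have D := @derivable_under_integral R _ (measurableTypeR R) mu (fth b) _ mD th _ _ Ia h1 h2 _ (fun=> normr_ge0 _) ib h3.
  have V := @differentiation_under_integral R _ (measurableTypeR R) mu (fth b) _ mD th _ _ Ia h1 h2 _ (fun=> normr_ge0 _) ib h3.
  split => //; rewrite -derive1E V.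
  transitivity (\int[mu]_(w in `]0%R, +oo[) dfth b th w).
    apply: eq_Rintegral => w /set_mem w0; rewrite partial1of2E.
    by rewrite (@derive_val _ _ _ _ _ _ _ (ider th w Ia w0)).
  by rewrite /Rintegral integral_dfth//; exact: hd.
have pi2 : 0 < pi / 2 :> R by rewrite (lt_le_trans _ pi1).
have [] := @MVT _ F (fun=> 0) 0 (pi / 2) pi2.
- move=> x; rewrite in_itv/= => /andP[x0 x1]; apply: dF.
    by rewrite (lt_trans _ x0)// oppr_lt0.
  by rewrite (lt_trans x1)// ltrDl.
- apply: derivable_within_continuous => x; rewrite in_itv/= => /andP[x0 x1].
  have [] // := dF x.
    by rewrite (lt_le_trans _ x0)// oppr_lt0.
  by rewrite (le_lt_trans x1)// ltrDl.
- by move=> x _; rewrite mul0r => /subr0_eq.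
Qed.

(** Euler's integral, equal to pi / sin (pi a). Below it acts as a normalising factor that
    cancels. *)
Definition stable_norm := \int[mu]_(w in `]0%R, +oo[) (w `^ (a - 1) / (1 + w)).

(** The equality of the rotated integrals, read at the two end angles. The phase b is left free: b =
    a pi / 2 isolates the first integral, and b = a pi / 2 - pi / 2 isolates the second. *)
Let fth_eq b :
  cos (a * (pi / 2) - b) * \int[mu]_(w in `]0%R, +oo[) (w `^ (a - 1) / (1 + w ^+ 2)) +
  sin (a * (pi / 2) - b) * \int[mu]_(w in `]0%R, +oo[) (w `^ a / (1 + w ^+ 2)) =
  cos b * stable_norm.
Proof.
have [i1 i2] := integrable_powR_frac2.
have i3 := integrable_powR_frac a0 a1.
have iZ k (f : R -> R) : mu.-integrable `]0%R, +oo[ (EFin \o f) ->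
    mu.-integrable `]0%R, +oo[ (EFin \o (fun w => k * f w)).
  move=> fi; rewrite (_ : EFin \o _ = (fun w => k%:E * (f w)%:E)%E); first exact: integrableZl.
  by apply/funext => w; rewrite /= EFinM.
rewrite /stable_norm -!RintegralZl// -RintegralD//; [|exact: iZ..].
transitivity (\int[mu]_(w in `]0%R, +oo[) fth b (pi / 2) w).
  apply: eq_Rintegral => w; rewrite inE/= in_itv/= andbT => w0.
  rewrite /fth /re /im /den cos_pihalf sin_pihalf -(mulr_powRB1 (ltW w0) a0).
  by rewrite !mulr0 !addr0 mulr1; ring.
rewrite fth_const; apply: eq_Rintegral => w; rewrite inE/= in_itv/= andbT => w0.
rewrite /fth /re /im /den cos0 sin0 mulr0 sub0r cosN sinN; field.
by rewrite gt_eqF ?addr_gt0//= gt_eqF// !addr_gt0 ?exprn_gt0// mulr_gt0// mulr1.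
Qed.

Lemma integral_powR_cos :
  \int[mu]_(w in `]0%R, +oo[) (w `^ (a - 1) / (1 + w ^+ 2)) = stable_norm * cos (pi * a / 2).
Proof.
have := fth_eq (a * (pi / 2)); rewrite subrr cos0 sin0 mul1r mul0r addr0 => ->.
by rewrite mulrC; congr (_ * cos _); ring.
Qed.

Lemma integral_powR_sin :
  \int[mu]_(w in `]0%R, +oo[) (w `^ a / (1 + w ^+ 2)) = stable_norm * sin (pi * a / 2).
Proof.
have := fth_eq (a * (pi / 2) - pi / 2).
rewrite subKr cos_pihalf sin_pihalf mul0r add0r mul1r => ->.
by rewrite cosBpihalf mulrC; congr (_ * sin _); ring.
Qed.

Lemma stable_norm_gt0 : 0 < stable_norm.
Proof.
apply: Rintegral_pos; first exact: integrable_powR_frac.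
by move=> w w0; rewrite divr_gt0 ?powR_gt0// addr_gt0.
Qed.

End rotation.

(** * Approximation of the stable law *)

Section probability_of_measure.
Context {R : realType} d {T : measurableType d} (m : {measure set T -> \bar R}).
Hypothesis m1 : m setT = 1%E.

Definition probability_of_fun : set T -> \bar R := m.

Let p0 : probability_of_fun set0 = 0%E. Proof. exact: measure0. Qed.
Let pge0 A : (0 <= probability_of_fun A)%E. Proof. exact: measure_ge0. Qed.
Let psigma : semi_sigma_additive probability_of_fun.
Proof. exact: measure_semi_sigma_additive. Qed.

HB.instance Definition _ := isMeasure.Build _ _ _ probability_of_fun p0 pge0 psigma.

Let p1 : probability_of_fun setT = 1%E. Proof. exact: m1. Qed.

HB.instance Definition _ := Measure_isProbability.Build _ _ _ probability_of_fun p1.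

Definition probability_of : probability T R := probability_of_fun.
End probability_of_measure.

Section density_on.
Context {R : realType}.
Notation mu := (@lebesgue_measure R).

Lemma density_probability (D : set (measurableTypeR R)) (f : R -> R) :
  measurable D -> measurable_fun setT f -> (forall x, D x -> 0 <= f x) ->
  (\int[mu]_(x in D) (f x)%:E = 1%E)%E ->
  exists Q : probability (measurableTypeR R) R,
    (forall h : R -> \bar R, measurable_fun setT h -> (forall x, 0 <= h x)%E ->
      (\int[Q]_x h x = \int[mu]_(x in D) (h x * (f x)%:E))%E) /\
    (forall h : R -> R, measurable_fun setT h ->
      (\int[Q]_x (h x)%:E = \int[mu]_(x in D) (h x * f x)%:E)%E).
Proof.
move=> mD mf f0 f1.
pose g : measurableTypeR R -> R := f \_ D.
have g0 x : 0 <= g x.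
  by rewrite /g patchE; case: ifPn => // /set_mem; exact: f0.
have mg : measurable_fun setT g.
  by apply/(measurable_restrictT _ _).1 => //; exact: measurable_funTS.
pose m := density_measure mu mg g0.
have gE (h : R -> \bar R) : (\int[mu]_x (h x * (g x)%:E) = \int[mu]_(x in D) (h x * (f x)%:E))%E.
  rewrite [RHS]integral_mkcond; apply: eq_integral => x _.
  by rewrite /g !patchE; case: ifPn => // _; rewrite mule0.
have m1 : m setT = 1%E.
  rewrite /m/= /density_measure_fun -f1 -[RHS]/(\int[mu]_(x in D) (f x)%:E)%E.
  rewrite -[RHS](eq_integral _ _ (fun x _ => mul1e _)) -gE.
  by apply: eq_integral => x _; rewrite mul1e.
exists (probability_of m1); split => h mh.
  move=> h0; rewrite -gE -(ge0_integral_density _ mg g0)//.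
transitivity (\int[mu]_x (h x * g x)%:E)%E; first exact: (integral_density _ mg g0).
exact: (gE (EFin \o h)).
Qed.

End density_on.

(** * Laplace transforms paired with characteristic functions *)

Section realizable.
Context {R : realType}.
Notation mu := (@lebesgue_measure R).
Implicit Types L C S : R -> R.

Lemma bounded_integrable d (T : measurableType d) (P : probability T R) (f : T -> R) :
  measurable_fun setT f -> (forall x, `|f x| <= 1) -> P.-integrable setT (EFin \o f).
Proof.
move=> mf f1; apply: (@le_integrableR _ _ _ _ _ _ (cst 1)) => //.
exact: finite_measure_integrable_cst.
Qed.

Lemma integral_prod_bounded d1 d2 (T1 : measurableType d1) (T2 : measurableType d2)
    (P1 : probability T1 R) (P2 : probability T2 R) (f : T1 * T2 -> R) :
  measurable_fun setT f -> (forall x, `|f x| <= 1) ->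
  (\int[P1 \x P2]_z (f z)%:E = \int[P1]_x \int[P2]_y (f (x, y))%:E)%E.
Proof.
move=> mf f1; rewrite -integral12_prod_meas1//.
exact: (@bounded_integrable _ _ (P1 \x P2)%E).
Qed.

(* [L], [C] and [S] are the Laplace transform and the real and imaginary parts of
   the characteristic function of some nonnegative random variable. *)
Definition realizable L C S := exists d (T : measurableType d) (P : probability T R)
  (X : T -> R), [/\ measurable_fun setT X, (forall w, 0 <= X w),
    (forall u, 0 < u -> (\int[P]_w (expR (- (u * X w)))%:E)%E = (L u)%:E) & has_cf P X C S].

Let expRN_le1 (x : R) : 0 <= x -> `|expR (- x)| <= 1.
Proof. by move=> x0; rewrite ger0_norm ?expR_ge0// -expR0 ler_expR oppr_le0. Qed.

Let intD d (T : measurableType d) (P : probability T R) (f g : T -> R) (k l x y : R) :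
  measurable_fun setT f -> measurable_fun setT g ->
  (forall w, `|f w| <= 1) -> (forall w, `|g w| <= 1) ->
  (\int[P]_w (f w)%:E = x%:E)%E -> (\int[P]_w (g w)%:E = y%:E)%E ->
  (\int[P]_w (k * f w + l * g w)%:E = (k * x + l * y)%:E)%E.
Proof.
move=> mf mg f1 g1 fx gy; have fi := bounded_integrable P mf f1; have gi := bounded_integrable P mg g1.
rewrite (eq_integral (fun w => k%:E * (f w)%:E + l%:E * (g w)%:E)%E); last first.
  by move=> w _; rewrite EFinD !EFinM.
rewrite integralD//; [|exact: integrableZl..].
by rewrite !integralZl// fx gy.
Qed.

(** Take the sum of the two variables on the product space. The formulas for the cosine and sine
    parts are those of complex multiplication. *)
Lemma realizable_mul L1 C1 S1 L2 C2 S2 : realizable L1 C1 S1 -> realizable L2 C2 S2 ->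
  realizable (fun u => L1 u * L2 u) (fun t => C1 t * C2 t - S1 t * S2 t)
    (fun t => S1 t * C2 t + C1 t * S2 t).
Proof.
move=> [d1 [T1 [P1 [X1 [mX1 X10 LX1 CX1]]]]] [d2 [T2 [P2 [X2 [mX2 X20 LX2 CX2]]]]].
have mX1' : measurable_fun setT (fun z : T1 * T2 => X1 z.1) by exact: measurableT_comp.
have mX2' : measurable_fun setT (fun z : T1 * T2 => X2 z.2) by exact: measurableT_comp.
exists _, (T1 * T2)%type, (P1 \x P2)%E, (fun z => X1 z.1 + X2 z.2); split.
- exact: measurable_funD.
- by move=> z; rewrite addr_ge0.
- move=> u u0; rewrite integral_prod_bounded//; last 2 first.
  + by mfun.
  + by move=> z; apply: expRN_le1; rewrite mulr_ge0 ?addr_ge0// ltW.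
  rewrite (eq_integral (fun x => (expR (- (u * X1 x)))%:E * (L2 u)%:E)%E); last first.
    move=> x _; rewrite -LX2// -ge0_integralZl_EFin ?expR_ge0//; last by mfun.
    by apply: eq_integral => y _; rewrite -EFinM -expRD mulrDr opprD.
  rewrite integralZr//; first by rewrite LX1.
  apply: (@bounded_integrable _ _ P1 (fun x => expR (- (u * X1 x)))); first by mfun.
  by move=> x; apply: expRN_le1; rewrite mulr_ge0// ltW.
- move=> t t0; have [hC1 hS1] := CX1 t t0; have [hC2 hS2] := CX2 t t0.
  have mc1 : measurable_fun setT (fun x => cos (t * X1 x)) by mfun.
  have ms1 : measurable_fun setT (fun x => sin (t * X1 x)) by mfun.
  have mc2 : measurable_fun setT (fun x => cos (t * X2 x)) by mfun.
  have ms2 : measurable_fun setT (fun x => sin (t * X2 x)) by mfun.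
  split.
  + rewrite integral_prod_bounded//; [|by mfun|by move=> z; exact: cos_max].
    rewrite (eq_integral (fun x => (C2 t * cos (t * X1 x) + (- S2 t) * sin (t * X1 x))%:E)); last first.
      move=> x _; rewrite (eq_integral (fun y => (cos (t * X1 x) * cos (t * X2 y) + (- sin (t * X1 x)) * sin (t * X2 y))%:E)).
        rewrite (intD _ _ mc2 ms2 _ _ hC2 hS2); last 2 first.
        * by move=> ?; exact: cos_max.
        * by move=> ?; exact: sin_max.
        by congr EFin; ring.
      by move=> y _; rewrite /= mulrDr cosD mulNr.
    rewrite (intD _ _ mc1 ms1 _ _ hC1 hS1); last 2 first.
    * by move=> ?; exact: cos_max.
    * by move=> ?; exact: sin_max.
    by congr EFin; ring.
  + rewrite integral_prod_bounded//; [|by mfun|by move=> z; exact: sin_max].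
    rewrite (eq_integral (fun x => (S2 t * cos (t * X1 x) + C2 t * sin (t * X1 x))%:E)); last first.
      move=> x _; rewrite (eq_integral (fun y => (sin (t * X1 x) * cos (t * X2 y) + cos (t * X1 x) * sin (t * X2 y))%:E)).
        rewrite (intD _ _ mc2 ms2 _ _ hC2 hS2); last 2 first.
        * by move=> ?; exact: cos_max.
        * by move=> ?; exact: sin_max.
        by congr EFin; ring.
      by move=> y _; rewrite /= mulrDr sinD.
    rewrite (intD _ _ mc1 ms1 _ _ hC1 hS1); last 2 first.
    * by move=> ?; exact: cos_max.
    * by move=> ?; exact: sin_max.
    by congr EFin; ring.
Qed.

(* The iterated map is multiplication by the complex number [x t + i * y t]. *)
Lemma realizable_exp L x y n : realizable L x y ->
  realizable (fun u => L u ^+ n.+1)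
    (fun t => (iter n (fun p => (p.1 * x t - p.2 * y t, p.2 * x t + p.1 * y t)) (x t, y t)).1)
    (fun t => (iter n (fun p => (p.1 * x t - p.2 * y t, p.2 * x t + p.1 * y t)) (x t, y t)).2).
Proof.
move=> h; elim: n => [|n ih]; first exact: h.
rewrite (_ : (fun u => _) = (fun u => L u ^+ n.+1 * L u)); first exact: realizable_mul ih h.
by apply/funext => u; rewrite exprSr.
Qed.

End realizable.

Section heavy_variable.
Context {R : realType}.
Notation mu := (@lebesgue_measure R).

(** The variable is a standard exponential divided by an independent variable of density
    [heavy a K]. Given the denominator w, its Laplace transform is w / (w + u) and its
    characteristic function is w / (w - i t) = (w^2 + i w t) / (w^2 + t^2). *)
Lemma realizable_heavy (a K : R) : 0 < a -> 0 < K ->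
  realizable (fun u => \int[mu]_(w in `]0%R, +oo[) (w / (w + u) * heavy a K w))
    (fun t => \int[mu]_(w in `]0%R, +oo[) (w ^+ 2 / (w ^+ 2 + t ^+ 2) * heavy a K w))
    (fun t => \int[mu]_(w in `]0%R, +oo[) (w * t / (w ^+ 2 + t ^+ 2) * heavy a K w)).
Proof.
move=> a0 K0.
have mD : measurable (`]0%R, +oo[%classic : set (measurableTypeR R)) by exact: measurable_itv.
have [Q1 [_ Q1E]] := density_probability mD (measurable_heavy a K)
  (fun x _ => heavy_ge0 x a0 K0) (integral_heavy a0 K0).
have e1 : (\int[mu]_(y in `]0%R, +oo[) (expR (- (1 * y)))%:E = 1%E)%E.
  by rewrite integral_expRN// mulr0 oppr0 expR0 divr1.
have [Q2 [_ Q2E]] := density_probability mD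
  (ltac:(mfun) : measurable_fun setT (fun y : R => expR (- (1 * y))))
  (fun y _ => expR_ge0 _) e1.
(* The absolute value makes X nonnegative everywhere; both coordinates are almost surely positive,
   so it does not change the law. *)
pose X (z : measurableTypeR R * measurableTypeR R) : R := `|z.2 / z.1|.
have mX : measurable_fun setT X by apply: measurableT_comp => //; mfun.
have mXx x : measurable_fun setT (fun y : measurableTypeR R => X (x, y)).
  by apply: measurableT_comp => //; rewrite /=; mfun.
have XE x y : 0 < y -> X (x, y) = y / `|x| by move=> y0; rewrite /X/= normrM normfV gtr0_norm.
(* Where the denominator is 0, the quotient is 0 by convention and its Laplace and cosine transforms
   equal 1 instead of h 0. The indicator of 0 records this value, which is lost on integrating over
   w > 0. *)
have ind (h : R -> R) : measurable_fun setT h ->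
    (\int[Q1]_x (h x + \1_[set 0] x)%:E = \int[mu]_(w in `]0%R, +oo[) (h w * heavy a K w)%:E)%E.
  move=> mh; rewrite Q1E; last by apply: measurable_funD => //; exact: measurable_indic.
  apply: eq_integral => w; rewrite inE/= in_itv/= andbT => w0.
  by rewrite indicE memNset/= ?addr0//; apply/eqP; rewrite gt_eqF.
have fin (h : R -> R) : measurable_fun setT h -> (forall w, 0 < w -> `|h w| <= 1) ->
    (\int[mu]_(w in `]0%R, +oo[) (h w * heavy a K w)%:E)%E =
    (\int[mu]_(w in `]0%R, +oo[) (h w * heavy a K w))%:E.
  move=> mh h1; rewrite fineK//; apply: integrable_fin_num => //.
  apply: (@le_integrableR R _ (measurableTypeR R) mu _ _ (heavy a K)) => //.
  - by apply: measurable_funTS; apply: measurable_funM => //; exact: measurable_heavy.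
  - move=> w /=; rewrite in_itv/= andbT => w0.
    by rewrite normrM (ger0_norm (heavy_ge0 w a0 K0)) -[leRHS]mul1r ler_wpM2r ?heavy_ge0// h1.
  - exact: integrable_heavy.
exists _, (measurableTypeR R * measurableTypeR R)%type, (Q1 \x Q2)%E, X; split => //.
- by move=> z; rewrite normr_ge0.
- move=> u u0; rewrite integral_prod_bounded//; [|by mfun|]; last first.
    by move=> z; rewrite ger0_norm ?expR_ge0// -expR0 ler_expR oppr_le0 mulr_ge0 ?(ltW u0) ?normr_ge0.
  transitivity (\int[Q1]_x (`|x| / (`|x| + u) + \1_[set 0] x)%:E)%E.
    apply: eq_integral => x _; have mXy := mXx x; rewrite Q2E; last by mfun.
    rewrite indicE; have [->|x0] := eqVneq x 0.
      rewrite mem_set// normr0 mul0r add0r -e1; apply: eq_integral => y _.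
      by rewrite /X/= invr0 mulr0 normr0 mulr0 oppr0 expR0 mul1r.
    rewrite memNset/= ?addr0; last exact/eqP.
    have nx : 0 < `|x| by rewrite normr_gt0.
    have s0 : 0 < 1 + u / `|x| by rewrite addr_gt0// divr_gt0.
    transitivity (\int[mu]_(y in `]0%R, +oo[) (expR (- ((1 + u / `|x|) * y)))%:E)%E.
      apply: eq_integral => y; rewrite inE/= in_itv/= andbT => y0.
      by rewrite XE// -expRD; congr (expR _)%:E; ring.
    rewrite integral_expRN// mulr0 oppr0 expR0; congr EFin.
    by field; rewrite !gt_eqF// addr_gt0.
  rewrite ind; last by mfun.
  rewrite -fin; last 2 first.
  + by mfun.
  + move=> w w0; have wu : 0 < w + u by rewrite addr_gt0.
    rewrite ger0_norm ?divr_ge0 ?(ltW w0) ?(ltW wu)// ler_pdivrMr// mul1r lerDl ltW//.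
  by apply: eq_integral => w; rewrite inE/= in_itv/= andbT => w0; rewrite gtr0_norm.
- have sq x t : x != 0 -> x ^+ 2 + t ^+ 2 != 0 :> R.
    by move=> x0; rewrite gt_eqF// ltr_wpDr ?sqr_ge0// exprn_even_gt0.
  move=> t t0; split.
  + rewrite integral_prod_bounded//; [|by mfun|by move=> z; exact: cos_max].
    transitivity (\int[Q1]_x (x ^+ 2 / (x ^+ 2 + t ^+ 2) + \1_[set 0] x)%:E)%E.
      apply: eq_integral => x _; have mXy := mXx x; rewrite Q2E; last by mfun.
      rewrite indicE; have [->|x0] := eqVneq x 0.
        rewrite mem_set// expr0n mul0r add0r -e1; apply: eq_integral => y _.
        by rewrite /X/= invr0 mulr0 normr0 mulr0 cos0 mul1r.
      rewrite memNset/= ?addr0; last exact/eqP.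
      transitivity (\int[mu]_(y in `]0%R, +oo[) (expR (- (1 * y)) * cos (y * (t / `|x|)))%:E)%E.
        apply: eq_integral => y; rewrite inE/= in_itv/= andbT => y0.
        by rewrite XE// mulrC; congr (_ * cos _)%:E; ring.
      rewrite integral_expRN_cos//; congr EFin.
      rewrite exprMn exprVn real_normK ?num_real// expr1n.
      by field; rewrite x0 (sq x t x0).
    rewrite ind; last by mfun.
    rewrite fin//; first by mfun.
    move=> w w0; have wu : 0 < w ^+ 2 + t ^+ 2 by rewrite addr_gt0// exprn_gt0.
    by rewrite ger0_norm ?divr_ge0 ?sqr_ge0 ?(ltW wu)// ler_pdivrMr// mul1r lerDl sqr_ge0.
  + rewrite integral_prod_bounded//; [|by mfun|by move=> z; exact: sin_max].
    transitivity (\int[Q1]_x (`|x| * t / (x ^+ 2 + t ^+ 2))%:E)%E.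
      apply: eq_integral => x _; have mXy := mXx x; rewrite Q2E; last by mfun.
      have [->|x0] := eqVneq x 0.
        rewrite normr0 !mul0r -[RHS](integral0 mu (`]0%R, +oo[%classic)); apply: eq_integral => y _.
        by rewrite /X/= invr0 mulr0 normr0 mulr0 sin0 mul0r.
      transitivity (\int[mu]_(y in `]0%R, +oo[) (expR (- (1 * y)) * sin (y * (t / `|x|)))%:E)%E.
        apply: eq_integral => y; rewrite inE/= in_itv/= andbT => y0.
        by rewrite XE// mulrC; congr (_ * sin _)%:E; ring.
      have nx : `|x| != 0 by rewrite normr_eq0.
      rewrite integral_expRN_sin//; congr EFin.
      rewrite -[x ^+ 2](real_normK (num_real x)) expr1n.
      have := sq `|x| t nx => sx.
      by field; rewrite nx sx.
    rewrite Q1E; last by mfun.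
    rewrite -fin; last 2 first.
    * by mfun.
    * move=> w w0; have wu : 0 < w ^+ 2 + t ^+ 2 by rewrite addr_gt0// exprn_gt0.
      rewrite ger0_norm ?divr_ge0 ?mulr_ge0 ?(ltW w0) ?(ltW t0) ?(ltW wu)// ler_pdivrMr// mul1r.
      by have := sqr_ge0 (w - t); rewrite sqrrB; have := mulr_gt0 w0 t0; lra.
    by apply: eq_integral => w; rewrite inE/= in_itv/= andbT => w0; rewrite gtr0_norm.
Qed.
End heavy_variable.

(** * Rescaled limits of the heavy-tailed integrals *)

Section stable_limit.
Context {R : realType}.
Notation mu := (@lebesgue_measure R).

Lemma integral_scale (k : R) (f : R -> R) : 0 < k -> measurable_fun setT f ->
  (forall x, 0 < x -> 0 <= f x) ->
  (\int[mu]_(y in `]0%R, +oo[) (f y)%:E = k%:E * \int[mu]_(x in `]0%R, +oo[) (f (k * x)%R)%:E)%E.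
Proof.
move=> k0 mf f0; have := ge0_integral_itv_affine 0 k0 0 (measurable_fun_norm mf) (fun x => normr_ge0 _).
rewrite mulr0 addr0 => h.
transitivity (\int[mu]_(y in `]0%R, +oo[) `|f y|%:E)%E.
  by apply: eq_integral => x; rewrite inE/= in_itv/= andbT => x0; rewrite ger0_norm ?f0.
rewrite h; congr (_ * _)%E; apply: eq_integral => x; rewrite inE/= in_itv/= andbT => x0.
by rewrite addr0 ger0_norm// f0// mulr_gt0.
Qed.

Variable a : R.
Hypotheses (a0 : 0 < a) (a1 : a < 1).

(* makes [n.+1 * heavy a (heavy_scale n) w] equal, up to a factor tending to 1, to
   [w `^ (a - 1) / stable_norm a] *)
Definition heavy_scale n := (a * n.+1%:R * stable_norm a) `^ a^-1.

Lemma heavy_scale_gt0 n : 0 < heavy_scale n.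
Proof. by rewrite powR_gt0// !mulr_gt0// stable_norm_gt0. Qed.

Lemma heavy_scale_powR n : heavy_scale n `^ a = a * n.+1%:R * stable_norm a.
Proof. by rewrite -powRrM mulVf ?gt_eqF// powRr1// !mulr_ge0 ?(ltW a0)// ltW// stable_norm_gt0. Qed.

(** The last factor lies between 0 and 1 and tends to 1 with n. It thus provides both the domination
    and the pointwise limit in [heavy_limit]. *)
Let hE n w : 0 < w -> n.+1%:R * heavy a (heavy_scale n) w =
  (stable_norm a)^-1 * w `^ (a - 1) * (heavy_scale n / (w + heavy_scale n)) `^ (a + 1).
Proof.
move=> w0; have K0 := heavy_scale_gt0 n; have s0 : 0 < w + heavy_scale n by rewrite addr_gt0.
have sn0 := stable_norm_gt0 a0 a1.
have KK := heavy_scale_powR n.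
have si0 : 0 < (w + heavy_scale n)^-1 by rewrite invr_gt0.
rewrite /heavy !powRM ?(ltW w0) ?(ltW si0) ?(ltW K0)//.
rewrite (powR_div a si0) (powRD_gt0 a 1 K0) (powRD_gt0 a 1 si0) !powRr1 ?(ltW si0) ?(ltW K0)// KK.
by field; rewrite !gt_eqF.
Qed.

Lemma heavy_scale_cvg (w : R) : 0 < w ->
  heavy_scale n / (w + heavy_scale n) @[n --> \oo] --> (1 : R).
Proof.
move=> w0; have sn0 := stable_norm_gt0 a0 a1.
have cN : (a * n.+1%:R * stable_norm a)^-1 @[n --> \oo] --> (0 : R).
  have -> : (fun n => (a * n.+1%:R * stable_norm a)^-1) =
      (fun n => (a * stable_norm a)^-1 * harmonic n).
    by apply/funext => n; rewrite /harmonic/= -invfM; congr (_^-1); ring.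
  rewrite -[X in _ --> X](mulr0 (a * stable_norm a)^-1).
  by apply: cvgM; [exact: cvg_cst|exact: cvg_harmonic].
have ck : (heavy_scale n)^-1 @[n --> \oo] --> (0 : R).
  have -> : (fun n => (heavy_scale n)^-1) = (fun n => (a * n.+1%:R * stable_norm a)^-1 `^ a^-1).
    apply/funext => n; rewrite /heavy_scale -powRN -[in RHS]powR_inv1 ?mulr_ge0 ?(ltW a0) ?(ltW sn0)//.
    by rewrite -powRrM mulN1r.
  apply: cvg_powR0 => //; first by rewrite invr_gt0.
  by near=> n; rewrite invr_ge0 !mulr_ge0 ?(ltW a0) ?(ltW sn0).
have -> : (fun n => heavy_scale n / (w + heavy_scale n)) =
    (fun n => (1 + w * (heavy_scale n)^-1)^-1).
  apply/funext => n; have K0 := heavy_scale_gt0 n.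
  by field; rewrite !gt_eqF// addr_gt0.
rewrite -[X in _ --> X]invr1; apply: cvgV; first exact: oner_neq0.
rewrite -[X in _ --> X](addr0 1) -(mulr0 w).
by apply: cvgD; [exact: cvg_cst|apply: cvgM => //; exact: cvg_cst].
Unshelve. all: by end_near.
Qed.

(** With an integrand of the form G (w / t), the substitution w = t w' in the limiting integral
    extracts the factor t^a. The Laplace, cosine and sine transforms are three choices of G. *)
Lemma heavy_limit (G : R -> R) (t : R) : 0 < t -> measurable_fun setT G ->
  (forall w, 0 < w -> 0 <= G w) ->
  mu.-integrable `]0, +oo[ (EFin \o (fun w => G w * w `^ (a - 1))) ->
  n.+1%:R * \int[mu]_(w in `]0%R, +oo[) (G (w / t) * heavy a (heavy_scale n) w) @[n --> \oo] -->
  t `^ a * (\int[mu]_(w in `]0%R, +oo[) (G w * w `^ (a - 1)) / stable_norm a).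
Proof.
move=> t0 mG G0 iG; have sn0 := stable_norm_gt0 a0 a1.
have mD : measurable (`]0%R, +oo[%classic : set (measurableTypeR R)) by exact: measurable_itv.
pose g (w : measurableTypeR R) : R := (stable_norm a)^-1 * (G (w / t) * w `^ (a - 1)).
have mGt : measurable_fun setT (fun w : R => G (w / t)) by apply: measurableT_comp => //; mfun.
have mh n : measurable_fun setT (heavy a (heavy_scale n)) by exact: measurable_heavy.
have mg : measurable_fun setT g by rewrite /g; mfun.
have g0 w : 0 < w -> 0 <= g w.
  move=> w0; rewrite /g !mulr_ge0 ?powR_ge0 ?invr_ge0 ?(ltW sn0)//.
  by apply: G0; rewrite divr_gt0.
have gE : (\int[mu]_(w in `]0%R, +oo[) (g w)%:E =
    (t `^ a * (\int[mu]_(w in `]0%R, +oo[) (G w * w `^ (a - 1)) / stable_norm a))%:E)%E.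
  rewrite (integral_scale t0 mg g0).
  rewrite (eq_integral (fun w : measurableTypeR R => (t `^ a / t / stable_norm a)%:E * (G w * w `^ (a - 1))%:E)%E); last first.
    move=> w; rewrite inE/= in_itv/= andbT => w0; rewrite -EFinM; congr EFin.
    rewrite /g powRM ?(ltW t0) ?(ltW w0)// (powR_div a t0) [t * w]mulrC mulfK ?gt_eqF//.
    by rewrite mulrC; ring.
  rewrite integralZl// -[X in (_ * (_ * X))%E]fineK; last by apply: integrable_fin_num.
  by rewrite -!EFinM; congr EFin; rewrite /Rintegral; field; rewrite !gt_eqF.
have ig : mu.-integrable `]0, +oo[ (EFin \o g).
  by apply: (integrable_ge0 mD _ _ gE); [exact: measurable_funTS|move=> w /=; rewrite in_itv/= andbT; exact: g0].
have r01 n w : 0 < w -> 0 <= (heavy_scale n / (w + heavy_scale n)) `^ (a + 1) <= 1.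
  move=> w0; rewrite powR_ge0/=; have K0 := heavy_scale_gt0 n.
  have s0 : 0 < w + heavy_scale n by rewrite addr_gt0.
  have one : (1 : R) = 1 `^ (a + 1) by rewrite powR1.
  rewrite [leRHS]one ge0_ler_powR ?nnegrE ?addr_ge0 ?(ltW a0) ?divr_ge0 ?(ltW K0) ?(ltW s0)//.
  by rewrite ler_pdivrMr// mul1r lerDr ltW.
pose f n (w : measurableTypeR R) : R := n.+1%:R * (G (w / t) * heavy a (heavy_scale n) w).
have fE n w : 0 < w -> f n w = g w * (heavy_scale n / (w + heavy_scale n)) `^ (a + 1).
  by move=> w0; rewrite /f mulrCA hE// /g; ring.
have fg n w : 0 < w -> `|f n w| <= g w.
  move=> w0; have /andP[r0 r1] := r01 n w w0.
  by rewrite fE// normrM (ger0_norm (g0 _ w0)) (ger0_norm r0) ler_piMr// g0.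
have mf n : measurable_fun setT (f n) by have := mh n => mhn; rewrite /f; mfun.
have := @dominated_cvgR R _ (measurableTypeR R) mu _ f g g mD.
have h1 n : measurable_fun (`]0%R, +oo[%classic : set (measurableTypeR R)) (f n) by exact: measurable_funTS (mf n).
have h2 (x : measurableTypeR R) : (`]0%R, +oo[%classic : set (measurableTypeR R)) x -> f n x @[n --> \oo] --> g x.
  rewrite /= in_itv/= andbT => w0.
  have -> : (fun n => f n x) = (fun n => g x * (heavy_scale n / (x + heavy_scale n)) `^ (a + 1)).
    by apply/funext => n; rewrite fE.
  rewrite [X in _ --> X](_ : _ = g x * 1 `^ (a + 1)); last by rewrite powR1 mulr1.
  apply: cvgM; first exact: cvg_cst.
  have [d D] : exists d, is_derive (1 : R) 1 (fun y : R => y `^ (a + 1)) d.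
    by eexists; eapply is_derive_eq1; [mder|reflexivity].
  exact: (cvg_comp _ _ (heavy_scale_cvg w0) (der_continuous D)).
have h3 n (x : measurableTypeR R) : (`]0%R, +oo[%classic : set (measurableTypeR R)) x -> `|f n x| <= g x.
  by rewrite /= in_itv/= andbT; exact: fg.
move=> /(_ h1 h2 ig h3); rewrite gE => h.
apply: cvg_EFinI; apply: cvg_trans h; apply: near_eq_cvg; near=> n.
have ifn : mu.-integrable `]0, +oo[ (EFin \o f n).
  by apply: (le_integrableR mD (h1 n) _ ig); exact: h3.
have iGh : mu.-integrable `]0, +oo[ (EFin \o (fun w : measurableTypeR R => G (w / t) * heavy a (heavy_scale n) w)).
  rewrite (_ : _ \o _ = (fun w => (n.+1%:R^-1)%:E * (EFin \o f n) w)%E).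
    exact: integrableZl.
  by apply/funext => w /=; rewrite -EFinM /f mulKf.
rewrite EFinM /Rintegral fineK; last exact: integrable_fin_num.
by rewrite -integralZl.
Unshelve. all: by end_near.
Qed.

(** As [heavy a K] has mass 1, the defect of the mean of p from 1 is the mean of q. This is the
    small quantity, of order 1/n, to which [heavy_limit] applies. *)
Lemma heavy_compl (K : R) (p q : R -> R) : 0 < K -> measurable_fun setT p -> measurable_fun setT q ->
  (forall w, 0 < w -> 0 <= p w) -> (forall w, 0 < w -> 0 <= q w) ->
  (forall w, 0 < w -> p w + q w = 1) ->
  1 - \int[mu]_(w in `]0%R, +oo[) (p w * heavy a K w) =
  \int[mu]_(w in `]0%R, +oo[) (q w * heavy a K w).
Proof.
move=> K0 mp mq p0 q0 pq.
have mD : measurable (`]0%R, +oo[%classic : set (measurableTypeR R)) by exact: measurable_itv.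
have mh := measurable_heavy a K.
have int (h : R -> R) : measurable_fun setT h -> (forall w, 0 < w -> 0 <= h w <= 1) ->
    mu.-integrable `]0%R, +oo[ (EFin \o (fun w : measurableTypeR R => h w * heavy a K w)).
  move=> mfh h1.
  apply: (@le_integrableR R _ (measurableTypeR R) mu _ _ (heavy a K)) => //.
  - by apply: measurable_funTS; mfun.
  - move=> w /=; rewrite in_itv/= andbT => /h1/andP[h0 hle].
    have hh := heavy_ge0 w a0 K0.
    by rewrite normrM (ger0_norm h0) (ger0_norm hh) -[leRHS]mul1r ler_wpM2r.
  - exact: integrable_heavy.
have i1 : \int[mu]_(w in `]0%R, +oo[) (heavy a K w) = 1.
  by rewrite /Rintegral integral_heavy.
rewrite -i1 -RintegralB//; last 2 first.
- exact: integrable_heavy.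
- by apply: int => // w w0; rewrite p0//= -(pq w w0) lerDl q0.
apply: eq_Rintegral => w; rewrite inE/= in_itv/= andbT => w0.
by rewrite -{1}[heavy a K w]mul1r -mulrBl -(pq w w0) addrC addKr.
Qed.

Let i1w : mu.-integrable `]0, +oo[ (EFin \o (fun w : R => (1 + w)^-1 * w `^ (a - 1))).
Proof.
rewrite (_ : (fun w => _) = (fun w => w `^ (a - 1) / (1 + w))); first exact: integrable_powR_frac.
by apply/funext => w; rewrite mulrC.
Qed.

Let i1w2 : mu.-integrable `]0, +oo[ (EFin \o (fun w : R => (1 + w ^+ 2)^-1 * w `^ (a - 1))).
Proof.
rewrite (_ : (fun w => _) = (fun w => w `^ (a - 1) / (1 + w ^+ 2))); first by have [] := integrable_powR_frac2 a0 a1.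
by apply/funext => w; rewrite mulrC.
Qed.

Let iww2 : mu.-integrable `]0, +oo[ (EFin \o (fun w : R => w / (1 + w ^+ 2) * w `^ (a - 1))).
Proof.
have [_] := integrable_powR_frac2 a0 a1; apply: eq_integrable => //.
move=> w; rewrite inE/= in_itv/= andbT => w0; congr EFin.
by rewrite powR_div//; field; rewrite !gt_eqF// addr_gt0// exprn_gt0.
Qed.

(** Here G w = 1 / (1 + w), whose limiting integral is [stable_norm a] itself; the cosine and sine
    limits use 1 / (1 + w^2) and w / (1 + w^2), evaluated by the rotation. *)
Lemma heavy_laplace_limit (u : R) : 0 < u ->
  n.+1%:R * (1 - \int[mu]_(w in `]0%R, +oo[) (w / (w + u) * heavy a (heavy_scale n) w))
    @[n --> \oo] --> u `^ a.
Proof.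
move=> u0; have s0 := stable_norm_gt0 a0 a1.
have m1 : measurable_fun setT (fun w : R => (1 + w)^-1) by mfun.
have p1 (w : R) : 0 < w -> 0 <= (1 + w)^-1 by move=> w0; rewrite invr_ge0 addr_ge0// ltW.
have := heavy_limit u0 m1 p1 i1w.
rewrite (_ : \int[mu]_(w in _) _ = stable_norm a); last by apply: eq_Rintegral => w _; rewrite mulrC.
rewrite divff ?gt_eqF// mulr1; apply: cvg_trans; apply: near_eq_cvg; near=> n; congr (_ * _).
apply/esym/heavy_compl; [exact: heavy_scale_gt0|by mfun|by mfun|..] => w w0.
- by rewrite divr_ge0 ?addr_ge0 ?(ltW w0) ?(ltW u0).
- by apply: p1; rewrite divr_gt0.
- by field; rewrite !gt_eqF ?addr_gt0.
Unshelve. all: by end_near.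
Qed.

Lemma heavy_cos_limit (t : R) : 0 < t ->
  n.+1%:R * (1 - \int[mu]_(w in `]0%R, +oo[) (w ^+ 2 / (w ^+ 2 + t ^+ 2) * heavy a (heavy_scale n) w))
    @[n --> \oo] --> t `^ a * cos (pi * a / 2).
Proof.
move=> u0; have s0 := stable_norm_gt0 a0 a1.
have m1 : measurable_fun setT (fun w : R => (1 + w ^+ 2)^-1) by mfun.
have p1 (w : R) : 0 < w -> 0 <= (1 + w ^+ 2)^-1 by move=> w0; rewrite invr_ge0 addr_ge0// sqr_ge0.
have := heavy_limit u0 m1 p1 i1w2.
rewrite (_ : \int[mu]_(w in _) _ = stable_norm a * cos (pi * a / 2)); last first.
  by rewrite -integral_powR_cos//; apply: eq_Rintegral => w _; rewrite mulrC.
rewrite [stable_norm a * _]mulrC mulfK ?gt_eqF//; apply: cvg_trans; apply: near_eq_cvg; near=> n; congr (_ * _).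
apply/esym/heavy_compl; [exact: heavy_scale_gt0|by mfun|by mfun|..] => w w0.
- by rewrite divr_ge0 ?addr_ge0 ?sqr_ge0.
- by apply: p1; rewrite divr_gt0.
- by field; rewrite !gt_eqF ?addr_gt0 ?exprn_gt0.
Unshelve. all: by end_near.
Qed.

Lemma heavy_sin_limit (t : R) : 0 < t ->
  n.+1%:R * \int[mu]_(w in `]0%R, +oo[) (w * t / (w ^+ 2 + t ^+ 2) * heavy a (heavy_scale n) w)
    @[n --> \oo] --> t `^ a * sin (pi * a / 2).
Proof.
move=> u0; have s0 := stable_norm_gt0 a0 a1.
have m1 : measurable_fun setT (fun w : R => w / (1 + w ^+ 2)) by mfun.
have p1 (w : R) : 0 < w -> 0 <= w / (1 + w ^+ 2).
  by move=> w0; rewrite divr_ge0 ?addr_ge0 ?sqr_ge0 ?(ltW w0).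
have := heavy_limit u0 m1 p1 iww2.
rewrite (_ : \int[mu]_(w in _) _ = stable_norm a * sin (pi * a / 2)); last first.
  rewrite -integral_powR_sin//; apply: eq_Rintegral => w; rewrite inE/= in_itv/= andbT => w0.
  by rewrite powR_div//; field; rewrite !gt_eqF// addr_gt0// exprn_gt0.
rewrite [stable_norm a * _]mulrC mulfK ?gt_eqF//; apply: cvg_trans; apply: near_eq_cvg; near=> n; congr (_ * _).
apply: eq_Rintegral => w; rewrite inE/= in_itv/= andbT => w0; congr (_ * _).
by field; rewrite !gt_eqF ?addr_gt0 ?exprn_gt0.
Unshelve. all: by end_near.
Qed.

End stable_limit.

(** * Limits of powers of real and complex numbers close to 1 *)

Section power_limits.
Context {R : realType}.

(** The hypothesis on h forces it to tend to 0, and there f is d times the identity to first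
    order. *)
Lemma scaled_derive_limit (f : R -> R) (d A : R) (h : R^nat) : is_derive (0 : R) 1 f d -> f 0 = 0 ->
  n.+1%:R * h n @[n --> \oo] --> A -> n.+1%:R * f (h n) @[n --> \oo] --> A * d.
Proof.
move=> df f0 hA.
have h0 : h n @[n --> \oo] --> (0 : R).
  have -> : h = (fun n => harmonic n * (n.+1%:R * h n)).
    by apply/funext => n; rewrite /harmonic/= mulKf.
  by rewrite -[X in _ --> X](mul0r A); apply: cvgM => //; exact: cvg_harmonic.
(* The difference quotient, filled in with d at 0. It is continuous at 0, and f x = x g x holds even
   when a term of the sequence is 0. *)
pose g (x : R) := if x == 0 then d else f x / x.
have cg : {for (0 : R), continuous g}.
  apply/continuous_withinNx; rewrite {2}/g eqxx.
  have := @ex_derive _ _ _ _ _ _ _ df; have := @derive_val _ _ _ _ _ _ _ df.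
  rewrite /derive/derivable => <- dv.
  apply: cvg_trans dv; apply: near_eq_cvg; near=> x.
  have x0 : x != 0 by near: x; exact: nbhs_dnbhs_neq.
  by rewrite /g (negbTE x0) f0 subr0 /= addr0 [x%:A]mulr1 [LHS]mulrC.
have -> : (fun n => n.+1%:R * f (h n)) = (fun n => (n.+1%:R * h n) * g (h n)).
  apply/funext => n; rewrite /g; case: eqVneq => [->|hn]; first by rewrite f0 !mulr0 mul0r.
  by rewrite -mulrA; congr (_ * _); field.
apply: cvgM => //; have := cvg_comp _ _ h0 cg.
by rewrite /g eqxx.
Unshelve. all: by end_near.
Qed.

Let der_ln1 : is_derive (0 : R) 1 (fun h => ln (1 - h)) (-1).
Proof.
eapply is_derive_eq1; first eapply der_comp; [|mder|].
  by apply: is_derive1_ln; rewrite subr0.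
by rewrite subr0 invr1 mul1r add0r.
Qed.

Let cvg1 (x : R^nat) (A : R) : n.+1%:R * (1 - x n) @[n --> \oo] --> A -> x n @[n --> \oo] --> (1 : R).
Proof.
move=> h; have -> : x = (fun n => 1 - harmonic n * (n.+1%:R * (1 - x n))).
  by apply/funext => n; rewrite /harmonic/= mulKf//; ring.
rewrite -[X in _ --> X](subr0 1) -(mul0r A).
apply: cvgB; first exact: cvg_cst.
by apply: cvgM => //; exact: cvg_harmonic.
Qed.

(** Take the logarithm: ln (1 - h) has derivative -1 at 0, and x n is eventually positive. *)
Lemma pow_limit (x : R^nat) (A : R) : n.+1%:R * (1 - x n) @[n --> \oo] --> A ->
  x n ^+ n.+1 @[n --> \oo] --> expR (- A).
Proof.
move=> h; have x1 := cvg1 h.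
have := scaled_derive_limit der_ln1 (_ : ln (1 - 0) = 0) h.
rewrite subr0 ln1 => /(_ erefl); rewrite mulrN1 => hl.
have := cvg_comp _ _ hl (@continuous_expR R _); apply: cvg_trans; apply: near_eq_cvg; near=> n.
have x0 : 0 < x n by near: n; exact: (cvgr_gt _ x1).
by rewrite /= opprB addrC subrK expRM_natl lnK.
Unshelve. all: by end_near.
Qed.

Lemma iter_polar (rho eta : R) n :
  iter n (fun p => (p.1 * (rho * cos eta) - p.2 * (rho * sin eta),
                    p.2 * (rho * cos eta) + p.1 * (rho * sin eta)))
    (rho * cos eta, rho * sin eta) =
  (rho ^+ n.+1 * cos (n.+1%:R * eta), rho ^+ n.+1 * sin (n.+1%:R * eta)).
Proof.
elim: n => [|n ih]; first by rewrite !mul1r expr1.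
rewrite iterS ih/= -[n.+2]addn1 natrD mulrDl mul1r cosD sinD exprD expr1.
by congr (_, _); ring.
Qed.

Let der_lncos : is_derive (0 : R) 1 (fun z => ln (cos (atan z))) 0.
Proof.
eapply is_derive_eq1; first eapply der_comp; [|mder|].
  by apply: is_derive1_ln; rewrite atan0 cos0.
by rewrite atan0 sin0 oppr0 !mul0r mulr0.
Qed.

Let der_atan0 : is_derive (0 : R) 1 (atan : R -> R) 1.
Proof.
eapply is_derive_eq1; first mder.
by rewrite expr0n addr0 invr1.
Qed.

(** The power of x + i y is computed in polar form, with argument atan (y / x) and modulus x / cos
    (atan (y / x)). The argument times n.+1 tends to B. The cosine, raised to the same power, tends
    to 1, since ln (cos (atan z)) has derivative 0 at z = 0. *)
Lemma iter_pow_limit (x y : R^nat) (A B : R) :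
  n.+1%:R * (1 - x n) @[n --> \oo] --> A -> n.+1%:R * y n @[n --> \oo] --> B ->
  let z n := iter n (fun p => (p.1 * x n - p.2 * y n, p.2 * x n + p.1 * y n)) (x n, y n) in
  (z n).1 @[n --> \oo] --> expR (- A) * cos B /\
  (z n).2 @[n --> \oo] --> expR (- A) * sin B.
Proof.
move=> hx hy z; have x1 := cvg1 hx; have xA := pow_limit hx.
have hq : n.+1%:R * (y n / x n) @[n --> \oo] --> B.
  rewrite -[B]divr1; under eq_fun do rewrite mulrA.
  by apply: cvgM => //; apply: cvgV => //; exact: oner_neq0.
have hl : n.+1%:R * ln (cos (atan (y n / x n))) @[n --> \oo] --> (0 : R).
  rewrite -[X in _ --> X](mulr0 B); apply: (scaled_derive_limit der_lncos) => //.
  by rewrite atan0 cos0 ln1.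
have he : n.+1%:R * atan (y n / x n) @[n --> \oo] --> B.
  by rewrite -[B]mulr1; apply: (scaled_derive_limit der_atan0) => //; exact: atan0.
have hr : (x n / cos (atan (y n / x n))) ^+ n.+1 @[n --> \oo] --> expR (- A).
  have := cvg_comp _ _ hl (@continuous_expR R _).
  rewrite expR0 => h; rewrite -[X in _ --> X]divr1.
  have hh : x n ^+ n.+1 * (expR (n.+1%:R * ln (cos (atan (y n / x n)))))^-1 @[n --> \oo] --> expR (- A) / 1.
    by apply: cvgM => //; apply: cvgV => //; exact: oner_neq0.
  apply: cvg_trans hh; apply: near_eq_cvg; near=> n.
  rewrite /= expRM_natl lnK ?exprMn ?exprVn// posrE cos_atan invr_gt0 sqrtr_gt0.
  by rewrite ltr_wpDr ?sqr_ge0.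
have zE : \forall n \near \oo, z n =
    ((x n / cos (atan (y n / x n))) ^+ n.+1 * cos (n.+1%:R * atan (y n / x n)),
     (x n / cos (atan (y n / x n))) ^+ n.+1 * sin (n.+1%:R * atan (y n / x n))).
  near=> n; have x0 : 0 < x n by near: n; exact: (cvgr_gt _ x1).
  have c0 : 0 < cos (atan (y n / x n)).
    by rewrite cos_atan invr_gt0 sqrtr_gt0 ltr_wpDr ?sqr_ge0.
  have : tan (atan (y n / x n)) = y n / x n by rewrite atanK.
  rewrite /tan => h; rewrite -iter_polar divfK ?gt_eqF//.
  rewrite (_ : x n / _ * sin _ = y n)// mulrAC -mulrA h.
  by field; rewrite gt_eqF.
split.
- have h : (x n / cos (atan (y n / x n))) ^+ n.+1 * cos (n.+1%:R * atan (y n / x n)) @[n --> \oo] --> expR (- A) * cos B.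
    by apply: cvgM => //; exact: cvg_comp _ _ he (@continuous_cos R _).
  by apply: cvg_trans h; apply: near_eq_cvg; near=> n; rewrite (near zE n _).
- have h : (x n / cos (atan (y n / x n))) ^+ n.+1 * sin (n.+1%:R * atan (y n / x n)) @[n --> \oo] --> expR (- A) * sin B.
    by apply: cvgM => //; exact: cvg_comp _ _ he (@continuous_sin R _).
  by apply: cvg_trans h; apply: near_eq_cvg; near=> n; rewrite (near zE n _).
Unshelve. all: by end_near.
Qed.

End power_limits.

(** * Laplace transform of the stable law *)

Section stable_transform.
Context {R : realType}.
Notation mu := (@lebesgue_measure R).

Section has_cf_theory.
Context d (T : measurableType d) (P : probability T R) (X : T -> R).
Hypothesis mX : measurable_fun setT X.
Variables (g F : R -> R).
Hypotheses (mg : measurable_fun setT g) (g1 : forall x, `|g x| <= 1).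
Hypothesis gF : forall t, 0 < t -> (\int[P]_w (g (t * X w))%:E = (F t)%:E)%E.

Let mgX (t : R) : measurable_fun setT (fun w => g (t * X w)).
Proof. by apply: measurableT_comp => //; mfun. Qed.

Lemma mean_le1 t : 0 < t -> `|F t| <= 1.
Proof.
move=> t0; rewrite -lee_fin -abse_EFin -gF//.
apply: le_trans (le_abse_integral _ _ _) _ => //; first by apply/measurable_EFinP.
apply: (@le_trans _ _ (\int[P]_w (cst 1 w))%E).
  apply: ge0_le_integral => //=.
  - by have := mgX t => m; mfun.
  - by move=> w _; rewrite lee_fin.
by rewrite integral_cst// mul1e probability_le1.
Qed.

(** The transforms of an approximant are known only as expectations; dominated convergence in t
    requires them to be measurable in t. *)
Lemma mean_measurable : measurable_fun (`]0%R, +oo[%classic : set (measurableTypeR R)) F.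
Proof.
have mX2 : measurable_fun setT (fun z : measurableTypeR R * T => X z.2) by exact: measurableT_comp.
(* Adding 1 makes the integrand nonnegative, as the measurability part of Tonelli's theorem
   requires. *)
have mf : measurable_fun setT (fun z : measurableTypeR R * T => (1 + g (z.1 * X z.2))%:E).
  apply/measurable_EFinP; apply: measurable_funD; first by mfun.
  by apply: measurableT_comp => //; mfun.
have f0 (z : measurableTypeR R * T) : (0 <= (1 + g (z.1 * X z.2))%:E)%E.
  by rewrite lee_fin -lerBlDl sub0r; have := g1 (z.1 * X z.2); rewrite ler_norml => /andP[].
have := @measurable_fun_fubini_tonelli_F _ _ (measurableTypeR R) T R P _ mf f0; rewrite /fubini_F/= => m.
have -> : F = (fun t => (1 + F t) - 1) by apply/funext => t; rewrite addrC addKr.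
apply: measurable_funB; last exact: measurable_cst.
apply/measurable_EFinP.
apply/(measurable_fun_eqP (fun t : R => \int[P]_w (1 + g (t * X w))%:E)%E).
  move=> t; rewrite inE/= in_itv/= andbT => t0.
  rewrite (eq_integral (fun w => 1 + (g (t * X w))%:E)%E)//.
  rewrite integralD//; last 2 first.
  - exact: finite_measure_integrable_cst.
  - exact: (@bounded_integrable _ _ _ P (fun w => g (t * X w))).
  by rewrite integral_cst// mul1e [X in (X + _)%E](@probability_setT _ _ _ P) gF.
exact: measurable_funTS.
Qed.
End has_cf_theory.

(** Real part, for t > 0, of exp (- t^a exp (- i pi a / 2)); [stable_im] is the imaginary part. *)
Definition stable_re a t : R := expR (- (t `^ a * cos (pi * a / 2))) * cos (t `^ a * sin (pi * a / 2)).
Definition stable_im a t : R := expR (- (t `^ a * cos (pi * a / 2))) * sin (t `^ a * sin (pi * a / 2)).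

Lemma measurable_stable_re a : measurable_fun setT (stable_re a).
Proof. by rewrite /stable_re; mfun. Qed.

Lemma measurable_stable_im a : measurable_fun setT (stable_im a).
Proof. by rewrite /stable_im; mfun. Qed.

(** On a nonnegative variable the test function is the difference of two exponentials, so its mean
    is a difference of Laplace transforms. *)
Lemma realizable_test L C S u v : realizable L C S -> 0 < u -> u <= v ->
  (\int[mu]_(t in `]0%R, +oo[) (C t * test_cos u v t + S t * test_sin u v t)%:E
   = (pi * (L u - L v))%:E)%E.
Proof.
move=> [d [T [P [X [mX X0 LX hcf]]]]] u0 uv; have v0 := lt_le_trans u0 uv.
have := integral_test mX hcf u0 uv.
have b x w : 0 < x -> `|expR (- (x * X w))| <= 1.
  by move=> x0; rewrite ger0_norm ?expR_ge0// -expR0 ler_expR oppr_le0 mulr_ge0 ?(ltW x0).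
have me x : measurable_fun setT (fun w => expR (- (x * X w))) by mfun.
rewrite (eq_integral (fun w => (expR (- (u * X w)))%:E - (expR (- (v * X w)))%:E)%E); last first.
  by move=> w _; rewrite test_pos.
rewrite integralB//; last 2 first.
- by apply: (@bounded_integrable _ _ _ P (fun w => expR (- (u * X w)))) => // w; exact: b.
- by apply: (@bounded_integrable _ _ _ P (fun w => expR (- (v * X w)))) => // w; exact: b.
rewrite !LX// -EFinB => /(congr1 (fun x => pi%:E * x)%E).
by rewrite muleA -!EFinM divff ?gt_eqF ?pi_gt0// mul1e => <-.
Qed.

Lemma realizable_cf L C S : realizable L C S ->
  [/\ measurable_fun (`]0%R, +oo[%classic : set (measurableTypeR R)) C, measurable_fun (`]0%R, +oo[%classic : set (measurableTypeR R)) S &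
   forall t, 0 < t -> `|C t| <= 1 /\ `|S t| <= 1].
Proof.
move=> [d [T [P [X [mX _ _ hcf]]]]].
have hC t (t0 : 0 < t) := (hcf t t0).1; have hS t (t0 : 0 < t) := (hcf t t0).2.
have mcos : measurable_fun [set: R] cos by exact: (measurable_fun_cos (@measurable_id _ R setT)).
have msin : measurable_fun [set: R] sin by exact: (measurable_fun_sin (@measurable_id _ R setT)).
split.
- exact: (mean_measurable mX mcos (@cos_max R) hC).
- exact: (mean_measurable mX msin (@sin_max R) hS).
- move=> t t0; split; first exact: (mean_le1 mX mcos (@cos_max R) hC).
  exact: (mean_le1 mX msin (@sin_max R) hS).
Qed.

Lemma stable_approximation a : 0 < a -> a < 1 -> exists L C S : nat -> R -> R,
  [/\ forall n, realizable (L n) (C n) (S n),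
    forall u, 0 < u -> L n u @[n --> \oo] --> expR (- (u `^ a)),
    forall t, 0 < t -> C n t @[n --> \oo] --> stable_re a t &
    forall t, 0 < t -> S n t @[n --> \oo] --> stable_im a t].
Proof.
move=> a0 a1.
pose x n t := \int[mu]_(w in `]0%R, +oo[) (w ^+ 2 / (w ^+ 2 + t ^+ 2) * heavy a (heavy_scale a n) w).
pose y n t := \int[mu]_(w in `]0%R, +oo[) (w * t / (w ^+ 2 + t ^+ 2) * heavy a (heavy_scale a n) w).
pose z n t := iter n (fun p => (p.1 * x n t - p.2 * y n t, p.2 * x n t + p.1 * y n t)) (x n t, y n t).
pose L n u := \int[mu]_(w in `]0%R, +oo[) (w / (w + u) * heavy a (heavy_scale a n) w).
have cz t : 0 < t -> (z n t).1 @[n --> \oo] --> stable_re a t /\ (z n t).2 @[n --> \oo] --> stable_im a t.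
  by move=> t0; apply: iter_pow_limit; [exact: heavy_cos_limit|exact: heavy_sin_limit].
exists (fun n u => L n u ^+ n.+1), (fun n t => (z n t).1), (fun n t => (z n t).2); split.
- by move=> n; apply: realizable_exp; apply: realizable_heavy => //; exact: heavy_scale_gt0.
- by move=> u u0; apply: pow_limit; exact: heavy_laplace_limit.
- by move=> t /cz[].
- by move=> t /cz[].
Qed.

(** The identity holds for every approximant. Characteristic functions have parts bounded by 1, so
    [test_dom] dominates the left-hand side, and the right-hand side converges by the explicit
    Laplace transforms. *)
Lemma stable_inversion a u v : 0 < a -> a < 1 -> 0 < u -> u <= v ->
  (\int[mu]_(t in `]0%R, +oo[) (stable_re a t * test_cos u v t + stable_im a t * test_sin u v t)%:E
   = (pi * (expR (- (u `^ a)) - expR (- (v `^ a))))%:E)%E.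
Proof.
move=> a0 a1 u0 uv; have v0 := lt_le_trans u0 uv.
pose D : set (measurableTypeR R) := `]0%R, +oo[%classic.
have mD : measurable D by exact: measurable_itv.
have [L [C [S [rz cL cC cS]]]] := stable_approximation a0 a1.
have := @dominated_cvgR R _ (measurableTypeR R) mu D
  (fun n t => C n t * test_cos u v t + S n t * test_sin u v t)
  (fun t => stable_re a t * test_cos u v t + stable_im a t * test_sin u v t) (test_dom u v) mD.
have h1 n : measurable_fun D (fun t => C n t * test_cos u v t + S n t * test_sin u v t).
  have [mC mS _] := realizable_cf (rz n).
  by apply: measurable_funD; apply: measurable_funM => //; apply: measurable_funTS;
    [exact: measurable_test_cos|exact: measurable_test_sin].
have h2 t : D t -> C n t * test_cos u v t + S n t * test_sin u v t @[n --> \oo] -->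
    stable_re a t * test_cos u v t + stable_im a t * test_sin u v t.
  rewrite /D/= in_itv/= andbT => t0; have c1 := cC t t0; have c2 := cS t t0.
  by apply: cvgD; apply: cvgM => //; exact: cvg_cst.
have h4 n t : D t -> `|C n t * test_cos u v t + S n t * test_sin u v t| <= test_dom u v t.
  rewrite /D/= in_itv/= andbT => t0; have [_ _ /(_ t t0)[b1 b2]] := realizable_cf (rz n).
  apply: le_trans (ler_normD _ _) _; apply: le_trans (test_dom_ge u0 uv t0).
  by rewrite !normrM lerD// -[leRHS]mul1r ler_wpM2r.
move=> /(_ h1 h2 (integrable_test_dom u0 v0) h4) h.
apply/esym/(cvg_unique _ _ h) => //.
rewrite (_ : (fun n => _) = (fun n => (pi * (L n u - L n v))%:E)); last first.
  by apply/funext => n; rewrite (realizable_test (rz n)).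
apply: cvg_EFin; first by near=> n.
by apply: cvgM; [exact: cvg_cst|apply: cvgB; exact: cL].
Unshelve. all: by end_near.
Qed.

End stable_transform.

Section stable_laplace.
Context {R : realType}.
Notation mu := (@lebesgue_measure R).

(** For a = 1 the stable characteristic function is exp (i t), that of the point 1, so this is the
    inversion formula at x = 1. *)
Lemma stable_inversion1 u v : 0 < u -> u <= v ->
  (\int[mu]_(t in `]0%R, +oo[) (stable_re 1 t * test_cos u v t + stable_im 1 t * test_sin u v t)%:E
   = (pi * (expR (- (u `^ 1)) - expR (- (v `^ 1))))%:E)%E.
Proof.
move=> u0 uv; have v0 := lt_le_trans u0 uv.
rewrite !powRr1 ?(ltW u0) ?(ltW v0)//.
transitivity (pi * test u v 1)%:E; last by rewrite test_pos// !mulr1.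
rewrite -(inversion 1 u0 uv); apply: eq_integral => t; rewrite inE/= in_itv/= andbT => t0.
by rewrite /stable_re /stable_im powRr1 ?(ltW t0)// mulr1 cos_pihalf sin_pihalf mulr0 oppr0 expR0 mulr1 !mul1r.
Qed.

Lemma stable_inversion_le1 a u v : 0 < a -> a <= 1 -> 0 < u -> u <= v ->
  (\int[mu]_(t in `]0%R, +oo[) (stable_re a t * test_cos u v t + stable_im a t * test_sin u v t)%:E
   = (pi * (expR (- (u `^ a)) - expR (- (v `^ a))))%:E)%E.
Proof.
move=> a0; rewrite le_eqVlt => /predU1P[-> |a1]; [exact: stable_inversion1|exact: stable_inversion].
Qed.

Lemma cvg_expRN_powR a (u : R^nat) : 0 < a -> (forall n, 0 <= u n) -> u n @[n --> \oo] --> (0 : R) ->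
  expR (- (u n `^ a)) @[n --> \oo] --> (1 : R).
Proof.
move=> a0 u0 cu; rewrite -[X in _ --> X]expR0 -[X in expR X]oppr0.
apply: (cvg_comp _ expR); last exact: continuous_expR.
by apply: cvgN; apply: cvg_powR0 => //; exact: nearW.
Qed.

Lemma cvg_expRN_powRy a u : 0 < a -> 0 <= u ->
  expR (- ((u + n.+1%:R) `^ a)) @[n --> \oo] --> (0 : R).
Proof.
move=> a0 u0.
have c : ((u + n.+1%:R)^-1) `^ a @[n --> \oo] --> (0 : R).
  apply: cvg_powR0 => //; first by apply: nearW => n; rewrite invr_ge0 addr_ge0.
  apply: (@squeeze_cvgr _ _ _ _ (fun=> 0) harmonic); [|exact: cvg_cst|exact: cvg_harmonic].
  apply: nearW => n; rewrite invr_ge0 addr_ge0//= /harmonic lef_pV2 ?posrE ?ltr_wpDl//.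
  by rewrite lerDr.
apply: (@squeeze_cvgr _ _ _ _ (fun=> 0) (fun n => ((u + n.+1%:R)^-1) `^ a)); [|exact: cvg_cst|exact: c].
apply: nearW => n; rewrite expR_ge0/=.
have p0 : 0 < u + n.+1%:R by rewrite ltr_wpDl.
have pa : 0 < (u + n.+1%:R) `^ a by rewrite powR_gt0.
have -> : (u + n.+1%:R)^-1 `^ a = ((u + n.+1%:R) `^ a)^-1.
  by rewrite -[X in X `^ a](powR_inv1 (ltW p0)) -powRrM mulN1r powRN.
rewrite expRN lef_pV2 ?posrE ?expR_gt0//.
by apply: le_trans (expR_ge1Dx _); rewrite lerDr.
Qed.

Context d (T : measurableType d) (P : probability T R) (S : T -> R) (a : R).
Hypotheses (mS : measurable_fun setT S) (a0 : 0 < a) (a1 : a <= 1).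
Hypothesis cfS : is_stable_one_sided P a S.

Let test_law u v : 0 < u -> u <= v ->
  (\int[P]_w (test u v (S w))%:E = (expR (- (u `^ a)) - expR (- (v `^ a)))%:E)%E.
Proof.
move=> u0 uv; have hcf : has_cf P S (stable_re a) (stable_im a).
  by move=> t t0; have := cfS t; rewrite gtr0_sg// gtr0_norm// mulr1.
by rewrite (integral_test mS hcf u0 uv) stable_inversion_le1// -EFinM mulKf// gt_eqF ?pi_gt0.
Qed.

Let D := S @^-1` `]0, +oo[.
Let mD : measurable D.
Proof. by rewrite /D -[X in measurable X]setTI; apply: mS => //; exact: measurable_itv. Qed.

Let inD w : (w \in D) = (0 < S w).
Proof. by apply/idP/idP; rewrite inE /D/= in_itv/= andbT. Qed.

Let int1 : P.-integrable setT (EFin \o cst 1).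
Proof. exact: finite_measure_integrable_cst. Qed.

(** As v = u + n.+1 tends to infinity, the test function at S increases to exp (- u S) where S > 0
    and stays 0 elsewhere. The indicator is the trace of the negative values that S might still take
    at this stage. *)
Let laplace_pos u : 0 < u ->
  (\int[P]_w (expR (- (u * S w)) * \1_D w)%:E = (expR (- (u `^ a)))%:E)%E.
Proof.
move=> u0.
have h := @dominated_cvgR _ _ T P setT (fun n w => test u (u + n.+1%:R) (S w))
  (fun w => expR (- (u * S w)) * \1_D w) (cst 1) measurableT.
have /h{}h n : measurable_fun setT (fun w => test u (u + n.+1%:R) (S w)).
  by apply: measurableT_comp => //; exact: measurable_test.
have /h{}h w : setT w -> test u (u + n.+1%:R) (S w) @[n --> \oo] --> expR (- (u * S w)) * \1_D w.
  move=> _; rewrite indicE inD; case: ltP => S0; last first.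
    by rewrite mulr0; under eq_fun do rewrite test_neg//; exact: cvg_cst.
  rewrite (_ : (fun n => _) = (fun n => expR (- (u * S w)) - expR (- ((u + n.+1%:R) * S w)))); last first.
    by apply/funext => n; rewrite test_pos// ltW.
  rewrite mulr1 -[X in _ --> X]subr0; apply: cvgB; first exact: cvg_cst.
  have := cvg_expRN_powRy ltr01 (ltW u0) => hc.
  (* The exponential exp (- v S) is viewed as the power of exponent S w > 0 of exp (- v), which
     tends to 0. *)
  have : expR (- ((u + n.+1%:R) `^ 1)) `^ (S w) @[n --> \oo] --> (0 : R).
    by apply: cvg_powR0 => //; apply: nearW => n; exact: expR_ge0.
  apply: cvg_trans; apply: near_eq_cvg; apply: nearW => n /=.
  by rewrite -expRM powRr1 ?addr_ge0 ?(ltW u0)// mulNr.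
have {}h := h int1.
have {}h : (\int[P]_x (test u (u + n.+1%:R) (S x))%:E @[n --> \oo] --> \int[P]_w (expR (- (u * S w)) * \1_D w)%:E)%E.
  apply: h => n w _; rewrite ger0_norm ?test_ge0 ?lerDl//.
  by apply: test_le1; exact: ltW.
apply/(cvg_unique _ h) => //.
rewrite (_ : (fun n => _) = (fun n => (expR (- (u `^ a)) - expR (- ((u + n.+1%:R) `^ a)))%:E)); last first.
  by apply/funext => n; rewrite test_law ?lerDl.
apply: cvg_EFin; first exact: nearW.
rewrite -[X in _ --> X]subr0; apply: cvgB; first exact: cvg_cst.
by apply: cvg_expRN_powRy => //; exact: ltW.
Qed.

Lemma stable_gt0 : P D = 1%E.
Proof.
have h := @dominated_cvgR _ _ T P setT (fun n w => expR (- (harmonic n * S w)) * \1_D w)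
  \1_D (cst 1) measurableT.
have mI : measurable_fun setT (\1_D : T -> R) by exact: measurable_indic.
have /h{}h n : measurable_fun setT (fun w => expR (- (harmonic n * S w)) * \1_D w) by mfun.
have /h{}h w : setT w -> expR (- (harmonic n * S w)) * \1_D w @[n --> \oo] --> (\1_D w : R).
  move=> _; rewrite -[X in _ --> X]mul1r; apply: cvgM; last exact: cvg_cst.
  rewrite -[X in _ --> X]expR0 -[X in expR X]oppr0 -[X in expR (- X)](mul0r (S w)).
  apply: (cvg_comp _ expR); last exact: continuous_expR.
  by apply: cvgN; apply: cvgM; [exact: cvg_harmonic|exact: cvg_cst].
have {}h := h int1.
have {}h : (\int[P]_x (expR (- (harmonic n * S x)) * \1_D x)%:E @[n --> \oo] --> \int[P]_w (\1_D w)%:E)%E.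
  apply: h => n w _; rewrite indicE inD; case: ltP => S0; last by rewrite mulr0 normr0.
  by rewrite mulr1 ger0_norm ?expR_ge0// -expR0 ler_expR oppr_le0 mulr_ge0 ?(ltW S0)// /harmonic invr_ge0.
rewrite -[X in P X](setIT D) -integral_indic//.
apply/(cvg_unique _ h) => //.
rewrite (_ : (fun n => _) = (fun n => (expR (- (harmonic n `^ a)))%:E)); last first.
  by apply/funext => n; rewrite laplace_pos /harmonic ?invr_gt0.
apply: cvg_EFin; first exact: nearW.
apply: cvg_expRN_powR => //; last exact: cvg_harmonic.
by move=> n; rewrite invr_ge0.
Qed.

Lemma stable_laplace u : 0 <= u ->
  (\int[P]_(w in D) (expR (- (u * S w)))%:E = (expR (- (u `^ a)))%:E)%E.
Proof.
rewrite le_eqVlt => /predU1P[<-|u0].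
  (* At u = 0 both sides are total masses, and the claim is that S is almost surely positive. *)
  rewrite powR0 ?gt_eqF// oppr0 expR0 -[RHS]stable_gt0 -[RHS]mul1e -integral_cst//.
  by apply: eq_integral => w _; rewrite mul0r oppr0 expR0.
rewrite -laplace_pos// integral_mkcond; apply: eq_integral => w _.
by rewrite patchE indicE; case: ifP => _; rewrite (mulr1, mulr0).
Qed.

End stable_laplace.

(** * Existence of the stable law *)

Section stable_density.
Context {R : realType}.
Notation mu := (@lebesgue_measure R).
Variable a : R.
Hypotheses (a0 : 0 < a) (a1 : a < 1).

Let D : set (measurableTypeR R) := `]0%R, +oo[%classic.
Let mD : measurable D. Proof. exact: measurable_itv. Qed.
Let inD t : D t -> 0 < t. Proof. by rewrite /D/= in_itv/= andbT. Qed.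

(** The decay rate of the stable characteristic function, whose modulus is exp (- k t^a). It is
    positive because a < 1; at a = 1 it vanishes and the law has no density. *)
Let k : R := cos (pi * a / 2).
Let k0 : 0 < k.
Proof.
apply: cos_gt0_pihalf; apply/andP; split.
  by apply: (@lt_trans _ _ 0); rewrite ?oppr_lt0 ?divr_gt0 ?mulr_gt0 ?pi_gt0.
by rewrite ltr_pM2r ?invr_gt0// -[ltRHS]mulr1 ltr_pM2l ?pi_gt0.
Qed.

(** One term of the exponential series is enough: if a (n + 1) >= 2, the term of degree n + 1 at k
    t^a is at least c t^2 for t >= 1. *)
Let decay_le : exists M : R, forall t, 0 < t -> expR (- (t `^ a * k)) <= M * (1 ^+ 2 + t ^+ 2)^-1.
Proof.
pose n := Num.bound (2 / a).
have n2 : 2 <= a * n.+1%:R.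
  rewrite mulrC -ler_pdivrMr//; apply: ltW; apply: lt_trans (archi_boundP _) _.
    by rewrite divr_ge0// ltW.
  by rewrite ltr_nat.
pose c := k ^+ n.+1 / n.+1`!%:R.
have c0 : 0 < c by rewrite divr_gt0 ?exprn_gt0// ltr0n fact_gt0.
(* The summand 2 bounds 1 + t^2 for t <= 1; for t > 1 one has 1 + t^2 <= 2 t^2 <= (2 / c) exp (k
   t^a). *)
exists (2 + 2 / c) => t t0; rewrite expr1n.
have d0 : 0 < 1 + t ^+ 2 by rewrite addr_gt0// exprn_gt0.
rewrite ler_pdivlMr//.
have e1 : expR (- (t `^ a * k)) <= 1.
  by rewrite -expR0 ler_expR oppr_le0 mulr_ge0 ?powR_ge0 ?(ltW k0).
have [t1|t1] := leP t 1.
  apply: (@le_trans _ _ (1 * (1 + t ^+ 2))); first by rewrite ler_wpM2r ?(ltW d0).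
  have : t ^+ 2 <= 1 by rewrite expr_le1 ?(ltW t0).
  have : 0 <= 2 / c by apply: divr_ge0 => //; exact: ltW.
  by lra.
have h : c * t ^+ 2 <= expR (t `^ a * k).
  apply: (@le_trans _ _ ((t `^ a * k) ^+ n.+1 / n.+1`!%:R)); last first.
    apply: le_trans (expR_ge1Dxn n _); first by rewrite lerDr.
    by rewrite mulr_ge0 ?powR_ge0 ?(ltW k0).
  have -> : (t `^ a * k) ^+ n.+1 / n.+1`!%:R = c * (t `^ a) ^+ n.+1 by rewrite exprMn /c; ring.
  apply: ler_wpM2l; first exact: ltW.
  rewrite -powR_mulrn ?powR_ge0// -powRrM -powR_mulrn ?(ltW t0)//.
  by rewrite ler_powR// ltW.
have t2 : 1 <= t ^+ 2 by rewrite expr_ge1 ?(ltW t1) ?(ltW t0).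
rewrite expRN mulrC ler_pdivrMr ?expR_gt0//.
apply: (@le_trans _ _ ((2 + 2 / c) * (c * t ^+ 2))); last first.
  apply: ler_wpM2l => //; rewrite addr_ge0//; apply: divr_ge0 => //; exact: ltW.
have -> : (2 + 2 / c) * (c * t ^+ 2) = 2 * (c * t ^+ 2) + 2 * t ^+ 2 by field; rewrite gt_eqF.
have : 0 <= c * t ^+ 2 by rewrite mulr_ge0 ?sqr_ge0 ?(ltW c0).
by lra.
Qed.

Let bnd t : R := 2 * expR (- (t `^ a * k)).

Let integrable_bnd : mu.-integrable D (EFin \o bnd).
Proof.
have [M hM] := decay_le.
have i := integrableZl mD (2 * M) (integrable_cauchy (@ltr01 R)).
apply: (le_integrableR mD _ _ i); first by apply: measurable_funTS; rewrite /bnd; mfun.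
by move=> t /inD t0; rewrite /bnd ger0_norm ?mulr_ge0 ?expR_ge0// -mulrA ler_wpM2l// hM.
Qed.

(** Real part of exp (- i t y) times the stable characteristic function. *)
Let phi y t := cos (t * y) * stable_re a t + sin (t * y) * stable_im a t.

Let re_bnd t : `|stable_re a t| <= expR (- (t `^ a * k)).
Proof. by rewrite normrM ger0_norm ?expR_ge0// -[leRHS]mulr1 ler_wpM2l ?expR_ge0// cos_max. Qed.

Let im_bnd t : `|stable_im a t| <= expR (- (t `^ a * k)).
Proof. by rewrite normrM ger0_norm ?expR_ge0// -[leRHS]mulr1 ler_wpM2l ?expR_ge0// sin_max. Qed.

Let trig_le (x r s b : R) : `|r| <= b -> `|s| <= b -> `|cos x * r + sin x * s| <= 2 * b.
Proof.
move=> rb sb; rewrite mulr_natl mulr2n; apply: le_trans (ler_normD _ _) _.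
by rewrite !normrM lerD// -[leRHS]mul1r ler_pM ?cos_max ?sin_max.
Qed.

Let phi_bnd y t : `|phi y t| <= bnd t.
Proof. by rewrite /phi trig_le. Qed.

Let measurable_phi2 : measurable_fun setT
  (fun z : measurableTypeR R * measurableTypeR R => phi z.1 z.2).
Proof.
rewrite /phi; apply: measurable_funD; apply: measurable_funM; try by mfun.
- by apply: (measurableT_comp (measurable_stable_re a)); exact: measurable_snd.
- by apply: (measurableT_comp (measurable_stable_im a)); exact: measurable_snd.
Qed.

Let measurable_phi y : measurable_fun setT (phi y).
Proof.
have := measurable_stable_re a; have := measurable_stable_im a => m1 m2.
by rewrite /phi; mfun.
Qed.

Let integrable_phi y : mu.-integrable D (EFin \o phi y).
Proof.
apply: (le_integrableR mD _ _ integrable_bnd); first exact: measurable_funTS (measurable_phi y).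
by move=> t _; exact: phi_bnd.
Qed.

(** The Fourier inverse. Real parts are even in t, so the integral over the line divided by 2 pi
    becomes one over t > 0 divided by pi. *)
Definition stable_density y : R := pi^-1 * \int[mu]_(t in `]0%R, +oo[) phi y t.

Let densityE y : ((stable_density y)%:E = (pi^-1)%:E * \int[mu]_(t in D) (phi y t)%:E)%E.
Proof. by rewrite /stable_density EFinM /Rintegral fineK//; exact: (integrable_fin_num mD (integrable_phi y)). Qed.

Let continuous_density : continuous stable_density.
Proof.
move=> x; apply/continuous_withinNx/cvgr_dnbhsP => u [_ ux].
apply: cvgM; first exact: cvg_cst.
have := @dominated_cvgR R _ (measurableTypeR R) mu D (fun n t => phi (u n) t) (phi x) bnd mD.
have h1 n : measurable_fun D (phi (u n)) by exact: measurable_funTS (measurable_phi _).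
have h2 t : D t -> phi (u n) t @[n --> \oo] --> phi x t.
  move=> _; have ct : t * u n @[n --> \oo] --> t * x by apply: cvgM => //; exact: cvg_cst.
  apply: cvgD; (apply: cvgM; last exact: cvg_cst).
    exact: (cvg_comp _ cos ct (@continuous_cos R _)).
  exact: (cvg_comp _ sin ct (@continuous_sin R _)).
move=> /(_ h1 h2 integrable_bnd (fun n t _ => phi_bnd (u n) t)) h.
apply: cvg_EFinI; rewrite /Rintegral fineK; last exact: (integrable_fin_num mD (integrable_phi x)).
apply: cvg_trans h; apply: near_eq_cvg; apply: nearW => n /=.
by rewrite fineK//; exact: (integrable_fin_num mD (integrable_phi (u n))).
Qed.

Lemma measurable_stable_density : measurable_fun setT stable_density.
Proof. exact: continuous_measurable_fun. Qed.

Lemma stable_density_bounded : exists2 M : R, 0 <= M & forall y, `|stable_density y| <= M.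
Proof.
exists (pi^-1 * \int[mu]_(t in `]0%R, +oo[) bnd t).
  rewrite mulr_ge0 ?invr_ge0 ?pi_ge0//; apply: Rintegral_ge0 => t _.
  by rewrite /bnd mulr_ge0 ?expR_ge0.
move=> y; rewrite normrM ger0_norm ?invr_ge0 ?pi_ge0//; apply: ler_wpM2l; first by rewrite invr_ge0 pi_ge0.
apply: le_trans (le_normr_Rintegral mD (integrable_phi y)) _.
apply: le_Rintegral => //; first exact: (integrable_norm (integrable_phi y)).
Qed.

(* The integral is the mean of [s / (s ^+ 2 + (y - X) ^+ 2)]. *)
Let smoothed n s y (L C S : nat -> R -> R) : realizable (L n) (C n) (S n) -> 0 < s ->
  (0 <= \int[mu]_(t in D) (expR (- (s * t)) * (cos (t * y) * C n t + sin (t * y) * S n t))%:E)%E.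
Proof.
move=> [d [T [P [X [mX _ _ hcf]]]]] s0.
have mX1 : measurable_fun setT (fun z : T * measurableTypeR R => X z.1) by exact: measurableT_comp.
pose f (z : T * measurableTypeR R) : R := expR (- (s * z.2)) * cos (z.2 * (y - X z.1)).
have mf : measurable_fun setT f by rewrite /f; mfun.
have -> : (\int[mu]_(t in D) (expR (- (s * t)) * (cos (t * y) * C n t + sin (t * y) * S n t))%:E =
    \int[mu]_(t in D) \int[P]_w (f (w, t))%:E)%E.
  apply: eq_integral => t; rewrite inE => /inD t0; have [hC hS] := hcf t t0.
  have iC : P.-integrable setT (fun w => (cos (t * X w))%:E).
    by apply: (@bounded_integrable _ _ _ P (fun w => cos (t * X w))) => [|x]; [mfun|exact: cos_max].
  have iS : P.-integrable setT (fun w => (sin (t * X w))%:E).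
    by apply: (@bounded_integrable _ _ _ P (fun w => sin (t * X w))) => [|x]; [mfun|exact: sin_max].
  rewrite (eq_integral (fun w => (expR (- (s * t)) * cos (t * y))%:E * (cos (t * X w))%:E
    + (expR (- (s * t)) * sin (t * y))%:E * (sin (t * X w))%:E)%E); last first.
    by move=> w _; rewrite /f/= mulrBr cosB -!EFinM -EFinD; congr EFin; ring.
  rewrite integralD//; [|exact: integrableZl..].
  by rewrite !integralZl// hC hS -!EFinM -EFinD; congr EFin; ring.
rewrite -(@fubini_bounded _ _ _ _ _ P mu _ _ _ _ f (cst 1) (fun t => expR (- (s * t))))//; first last.
- move=> w t _ _ /=; rewrite mul1r normrM ger0_norm ?expR_ge0// -[leRHS]mulr1.
  by rewrite ler_wpM2l ?expR_ge0// cos_max.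
- exact: integrable_expRN.
- exact: finite_measure_integrable_cst.
apply: integral_ge0 => w _; rewrite /f/= integral_expRN_cos// lee_fin.
by rewrite divr_ge0 ?addr_ge0 ?sqr_ge0 ?(ltW s0).
Qed.

(** The smoothing exp (- s t) supplies the dominating function: the bounds on the transforms of the
    approximants that hold uniformly in n are constants, which are not integrable in t. *)
Let smoothed_stable s y : 0 < s ->
  (0 <= \int[mu]_(t in D) (expR (- (s * t)) * phi y t)%:E)%E.
Proof.
move=> s0; have [L [C [S [rz _ cC cS]]]] := stable_approximation a0 a1.
have := @dominated_cvgR R _ (measurableTypeR R) mu D
  (fun n t => expR (- (s * t)) * (cos (t * y) * C n t + sin (t * y) * S n t))
  (fun t => expR (- (s * t)) * phi y t) (fun t => expR (- (s * t)) * 2) mD.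
have h1 n : measurable_fun D (fun t => expR (- (s * t)) * (cos (t * y) * C n t + sin (t * y) * S n t)).
  have [mC mS _] := realizable_cf (rz n).
  apply: measurable_funM; first by mfun.
  by apply: measurable_funD; apply: measurable_funM => //; mfun.
have h2 t : D t -> expR (- (s * t)) * (cos (t * y) * C n t + sin (t * y) * S n t) @[n --> \oo] -->
    expR (- (s * t)) * phi y t.
  move=> /inD t0; have c1 := cC t t0; have c2 := cS t t0.
  apply: cvgM; first exact: cvg_cst.
  by apply: cvgD; apply: cvgM => //; exact: cvg_cst.
have h3 : mu.-integrable D (EFin \o (fun t => expR (- (s * t)) * 2)).
  by apply: (integrable_expRN_bounded 0 s0 (f := cst 2) (M := 2)) => // t; rewrite ger0_norm.
have h4 n t : D t -> `|expR (- (s * t)) * (cos (t * y) * C n t + sin (t * y) * S n t)| <= expR (- (s * t)) * 2.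
  move=> /inD t0; have [_ _ /(_ t t0)[b1 b2]] := realizable_cf (rz n).
  by rewrite normrM ger0_norm ?expR_ge0// ler_wpM2l ?expR_ge0// -[leRHS]mulr1 trig_le.
move=> /(_ h1 h2 h3 h4) h.
rewrite -(cvg_lim _ h)//; apply: lime_ge; first by apply/cvg_ex; eexists; exact: h.
by apply: nearW => n; exact: smoothed (rz n) s0.
Qed.

(** The limit s -> 0 comes after the limit of the approximants, when the decay of the stable
    characteristic function itself dominates. *)
Lemma stable_density_ge0 y : 0 <= stable_density y.
Proof.
rewrite -lee_fin densityE mule_ge0 ?lee_fin ?invr_ge0 ?pi_ge0//.
have := @dominated_cvgR R _ (measurableTypeR R) mu D
  (fun n t => expR (- (harmonic n * t)) * phi y t) (phi y) bnd mD.
have h1 n : measurable_fun D (fun t => expR (- (harmonic n * t)) * phi y t).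
  by apply: measurable_funTS; have := measurable_phi y => m; mfun.
have h2 t : D t -> expR (- (harmonic n * t)) * phi y t @[n --> \oo] --> phi y t.
  move=> /inD t0; rewrite -[X in _ --> X]mul1r; apply: cvgM; last exact: cvg_cst.
  rewrite -[X in _ --> X]expR0 -[X in expR X]oppr0 -[X in expR (- X)](mul0r t).
  apply: (cvg_comp _ expR); last exact: continuous_expR.
  by apply: cvgN; apply: cvgM; [exact: cvg_harmonic|exact: cvg_cst].
have h4 n t : D t -> `|expR (- (harmonic n * t)) * phi y t| <= bnd t.
  move=> /inD t0; rewrite normrM -[leRHS]mul1r ler_pM//.
  by rewrite ger0_norm ?expR_ge0// -expR0 ler_expR oppr_le0 mulr_ge0 ?(ltW t0)// /harmonic invr_ge0.
move=> /(_ h1 h2 integrable_bnd h4) h.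
rewrite -(cvg_lim _ h)//; apply: lime_ge; first by apply/cvg_ex; eexists; exact: h.
by apply: nearW => n; apply: smoothed_stable; rewrite /harmonic invr_gt0.
Qed.

(** Exchanging the integrals in y and t turns the left-hand side into the functional of
    [stable_inversion]. Test functions see only y > 0, so nothing is claimed about the other
    half-line. *)
Let density_test u v : 0 < u -> u <= v ->
  (\int[mu]_(y in D) (test u v y * stable_density y)%:E = (expR (- (u `^ a)) - expR (- (v `^ a)))%:E)%E.
Proof.
move=> u0 uv; have v0 := lt_le_trans u0 uv.
pose f (z : measurableTypeR R * measurableTypeR R) : R := test u v z.1 * phi z.1 z.2.
have mf : measurable_fun setT f.
  by apply: measurable_funM => //; apply: (measurableT_comp (measurable_test u v)); exact: measurable_fst.
transitivity ((pi^-1)%:E * \int[mu]_(y in D) \int[mu]_(t in D) (f (y, t))%:E)%E.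
  have tE y : (\int[mu]_(t in D) (f (y, t))%:E = (pi * (test u v y * stable_density y))%:E)%E.
    transitivity ((test u v y)%:E * \int[mu]_(t in D) (phi y t)%:E)%E.
      by rewrite -(integralZl mD (integrable_phi y)); apply: eq_integral => t _; rewrite EFinM.
    rewrite -[X in (_ * X)%E]mul1e -[1%E]/((1 : R)%:E) -(@mulfV _ pi) ?gt_eqF ?pi_gt0//.
    by rewrite EFinM -muleA -densityE -!EFinM; congr EFin; ring.
  have [M M0 hM] := stable_density_bounded.
  rewrite -integralZl//; last first.
    rewrite (_ : (fun y => _) = (fun y : measurableTypeR R => (pi * (test u v y * stable_density y))%:E)); last exact/funext.
    apply: (@le_integrableR R _ (measurableTypeR R) mu D _ (fun y => pi * M * test u v y)) => //.
    - have := measurable_test u v; have := measurable_stable_density => m1 m2.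
      by apply: measurable_funTS; mfun.
    - move=> y _; rewrite normrM (ger0_norm (pi_ge0 R)) normrM (ger0_norm (test_ge0 _ uv)) -mulrA.
      by rewrite ler_wpM2l ?pi_ge0// mulrC ler_wpM2r ?test_ge0.
    - rewrite (_ : _ \o _ = (fun y => (pi * M)%:E * (EFin \o test u v) y)%E); last first.
        by apply/funext => y /=; rewrite EFinM.
      by apply: integrableZl => //; exact: integrable_test.
  by apply: eq_integral => y _; rewrite tE -EFinM mulKf// gt_eqF ?pi_gt0.
rewrite (@fubini_bounded _ _ _ _ _ mu mu _ _ mD mD f (test u v) bnd)//; last 2 first.
- exact: integrable_test.
- by move=> y t _ _; rewrite /f/= normrM (ger0_norm (test_ge0 _ uv)) ler_wpM2l ?test_ge0.
rewrite (eq_integral (fun t : measurableTypeR R => (stable_re a t * test_cos u v t + stable_im a t * test_sin u v t)%:E)).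
  by rewrite stable_inversion// -EFinM mulKf// gt_eqF ?pi_gt0.
move=> t _; rewrite /f/=.
have itr (g : R -> R) : measurable_fun setT g -> (forall x, `|g x| <= 1) ->
    mu.-integrable D (EFin \o (fun y => g (t * y) * test u v y)).
  move=> mg g1; apply: (@le_integrableR R _ (measurableTypeR R) mu D _ (test u v)) => //.
  - have := measurable_test u v => m1; apply: measurable_funTS.
    by apply: measurable_funM => //; apply: measurableT_comp => //; mfun.
  - by move=> y _; rewrite normrM (ger0_norm (test_ge0 _ uv)) -[leRHS]mul1r ler_wpM2r ?test_ge0.
  - exact: integrable_test.
have mcos : measurable_fun [set: R] cos by exact: (measurable_fun_cos (@measurable_id _ R setT)).
have msin : measurable_fun [set: R] sin by exact: (measurable_fun_sin (@measurable_id _ R setT)).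
have ic := itr cos mcos (@cos_max R); have isn := itr sin msin (@sin_max R).
rewrite (eq_integral (fun y : measurableTypeR R => (stable_re a t)%:E * (cos (t * y) * test u v y)%:E
  + (stable_im a t)%:E * (sin (t * y) * test u v y)%:E)%E); last first.
  by move=> y _; rewrite -!EFinM -EFinD /phi; congr EFin; ring.
rewrite integralD//; [|exact: integrableZl..].
by rewrite !integralZl// test_cosE// test_sinE// -!EFinM -EFinD.
Qed.

Lemma stable_density_laplace u : 0 < u ->
  (\int[mu]_(y in D) (expR (- (u * y)) * stable_density y)%:E = (expR (- (u `^ a)))%:E)%E.
Proof.
move=> u0; have [M M0 hM] := stable_density_bounded.
have := @dominated_cvgR R _ (measurableTypeR R) mu D
  (fun n y => test u (u + n.+1%:R) y * stable_density y)
  (fun y => expR (- (u * y)) * stable_density y) (fun y => expR (- (u * y)) * M) mD.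
have mdens := measurable_stable_density.
have h1 n : measurable_fun D (fun y => test u (u + n.+1%:R) y * stable_density y).
  by apply: measurable_funTS; have := measurable_test u (u + n.+1%:R) => m; mfun.
have h2 y : D y -> test u (u + n.+1%:R) y * stable_density y @[n --> \oo] --> expR (- (u * y)) * stable_density y.
  move=> /inD y0; apply: cvgM; last exact: cvg_cst.
  rewrite (_ : (fun n => _) = (fun n => expR (- (u * y)) - expR (- ((u + n.+1%:R) * y)))); last first.
    by apply/funext => n; rewrite test_pos// ltW.
  rewrite -[X in _ --> X]subr0; apply: cvgB; first exact: cvg_cst.
  have := cvg_expRN_powRy ltr01 (ltW u0) => hc.
  have : expR (- ((u + n.+1%:R) `^ 1)) `^ y @[n --> \oo] --> (0 : R).
    by apply: cvg_powR0 => //; apply: nearW => n; exact: expR_ge0.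
  apply: cvg_trans; apply: near_eq_cvg; apply: nearW => n /=.
  by rewrite -expRM powRr1 ?addr_ge0 ?(ltW u0)// mulNr.
have h3 : mu.-integrable D (EFin \o (fun y => expR (- (u * y)) * M)).
  by apply: (integrable_expRN_bounded 0 u0 (f := cst M) (M := M)) => // t; rewrite ger0_norm.
have h4 n y : D y -> `|test u (u + n.+1%:R) y * stable_density y| <= expR (- (u * y)) * M.
  move=> /inD y0; rewrite normrM ger0_norm ?test_ge0 ?lerDl// ler_pM ?test_ge0 ?lerDl//.
  by apply: le_trans (test_le _ _ _) _; rewrite ramp_pos// ltW.
move=> /(_ h1 h2 h3 h4) h.
apply/esym/(cvg_unique _ _ h) => //.
rewrite (_ : (fun n => _) = (fun n => (expR (- (u `^ a)) - expR (- ((u + n.+1%:R) `^ a)))%:E)); last first.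
  by apply/funext => n; rewrite density_test ?lerDl.
apply: cvg_EFin; first exact: nearW.
rewrite -[X in _ --> X]subr0; apply: cvgB; first exact: cvg_cst.
by apply: cvg_expRN_powRy => //; exact: ltW.
Qed.

(** Integrability of the density is part of the conclusion, so u -> 0 is taken by monotone
    convergence, where the nonnegativity of the density enters. *)
Lemma stable_density_mass : (\int[mu]_(y in D) (stable_density y)%:E = 1)%E.
Proof.
pose g n y : \bar R := (expR (- (harmonic n * y)) * stable_density y)%:E.
have mdens := measurable_stable_density.
have mg n : measurable_fun D (g n) by apply: measurable_funTS; rewrite /g; mfun.
have g0 n y : D y -> (0 <= g n y)%E.
  by move=> _; rewrite lee_fin mulr_ge0 ?expR_ge0 ?stable_density_ge0.
have ndg y : D y -> {homo g^~ y : n m / (n <= m)%N >-> (n <= m)%E}.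
  move=> /inD y0 n m nm; rewrite lee_fin ler_wpM2r ?stable_density_ge0// ler_expR lerN2.
  by rewrite ler_wpM2r ?(ltW y0)// /harmonic lef_pV2 ?posrE// ler_nat.
have := cvg_monotone_convergence (mu := mu) mD mg g0 ndg.
rewrite (@eq_integral _ _ _ mu D (EFin \o stable_density)); last first.
  move=> y; rewrite inE => /inD y0; apply: cvg_lim => //; apply: cvg_EFin; first exact: nearW.
  rewrite -[X in _ --> X]mul1r; apply: cvgM; last exact: cvg_cst.
  rewrite -[X in _ --> X]expR0 -[X in expR X]oppr0 -[X in expR (- X)](mul0r y).
  apply: (cvg_comp _ expR); last exact: continuous_expR.
  by apply: cvgN; apply: cvgM; [exact: cvg_harmonic|exact: cvg_cst].
move=> h; apply/esym/(cvg_unique _ _ h) => //.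
rewrite (_ : (fun n => _) = (fun n => (expR (- (harmonic n `^ a)))%:E)); last first.
  by apply/funext => n; rewrite stable_density_laplace /harmonic ?invr_gt0.
apply: cvg_EFin; first exact: nearW.
apply: cvg_expRN_powR => //; last exact: cvg_harmonic.
by move=> n; rewrite invr_ge0.
Qed.

End stable_density.

Section stable_existence.
Context {R : realType}.
Notation mu := (@lebesgue_measure R).

(** The law is described by its Laplace transform on the positive half-line, the form in which it
    enters the mixture. *)
Lemma stable_exists (a : R) : 0 < a -> a <= 1 ->
  exists Q : probability (measurableTypeR R) R, Q `]0%R, +oo[%classic = 1%E /\
    forall u, 0 <= u -> (\int[Q]_(s in `]0%R, +oo[) (expR (- (u * s)))%:E = (expR (- (u `^ a)))%:E)%E.
Proof.
move=> a0; rewrite le_eqVlt => /predU1P[->|a1].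
  pose Q : probability (measurableTypeR R) R := @dirac _ (measurableTypeR R) 1 R.
  have Q1 : Q `]0%R, +oo[%classic = 1%E.
    transitivity ((\1_(`]0%R, +oo[%classic) (1 : R))%:E : \bar R); first by [].
    by rewrite indicE mem_set//= in_itv/= ltr01.
  exists Q; split => // u u0.
  rewrite integral_dirac//; last by apply: measurable_funTS; mfun.
  by rewrite [X in (X * _)%E]Q1 mul1e mulr1 powRr1.
have mD : measurable (`]0%R, +oo[%classic : set (measurableTypeR R)) by exact: measurable_itv.
have [Q [Q0 _]] := density_probability mD (measurable_stable_density a0 a1)
  (fun y _ => stable_density_ge0 a0 a1 y) (stable_density_mass a0 a1).
have QD (h : R -> R) : measurable_fun setT h -> (forall x, 0 <= h x) ->
    (\int[Q]_(x in `]0%R, +oo[) (h x)%:E = \int[mu]_(x in `]0%R, +oo[) (h x * stable_density a x)%:E)%E.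
  move=> mh h0; rewrite integral_mkcond Q0; last 2 first.
  - by apply/(measurable_restrictT _ _).1 => //; apply: measurable_funTS; exact/measurable_EFinP.
  - by move=> x; rewrite patchE; case: ifP; rewrite ?lee_fin.
  by apply: eq_integral => x xD; rewrite patchE xD EFinM.
exists Q; split.
  rewrite -[LHS]mul1e -integral_cst// (QD (cst 1))// -(stable_density_mass a0 a1).
  by apply: eq_integral => x _; rewrite mul1r.
move=> u; rewrite le_eqVlt => /predU1P[<-|u0]; rewrite QD//; [|by mfun|exact: stable_density_laplace|by mfun].
rewrite powR0 ?gt_eqF// oppr0 expR0 -(stable_density_mass a0 a1).
by apply: eq_integral => x _; rewrite mul0r oppr0 expR0 mul1r.
Qed.

End stable_existence.

(** * Tails of the generalized gamma law *)

Section gamma.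
Context {R : realType}.
Notation mu := (@lebesgue_measure R).

Let D : set (measurableTypeR R) := `]0%R, +oo[%classic.
Let mD : measurable D. Proof. exact: measurable_itv. Qed.
Let inD t : D t -> 0 < t. Proof. by rewrite /D/= in_itv/= andbT. Qed.

(** Since exp (- t) <= 1 / (1 + t), this is dominated by the integrand of [stable_norm]. *)
Lemma integrable_gamma (r : R) : 0 < r -> r < 1 ->
  mu.-integrable `]0%R, +oo[ (EFin \o (fun t : R => t `^ (r - 1) * expR (- t))).
Proof.
move=> r0 r1; apply: (le_integrableR mD _ _ (integrable_powR_frac r0 r1)).
  by apply: measurable_funTS; mfun.
move=> t /inD t0; rewrite ger0_norm ?mulr_ge0 ?powR_ge0 ?expR_ge0// ler_wpM2l ?powR_ge0//.
by rewrite expRN lef_pV2 ?posrE ?expR_gt0 ?addr_gt0// expR_ge1Dx.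
Qed.

Lemma Gammaf_gt0 (r : R) : 0 < r -> r < 1 -> 0 < Gammaf r.
Proof.
move=> r0 r1; apply: Rintegral_pos; first exact: integrable_gamma.
by move=> t t0; rewrite mulr_gt0 ?powR_gt0 ?expR_gt0.
Qed.

(** A rescaled gamma integral. With v = y^a it expresses the power (y^a)^(r-1) as a mixture of
    exponentials in y^a. *)
Lemma integral_powR_expRN (r v : R) : 0 < r -> r < 1 -> 0 < v ->
  (\int[mu]_(w in `]0%R, +oo[) (w `^ (- r) * expR (- (v * w)))%:E = (Gammaf (1 - r) * v `^ (r - 1))%:E)%E.
Proof.
move=> r0 r1 v0; have r10 : 0 < 1 - r by rewrite subr_gt0.
have r11 : 1 - r < 1 by rewrite ltrBlDr ltrDl.
have := integral_scale v0 (ltac:(mfun) : measurable_fun setT (fun w : R => w `^ (- r) * expR (- w)))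
  (fun w _ => mulr_ge0 (powR_ge0 _ _) (expR_ge0 _)).
have -> : (\int[mu]_(w in `]0%R, +oo[) (w `^ (- r) * expR (- w))%:E = (Gammaf (1 - r))%:E)%E.
  have := integrable_gamma r10 r11; rewrite (_ : 1 - r - 1 = - r); last by ring.
  move=> i; rewrite /Gammaf /Rintegral (_ : 1 - r - 1 = - r); last by ring.
  by rewrite fineK// (integrable_fin_num mD i).
rewrite (eq_integral (fun w : measurableTypeR R => (v `^ (- r))%:E * (w `^ (- r) * expR (- (v * w)))%:E)%E); last first.
  by move=> w; rewrite inE => /inD w0; rewrite powRM ?(ltW v0) ?(ltW w0)// -EFinM mulrA.
rewrite ge0_integralZl_EFin ?powR_ge0//; last 2 first.
- by move=> w _; rewrite lee_fin mulr_ge0 ?powR_ge0 ?expR_ge0.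
- by apply: measurable_funTS; mfun.
move=> /(congr1 (fun e => (v `^ (r - 1))%:E * e)%E); rewrite !muleA -!EFinM.
have -> : v `^ (r - 1) * v * v `^ (- r) = 1.
  rewrite -[X in _ * X * _](powRr1 (ltW v0)) -!(powRD_gt0 _ _ v0).
  by rewrite (_ : r - 1 + 1 - r = 0) ?powRr0//; ring.
by rewrite mul1e => <-; rewrite mulrC.
Qed.

Lemma integral_weibull (a s x : R) : 0 < a -> 0 < s -> 0 <= x ->
  (\int[mu]_(y in `]x, +oo[) (a * y `^ (a - 1) * expR (- (y `^ a * s)))%:E =
   (expR (- (x `^ a * s)) / s)%:E)%E.
Proof.
move=> a0 s0 x0.
have -> : expR (- (x `^ a * s)) / s = 0 - (- (expR (- (x `^ a * s)) / s)) by rewrite sub0r opprK.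
apply: (@ge0_FTCy _ (fun y => - (expR (- (y `^ a * s)) / s))).
- move=> y xy; have y0 := le_lt_trans x0 xy.
  eapply is_derive_eq1; [mder|rewrite /=; field]; rewrite ?gt_eqF//.
- move=> y xy; have y0 := le_lt_trans x0 xy.
  by mcont.
- apply: cvgN; apply: cvgM; last exact: cvg_cst.
  apply: (cvg_comp _ expR); last exact: continuous_expR.
  apply: cvgN; apply: cvgM; last exact: cvg_cst.
  move: x0; rewrite le_eqVlt => /predU1P[<-|x0].
    rewrite powR0 ?gt_eqF//; apply: cvg_powR0 => //; last exact: cvg_at_right_filter.
    by near=> y; apply: ltW; near: y; exact: nbhs_right_gt.
  have [d dd] : exists d, is_derive x 1 (fun y : R => y `^ a) d.
    by eexists; eapply is_derive_eq1; [mder|reflexivity].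
  exact: der_cvg_right dd.
- rewrite -[X in _ --> X]oppr0; apply: cvgN; rewrite -[X in _ --> X](mul0r s^-1).
  apply: cvgM; last exact: cvg_cst.
  have c : s^-1 * ((0 + y)^-1) `^ a @[y --> +oo] --> (0 : R).
    rewrite -[X in _ --> X](mulr0 s^-1); apply: cvgM; first exact: cvg_cst.
    apply: cvg_powR0 => //; last exact: cvg_invDy.
    by near=> y; rewrite add0r invr_ge0.
  apply: (@squeeze_cvgr _ _ _ _ (fun=> 0) (fun y => s^-1 * ((0 + y)^-1) `^ a)); [|exact: cvg_cst|exact: c].
  near=> y; rewrite expR_ge0/= add0r.
  have y0 : 0 < y by near: y; exact: nbhs_pinfty_gt.
  have -> : y^-1 `^ a = (y `^ a)^-1.
    by rewrite -[X in X `^ a](powR_inv1 (ltW y0)) -powRrM mulN1r powRN.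
  have p0 : 0 < y `^ a * s by rewrite mulr_gt0 ?powR_gt0.
  rewrite expRN -invfM [s * _]mulrC lef_pV2 ?posrE ?expR_gt0//.
  by apply: le_trans (expR_ge1Dx _); rewrite lerDr.
- by move=> y _; rewrite !mulr_ge0 ?powR_ge0 ?expR_ge0 ?(ltW a0).
Unshelve. all: by end_near.
Qed.

End gamma.

(** * The generalized gamma tail as a mixture of Weibull tails *)

Section gg_tail.
Context {R : realType}.
Notation mu := (@lebesgue_measure R).
Variables (r m : R).
Hypotheses (r0 : 0 < r) (r1 : r < 1) (m0 : 0 < m).

Let D : set (measurableTypeR R) := `]0%R, +oo[%classic.
Let mD : measurable D. Proof. exact: measurable_itv. Qed.
Let inD t : D t -> 0 < t. Proof. by rewrite /D/= in_itv/= andbT. Qed.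

Let r10 : 0 < 1 - r. Proof. by rewrite subr_gt0. Qed.
Let r11 : 1 - r < 1. Proof. by rewrite ltrBlDr ltrDl. Qed.
Let G1 := Gammaf_gt0 r10 r11.
Let G := Gammaf_gt0 r0 r1.

Lemma Z_density_ge0 z : m <= z -> 0 <= Z_density r m z.
Proof.
move=> mz; have z0 := lt_le_trans m0 mz.
by rewrite /Z_density !divr_ge0 ?mulr_ge0 ?powR_ge0 ?(ltW G) ?(ltW G1) ?(ltW z0).
Qed.

Lemma measurable_Z_density : measurable_fun setT (Z_density r m).
Proof. by rewrite /Z_density; mfun. Qed.

Let K := m `^ r / (Gammaf (1 - r) * Gammaf r).
Let K0 : 0 <= K. Proof. by rewrite divr_ge0 ?mulr_ge0 ?powR_ge0 ?(ltW G) ?(ltW G1). Qed.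

(** Under z = w + m the density of Z becomes K w^(- r) / (w + m) on w > 0. *)
Let shiftE (h : R -> R) : measurable_fun setT h -> (forall z, 0 <= h z) ->
  (\int[mu]_(z in `[m, +oo[) (Z_density r m z * h z)%:E =
   \int[mu]_(w in D) (K * (w `^ (- r) * (h (w + m) / (w + m))))%:E)%E.
Proof.
move=> mh h0; have mz := measurable_Z_density.
have mzh : measurable_fun setT (fun z => Z_density r m z * h z) by mfun.
rewrite -integral_itv_obnd_cbnd; last by apply: measurable_funTS; exact/measurable_EFinP.
transitivity (\int[mu]_(z in `]m, +oo[) `|Z_density r m z * h z|%:E)%E.
  apply: eq_integral => z; rewrite inE/= in_itv/= andbT => zm.
  by rewrite ger0_norm// mulr_ge0// Z_density_ge0// ltW.
have := ge0_integral_itv_affine m (@ltr01 R) 0 (measurable_fun_norm mzh) (fun z => normr_ge0 _).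
rewrite mulr0 add0r mul1e => ->; apply: eq_integral => w; rewrite inE => /inD w0.
have mw : m <= w + m by rewrite lerDr ltW.
have zh0 : 0 <= Z_density r m (w + m) * h (w + m) by rewrite mulr_ge0// Z_density_ge0.
rewrite mul1r (ger0_norm zh0); congr EFin.
have wr : 0 < w `^ r by rewrite powR_gt0.
by rewrite /Z_density addrK powRN /K; field; rewrite !gt_eqF ?addr_gt0.
Qed.

Variable a : R.
Hypothesis a0 : 0 < a.

Lemma gg_tail x : 0 <= x ->
  (gg_law r a m `]x, +oo[%classic = \int[mu]_(z in `[m, +oo[) (Z_density r m z * expR (- (z * x `^ a)))%:E)%E.
Proof.
move=> x0.
have mDx : measurable (`]x, +oo[%classic : set (measurableTypeR R)) by exact: measurable_itv.
have inDx y : (`]x, +oo[%classic : set (measurableTypeR R)) y -> 0 < y.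
  by rewrite /= in_itv/= andbT; exact: le_lt_trans.
(* Integrated in w, this is the generalized gamma density at y, the factor exp (- m y^a) having been
   absorbed in the rate w + m. Integrated in y, it is a Weibull tail of rate w + m. *)
pose f (z : measurableTypeR R * measurableTypeR R) : R :=
  K * (z.2 `^ (- r) * (a * z.1 `^ (a - 1) * expR (- (z.1 `^ a * (z.2 + m))))).
have mf : measurable_fun setT f by rewrite /f; mfun.
have f0 y w : 0 <= f (y, w) by rewrite /f/= (mulr_ge0 K0)// !mulr_ge0 ?powR_ge0 ?expR_ge0 ?(ltW a0).
transitivity (\int[mu]_(y in `]x, +oo[) \int[mu]_(w in D) (f (y, w))%:E)%E.
  rewrite /gg_law (_ : `]x, +oo[ `&` `[0%R, +oo[ = `]x, +oo[%classic); last first.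
    apply/seteqP; split => y; first by case.
    by rewrite /= !in_itv/= !andbT => xy; split=> //; apply: le_trans x0 (ltW xy).
  apply: eq_integral => y; rewrite inE => /inDx y0.
  have ya : 0 < y `^ a by rewrite powR_gt0.
  rewrite (eq_integral (fun w : measurableTypeR R =>
    (K * (a * y `^ (a - 1) * expR (- (m * y `^ a))))%:E * (w `^ (- r) * expR (- (y `^ a * w)))%:E)%E); last first.
    move=> w _; rewrite -EFinM /f/=; congr EFin.
    by rewrite mulrDr opprD expRD [y `^ a * m]mulrC; ring.
  rewrite ge0_integralZl_EFin ?integral_powR_expRN//; last 3 first.
  - by move=> w _; rewrite lee_fin mulr_ge0 ?powR_ge0 ?expR_ge0.
  - by apply: measurable_funTS; mfun.
  - by rewrite (mulr_ge0 K0)// !mulr_ge0 ?powR_ge0 ?expR_ge0 ?(ltW a0).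
  rewrite -EFinM /gg_density gtr0_norm//; congr EFin.
  have -> : y `^ (a * r - 1) = y `^ (a - 1) * (y `^ a) `^ (r - 1).
    by rewrite -powRrM -powRD_gt0//; congr (_ `^ _); ring.
  by rewrite /K; field; rewrite !gt_eqF.
rewrite (@tonelli_on _ _ _ _ _ mu mu _ _ mDx mD f)//.
rewrite (shiftE (h := fun z => expR (- (z * x `^ a)))); [|by mfun|by move=> z; exact: expR_ge0].
apply: eq_integral => w; rewrite inE => /inD w0; rewrite /f/=.
rewrite (eq_integral (fun y : measurableTypeR R =>
  (K * w `^ (- r))%:E * (a * y `^ (a - 1) * expR (- (y `^ a * (w + m))))%:E)%E); last first.
  by move=> y _; rewrite -EFinM mulrA.
rewrite ge0_integralZl_EFin ?(mulr_ge0 K0) ?powR_ge0//; last 2 first.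
- by move=> y _; rewrite lee_fin !mulr_ge0 ?powR_ge0 ?expR_ge0 ?(ltW a0).
- by apply: measurable_funTS; mfun.
rewrite integral_weibull ?addr_gt0// -EFinM; congr EFin.
by rewrite [(w + m) * _]mulrC mulrA.
Qed.

End gg_tail.

Section Z_mass.
Context {R : realType}.
Notation mu := (@lebesgue_measure R).

(** The tail formula at a = 1 and x = 0 equates this mass with that of a gamma law, which is a gamma
    integral. *)
Lemma Z_density_mass (r m : R) : 0 < r -> r < 1 -> 0 < m ->
  (\int[mu]_(z in `[m, +oo[) (Z_density r m z)%:E = 1)%E.
Proof.
move=> r0 r1 m0.
have mD : measurable (`]0%R, +oo[%classic : set (measurableTypeR R)) by exact: measurable_itv.
have := gg_tail r0 r1 m0 (@ltr01 R) (lexx 0).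
rewrite powRr1// (eq_integral (fun z : measurableTypeR R => (Z_density r m z)%:E)); last first.
  by move=> z _; rewrite mulr0 oppr0 expR0 mulr1.
move=> <-; rewrite /gg_law (_ : _ `&` _ = `]0%R, +oo[%classic); last first.
  apply/seteqP; split => y; first by case.
  by rewrite /= !in_itv/= !andbT => xy; split=> //; exact: ltW.
have s : 0 < 1 - r by rewrite subr_gt0.
have s1 : 1 - r < 1 by rewrite ltrBlDr ltrDl.
have G := Gammaf_gt0 r0 r1.
rewrite (eq_integral (fun y : measurableTypeR R => (m `^ r / Gammaf r)%:E * (y `^ (- (1 - r)) * expR (- (m * y)))%:E)%E); last first.
  move=> y; rewrite inE/= in_itv/= andbT => y0.
  by rewrite -EFinM /gg_density normr1 !mul1r powRr1 ?(ltW y0)// opprB mulrA.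
rewrite ge0_integralZl_EFin ?divr_ge0 ?powR_ge0 ?(ltW G)//; last 2 first.
- by move=> w _; rewrite lee_fin mulr_ge0 ?powR_ge0 ?expR_ge0.
- by apply: measurable_funTS; mfun.
rewrite integral_powR_expRN// -EFinM; congr EFin.
rewrite subKr (_ : 1 - r - 1 = - r); last by ring.
have mr : 0 < m `^ r by rewrite powR_gt0.
by rewrite powRN; field; rewrite !gt_eqF.
Qed.
End Z_mass.

(** * Independence and the product representation *)

Section independence.
Context {R : realType}.

Lemma finite_measure_prod_unique d1 d2 (T1 : measurableType d1) (T2 : measurableType d2)
    (m1 m2 : {measure set (T1 * T2) -> \bar R}) : (m1 setT < +oo)%E ->
  (forall A B, measurable A -> measurable B -> m1 (A `*` B) = m2 (A `*` B)) ->
  forall E, measurable E -> m1 E = m2 E.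
Proof.
move=> fin h E mE.
apply: (measure_unique [set A `*` B | A in measurable & B in measurable] (fun=> setT)) => //.
- exact: measurable_prod_measurableType.
- move=> _ _ [A1 mA1 [B1 mB1 <-]] [A2 mA2 [B2 mB2 <-]]; rewrite -setXI.
  by exists (A1 `&` A2); [exact: measurableI|exists (B1 `&` B2) => //; exact: measurableI].
- by move=> _; exists setT => //; exists setT => //; rewrite setXTT.
- by rewrite bigcup_const//; exists 0%N.
- by move=> _ [A mA [B mB <-]]; exact: h.
Qed.

Definition law d d1 (T : measurableType d) (T1 : measurableType d1) (P : probability T R)
    (X : T -> T1) (mX : measurable_fun setT X) : probability T1 R :=
  @probability_of R _ T1 (image_measure P mX) (@probability_setT _ _ _ P).

Lemma integral_law d d1 (T : measurableType d) (T1 : measurableType d1) (P : probability T R)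
    (X : T -> T1) (mX : measurable_fun setT X) (f : T1 -> \bar R) : measurable_fun setT f ->
  (forall x, 0 <= f x)%E -> (\int[law P mX]_x f x = \int[P]_w f (X w))%E.
Proof. by move=> mf f0; exact: (ge0_integral_pushforward mX P measurableT mf (fun x _ => f0 x)). Qed.

Context d (T : measurableType d) (P : probability T R).

(** Independence says that the joint law and the product of the laws agree on rectangles, hence
    everywhere; Tonelli's theorem then gives the iterated integral. *)
Lemma indep_integral d1 d2 (T1 : measurableType d1) (T2 : measurableType d2)
    (X : T -> T1) (Y : T -> T2) (h : T1 * T2 -> \bar R) :
  measurable_fun setT X -> measurable_fun setT Y ->
  (forall A B, measurable A -> measurable B ->
    P (X @^-1` A `&` Y @^-1` B) = (P (X @^-1` A) * P (Y @^-1` B))%E) ->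
  measurable_fun setT h -> (forall z, 0 <= h z)%E ->
  (\int[P]_w h (X w, Y w) = \int[P]_w \int[P]_w' h (X w', Y w))%E.
Proof.
move=> mX mY XY mh h0.
have mXY : measurable_fun setT (fun w => (X w, Y w)) by exact: measurable_fun_pair.
rewrite -(integral_law P mXY mh h0).
rewrite (eq_measure_integral (law P mX \x law P mY)%E); last first.
  move=> E mE _; apply: finite_measure_prod_unique => //.
    by rewrite [X in (X < _)%E](@probability_setT _ _ _ (law P mXY)) ltry.
  by move=> A B mA mB; apply: etrans (XY A B mA mB) _; exact/esym/product_measure1E.
rewrite fubini_tonelli2// integral_law//; last 2 first.
- exact: measurable_fun_fubini_tonelli_G.
- by move=> y; apply: integral_ge0.
apply: eq_integral => w _; rewrite /fubini_G integral_law//.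
exact: measurable_fun_pair1.
Qed.

(** [indep3] speaks only of boxes. For fixed A, both sides are finite measures in E that agree on
    rectangles, so they coincide. *)
Lemma indep3_pair (X Y Z : T -> R) : measurable_fun setT X -> measurable_fun setT Y ->
  measurable_fun setT Z -> indep3 P X Y Z ->
  forall A (E : set (R * R)), measurable A -> measurable E ->
    P (X @^-1` A `&` (fun w => (Y w, Z w)) @^-1` E) =
    (P (X @^-1` A) * P ((fun w => (Y w, Z w)) @^-1` E))%E.
Proof.
move=> mX mY mZ ind A E mA mE.
have mYZ : measurable_fun setT (fun w => (Y w, Z w)) by exact: measurable_fun_pair.
have mXA : measurable (X @^-1` A) by rewrite -[X in measurable X]setTI; exact: mX.
have pf : P (X @^-1` A) \is a fin_num by exact: fin_num_measure.
have p0 : 0 <= fine (P (X @^-1` A)) by rewrite fine_ge0.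
have YZ B C : measurable B -> measurable C ->
    P (Y @^-1` B `&` Z @^-1` C) = (P (Y @^-1` B) * P (Z @^-1` C))%E.
  by move=> mB mC; have := ind setT B C measurableT mB mC; rewrite preimage_setT setTI [P setT]probability_setT mul1e.
have := @finite_measure_prod_unique _ _ _ _ (image_measure (mrestr P mXA) mYZ)
  (mscale (NngNum p0) (image_measure P mYZ)).
have h1 : (image_measure (mrestr P mXA) mYZ setT < +oo)%E.
  by rewrite /= /pushforward /mrestr; apply: le_lt_trans (probability_le1 _ _) _; rewrite ?ltry// preimage_setT setTI.
have h2 B C : measurable B -> measurable C -> image_measure (mrestr P mXA) mYZ (B `*` C) =
    mscale (NngNum p0) (image_measure P mYZ) (B `*` C).
  move=> mB mC; rewrite /mscale/= /pushforward /mrestr fineK//.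
  rewrite (_ : _ @^-1` (B `*` C) = Y @^-1` B `&` Z @^-1` C)//.
  by rewrite YZ// muleA -ind// setIC setIA.
move=> /(_ h1 h2 E mE) e; rewrite setIC; apply: etrans e _.
rewrite -[X in (X * _)%E](fineK pf); exact: erefl.
Qed.

End independence.

(** * The mixing variable S Z^(1/a) *)

Section mixture.
Context {R : realType}.
Notation mu := (@lebesgue_measure R).

Lemma integral_Z_law d (T : measurableType d) (P : probability T R) (r m : R) (Z : T -> R)
    (f : R -> R) : 0 < r -> r < 1 -> 0 < m -> measurable_fun setT Z -> is_Z_law P r m Z ->
  measurable_fun setT f -> (forall z, 0 <= f z) ->
  (\int[P]_w (f (Z w))%:E = \int[mu]_(z in `[m, +oo[) (Z_density r m z * f z)%:E)%E.
Proof.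
move=> r0 r1 m0 mZ lawZ mf f0.
pose M : set (measurableTypeR R) := `[m, +oo[%classic.
have mM : measurable M by exact: measurable_itv.
pose g : measurableTypeR R -> R := Z_density r m \_ M.
have g0 z : 0 <= g z.
  rewrite /g patchE; case: ifPn => //; rewrite inE /M/= in_itv/= andbT.
  exact: Z_density_ge0.
have mg : measurable_fun setT g.
  by apply/(measurable_restrictT _ _).1 => //; apply: measurable_funTS; exact: measurable_Z_density.
have mfE : measurable_fun setT (EFin \o f) by exact/measurable_EFinP.
have mZ' : measurable_fun setT (Z : T -> measurableTypeR R) := mZ.
transitivity (\int[law P mZ']_z (f z)%:E)%E.
  by rewrite integral_law.
rewrite [LHS](eq_measure_integral (density_measure mu mg g0)); last first.
  move=> A mA _; apply: etrans (lawZ A mA) _.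
  rewrite integral_mkcondr; apply: eq_integral => z _.
  by rewrite /g !patchE; case: ifP.
rewrite ge0_integral_density//= [RHS]integral_mkcond; apply: eq_integral => z _.
by rewrite /g !patchE; case: ifP; rewrite ?mule0// EFinM muleC.
Qed.

Context d (T : measurableType d) (P : probability T R) (S Z : T -> R) (a r m : R).
Hypotheses (a0 : 0 < a) (r0 : 0 < r) (r1 : r < 1) (m0 : 0 < m).
Hypotheses (mS : measurable_fun setT S) (mZ : measurable_fun setT Z).
Hypothesis S1 : P (S @^-1` `]0%R, +oo[) = 1%E.
Hypothesis laplaceS : forall u, 0 <= u ->
  (\int[P]_(w in S @^-1` `]0%R, +oo[) (expR (- (u * S w)))%:E = (expR (- (u `^ a)))%:E)%E.
Hypothesis lawZ : is_Z_law P r m Z.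
Hypothesis SZ : forall A B, measurable A -> measurable B ->
  P (S @^-1` A `&` Z @^-1` B) = (P (S @^-1` A) * P (Z @^-1` B))%E.

Let D : set R := `]0%R, +oo[%classic.
Let M : set R := `[m, +oo[%classic.
Let V w := S w * Z w `^ (1 / a).
(** An event of probability 1 on which V is a product of positive numbers. V may also be positive
    outside G, but only on a null set. *)
Let G := S @^-1` D `&` Z @^-1` M.

Let mD : measurable D. Proof. exact: measurable_itv. Qed.
Let mM : measurable M. Proof. exact: measurable_itv. Qed.

Let mpre (X : T -> R) (A : set R) : measurable_fun setT X -> measurable A -> measurable (X @^-1` A).
Proof. by move=> mX mA; rewrite -[X in measurable X]setTI; exact: mX. Qed.

Let mV : measurable_fun setT V. Proof. by rewrite /V; mfun. Qed.

Let mG : measurable G. Proof. by apply: measurableI; exact: mpre. Qed.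

Let PG : P G = 1%E.
Proof.
rewrite /G SZ// S1 mul1e lawZ//.
rewrite (_ : M `&` _ = `[m, +oo[%classic); last exact: setIid.
exact: Z_density_mass.
Qed.

Let GV : G `<=` V @^-1` D.
Proof.
move=> w [/=]; rewrite /D/M/= !in_itv/= !andbT => s0 zm.
by rewrite /V mulr_gt0// powR_gt0// (lt_le_trans m0).
Qed.

Lemma mixing_variable_gt0 : P (V @^-1` D) = 1%E.
Proof.
apply/eqP; rewrite eq_le probability_le1 -?PG; last exact: mpre.
by rewrite le_measure ?inE//; exact: mpre.
Qed.

(** Given Z, the Laplace transform of S at Z^(1/a) x is exp (- Z x^a); the law of Z is then
    integrated out. S enters through its Laplace transform, so the result serves both the
    constructed stable law and one given by its characteristic function. *)
Lemma mixing_variable_laplace x : 0 <= x ->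
  (\int[P]_(w in V @^-1` D) (expR (- (V w * x)))%:E =
   \int[mu]_(z in `[m, +oo[) (Z_density r m z * expR (- (z * x `^ a)))%:E)%E.
Proof.
move=> x0; have mVD : measurable (V @^-1` D) by exact: mpre.
have m1 : measurable_fun setT (\1_D : R -> R) by exact: measurable_indic.
have m2 : measurable_fun setT (\1_M : R -> R) by exact: measurable_indic.
have me : measurable_fun setT (fun w => expR (- (V w * x))) by mfun.
have iV : P.-integrable (V @^-1` D) (fun w => (expR (- (V w * x)))%:E).
  apply: (@le_integrableR _ _ _ P _ _ (cst 1)) => //.
  - exact: measurable_funTS.
  - move=> w /=; rewrite /D/= in_itv/= andbT => v0.
    by rewrite ger0_norm ?expR_ge0// -expR0 ler_expR oppr_le0 mulr_ge0// ltW.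
  - exact: finite_measure_integrable_cst.
have PN : P (V @^-1` D `\` G) = 0.
  apply/eqP; rewrite -measure_le0 (@le_trans _ _ (P (~` G)))//.
    by apply: le_measure; rewrite ?inE; [exact: measurableD|exact: measurableC|move=> w []].
  by rewrite probability_setC// [P G]PG subee.
rewrite (negligible_integral _ mVD iV PN); last exact: measurableD.
rewrite setDD (_ : V @^-1` D `&` G = G); last exact/setIidPr.
pose h (z : R * R) : \bar R := (expR (- (z.2 `^ (1 / a) * x * z.1)) * \1_D z.1 * \1_M z.2)%:E.
have mh : measurable_fun setT h.
  have mh1 : measurable_fun setT (fun z : R * R => \1_D z.1 : R).
    by apply: (measurableT_comp m1); exact: measurable_fst.
  have mh2 : measurable_fun setT (fun z : R * R => \1_M z.2 : R).
    by apply: (measurableT_comp m2); exact: measurable_snd.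
  by rewrite /h; mfun.
have h0 z : (0 <= h z)%E by rewrite lee_fin !mulr_ge0 ?expR_ge0// indicE.
transitivity (\int[P]_w h (S w, Z w))%E.
  rewrite integral_mkcond; apply: eq_integral => w _.
  rewrite /h patchE /G in_setI !indicE/=.
  have -> : (w \in S @^-1` D) = (S w \in D) by apply/idP/idP; rewrite !inE.
  have -> : (w \in Z @^-1` M) = (Z w \in M) by apply/idP/idP; rewrite !inE.
  case: (S w \in D); case: (Z w \in M); rewrite /= ?mulr0 ?mulr1//.
  by rewrite /V; congr (expR (- _))%:E; ring.
rewrite (indep_integral mS mZ SZ mh h0).
transitivity (\int[P]_w (expR (- (Z w * x `^ a)) * \1_M (Z w))%:E)%E.
  apply: eq_integral => w _; rewrite /h/=.
  have [wM|wM] := boolP (Z w \in M); last first.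
    by rewrite !indicE (negbTE wM) mulr0 integral0_eq// => w' _; rewrite mulr0.
  have zm : m <= Z w by move: wM; rewrite inE /M/= in_itv/= andbT.
  have z0 := lt_le_trans m0 zm.
  have u0 : 0 <= Z w `^ (1 / a) * x by rewrite mulr_ge0 ?powR_ge0.
  transitivity (expR (- ((Z w `^ (1 / a) * x) `^ a)))%:E; last first.
    rewrite indicE wM mulr1 powRM ?powR_ge0// -powRrM div1r mulVf ?gt_eqF//.
    by rewrite powRr1// ltW.
  rewrite -laplaceS// [RHS]integral_mkcond; apply: eq_integral => w' _.
  rewrite patchE !indicE wM mulr1.
  have -> : (w' \in S @^-1` D) = (S w' \in D) by apply/idP/idP; rewrite !inE.
  by case: (S w' \in D); rewrite ?mulr0 ?mulr1.
rewrite (integral_Z_law r0 r1 m0 mZ lawZ (f := fun z => expR (- (z * x `^ a)) * \1_M z)).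
- apply: eq_integral => z zM.
  by rewrite indicE zM mulr1.
- by mfun.
- by move=> z; rewrite mulr_ge0 ?expR_ge0// indicE.
Qed.

End mixture.

Section product_representation.
Context {R : realType}.
Notation mu := (@lebesgue_measure R).

Lemma measure_unique_rays (m1 m2 : {measure set (measurableTypeR R) -> \bar R}) :
  (forall x, m1 `]x, +oo[%classic < +oo)%E ->
  (forall x, m1 `]x, +oo[%classic = m2 `]x, +oo[%classic) ->
  forall A, measurable A -> m1 A = m2 A.
Proof.
move=> fin h; apply: (@measure_unique _ R (measurableTypeR R) (@RGenOInfty.G R) (fun n => `](- n%:R), +oo[%classic)) => //.
- exact: RGenOInfty.measurableE.
- move=> _ _ [x ->] [y ->]; exists (Num.max x y); apply/seteqP; split => z.
    by move=> [/=]; rewrite !in_itv/= !andbT gt_max => -> ->.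
  by rewrite /= !in_itv/= !andbT gt_max => /andP[].
- by move=> n; exists (- n%:R).
- apply/seteqP; split => // z _; exists (Num.bound `|z|) => //=.
  rewrite in_itv/= andbT ltrNl; apply: le_lt_trans (ler_norm _) _.
  by rewrite normrN; apply: le_lt_trans (archi_boundP _).
- by move=> _ [x ->].
Qed.

Lemma probability_setIr d (T : measurableType d) (P : probability T R) (A D : set T) :
  measurable A -> measurable D -> P D = 1%E -> P (A `&` D) = P A.
Proof.
move=> mA mD PD; apply/eqP; rewrite eq_le le_measure ?inE//=; last first.
  exact: measurableI.
rewrite (measureDI P mA mD) -[leRHS]add0e leeD2r// (@le_trans _ _ (P (~` D)))//.
  by apply: le_measure; rewrite ?inE; [exact: measurableD|exact: measurableC|move=> w []].
by rewrite probability_setC// [P D]PD subee.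
Qed.

Lemma gg_law_setI0 (r a m : R) : gg_law r a m setT = gg_law r a m `]0%R, +oo[%classic.
Proof.
rewrite /gg_law setTI -integral_itv_obnd_cbnd; last first.
  by apply: measurable_funTS; apply/measurable_EFinP; rewrite /gg_density; mfun.
congr (integral _ _ _); apply/seteqP; split => y; last by case.
by rewrite /= !in_itv/= !andbT => xy; split=> //; exact: ltW.
Qed.

Lemma gg_law0 (r a m : R) : 0 < r -> r < 1 -> 0 < m -> 0 < a ->
  gg_law r a m `]0%R, +oo[%classic = 1%E.
Proof.
move=> r0 r1 m0 a0; rewrite (gg_tail r0 r1 m0 a0 (lexx 0)) powR0 ?gt_eqF//.
rewrite -(Z_density_mass r0 r1 m0); apply: eq_integral => z _.
by rewrite mulr0 oppr0 expR0 mulr1.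
Qed.

Lemma gg_law_neg (r a m x : R) : 0 < r -> r < 1 -> 0 < m -> 0 < a -> x < 0 ->
  gg_law r a m `]x, +oo[%classic = 1%E.
Proof.
move=> r0 r1 m0 a0 x0; rewrite -(gg_law0 r0 r1 m0 a0) -gg_law_setI0 /gg_law setTI.
congr (integral _ _ _); apply/seteqP; split => y; first by case.
by rewrite /= !in_itv/= !andbT => xy; split=> //; exact: lt_le_trans xy.
Qed.

(** S and Z are taken as the coordinates of a product space, and H is the law of S Z^(1/a). *)
Lemma gg_mixed_exponential (r a m : R) : 0 < a -> a <= 1 -> 0 < r -> r < 1 -> 0 < m ->
  mixed_exponential (gg_law r a m).
Proof.
move=> a0 a1 r0 r1 m0.
have [Q [Q1 laplaceQ]] := stable_exists a0 a1.
have mM : measurable (`[m, +oo[%classic : set (measurableTypeR R)) by exact: measurable_itv.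
have Zge0 z : (`[m, +oo[%classic : set (measurableTypeR R)) z -> 0 <= Z_density r m z.
  by rewrite /= in_itv/= andbT; exact: Z_density_ge0.
have [Q' [Q'0 _]] := density_probability mM (measurable_Z_density r m) Zge0 (Z_density_mass r0 r1 m0).
pose P := (Q \x Q')%E.
pose S (z : measurableTypeR R * measurableTypeR R) : R := z.1.
pose Z (z : measurableTypeR R * measurableTypeR R) : R := z.2.
have mS : measurable_fun setT S by exact: measurable_fst.
have mZ : measurable_fun setT Z by exact: measurable_snd.
have PS (A : set (measurableTypeR R)) : measurable A -> P (S @^-1` A) = Q A.
  move=> mA; rewrite (_ : S @^-1` A = A `*` setT); last by apply/seteqP; split => [[? ?]|[? ?] []].
  by apply: etrans (product_measure1E _ _ mA measurableT) _; rewrite [X in (_ * X)%E]probability_setT mule1.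
have PZ (A : set (measurableTypeR R)) : measurable A -> P (Z @^-1` A) = Q' A.
  move=> mA; rewrite (_ : Z @^-1` A = setT `*` A); last by apply/seteqP; split => [[? ?]|[? ?] []].
  by apply: etrans (product_measure1E _ _ measurableT mA) _; rewrite [X in (X * _)%E]probability_setT mul1e.
have S1 : P (S @^-1` `]0%R, +oo[) = 1%E by rewrite PS.
have laplaceS u : 0 <= u ->
    (\int[P]_(w in S @^-1` `]0%R, +oo[) (expR (- (u * S w)))%:E = (expR (- (u `^ a)))%:E)%E.
  move=> u0; rewrite -laplaceQ//.
  have mS' : measurable_fun setT (S : _ -> measurableTypeR R) := mS.
  rewrite [RHS](eq_measure_integral (law P mS')); last by move=> A mA _; apply/esym; exact: PS.
  apply/esym; apply: (ge0_integral_pushforward mS' P) => //.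
  by apply: measurable_funTS; mfun.
have lawZ : is_Z_law P r m Z.
  move=> A mA; apply: etrans (PZ A mA) _; rewrite -[X in Q' X]setIT -integral_indic// Q'0//.
  - rewrite setIC integral_mkcondr; apply: eq_integral => z _.
    by rewrite patchE indicE; case: ifP => zA; rewrite ?mul1e ?mul0e.
  - by apply/measurable_EFinP; exact: measurable_indic.
have SZ A B : measurable A -> measurable B ->
    P (S @^-1` A `&` Z @^-1` B) = (P (S @^-1` A) * P (Z @^-1` B))%E.
  move=> mA mB; apply: etrans (product_measure1E Q Q' mA mB) _.
  by congr (_ * _)%E; apply/esym; [exact: PS|exact: PZ].
pose V w := S w * Z w `^ (1 / a).
have mV : measurable_fun setT V by rewrite /V; mfun.
exists (law P mV); split.
  exact: (mixing_variable_gt0 a r0 r1 m0 mS mZ S1 lawZ SZ).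
move=> x x0; rewrite gg_tail//.
rewrite -(mixing_variable_laplace a0 r0 r1 m0 mS mZ S1 laplaceS lawZ SZ x0).
apply/esym; apply: (ge0_integral_pushforward mV P) => //.
by apply: measurable_funTS; mfun.
Qed.

(** Given V, the event W > x V has probability exp (- x V), so the tail of W / V is the Laplace
    transform of V, already identified with the generalized gamma tail. Equality of tails extends to
    all measurable sets. *)
Lemma gg_product_representation d (T : measurableType d) (P : probability T R) (W S Z : T -> R)
    (r a m : R) : 0 < a -> a <= 1 -> 0 < r -> r < 1 -> 0 < m ->
  measurable_fun setT W -> measurable_fun setT S -> measurable_fun setT Z ->
  indep3 P W S Z -> is_std_exponential P W -> is_stable_one_sided P a S -> is_Z_law P r m Z ->
  forall A : set R, measurable A ->
    P ((fun w => W w / (S w * Z w `^ (1 / a))) @^-1` A) = gg_law r a m A.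
Proof.
move=> a0 a1 r0 r1 m0 mW mS mZ ind expW stS lawZ.
pose V w := S w * Z w `^ (1 / a); pose U w := W w / V w.
have mV : measurable_fun setT V by rewrite /V; mfun.
have mU : measurable_fun setT U by rewrite /U; mfun.
have mU' : measurable_fun setT (U : T -> measurableTypeR R) := mU.
have mpre (X : T -> R) (A : set R) : measurable_fun setT X -> measurable A -> measurable (X @^-1` A).
  by move=> mX mA; rewrite -[X in measurable X]setTI; exact: mX.
have mray (x : R) : measurable (`]x, +oo[%classic : set R) by exact: measurable_itv.
have SZ A B : measurable A -> measurable B ->
    P (S @^-1` A `&` Z @^-1` B) = (P (S @^-1` A) * P (Z @^-1` B))%E.
  by move=> mA mB; have := ind setT A B measurableT mA mB; rewrite preimage_setT setTI [P setT]probability_setT mul1e.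
have WV A B : measurable A -> measurable B ->
    P (W @^-1` A `&` V @^-1` B) = (P (W @^-1` A) * P (V @^-1` B))%E.
  move=> mA mB; have mv : measurable_fun setT (fun z : R * R => z.1 * z.2 `^ (1 / a)) by mfun.
  have mE : measurable ((fun z : R * R => z.1 * z.2 `^ (1 / a)) @^-1` B).
    by rewrite -[X in measurable X]setTI; exact: mv.
  exact: (indep3_pair mW mS mZ ind mA mE).
have S1 := stable_gt0 mS a0 a1 stS.
have V1 : P (V @^-1` `]0%R, +oo[) = 1%E := mixing_variable_gt0 a r0 r1 m0 mS mZ S1 lawZ SZ.
have inV w : (w \in V @^-1` `]0%R, +oo[) = (0 < V w).
  by apply/idP/idP; rewrite inE /= in_itv/= andbT.
have posE (y : R) : (y \in (`]0%R, +oo[%classic : set R)) = (0 < y).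
  by apply/idP/idP; rewrite inE /= in_itv/= andbT.
have tail x : 0 <= x -> P (U @^-1` `]x, +oo[) = gg_law r a m `]x, +oo[%classic.
  move=> x0; rewrite gg_tail//.
  rewrite -(mixing_variable_laplace a0 r0 r1 m0 mS mZ S1 (stable_laplace mS a0 a1 stS) lawZ SZ x0).
  rewrite -(probability_setIr _ _ V1); [|exact: mpre..].
  pose h (z : R * R) : \bar R := (\1_(`]0%R, +oo[%classic) (z.1 - x * z.2) * \1_(`]0%R, +oo[%classic) z.2)%:E.
  have mI : measurable_fun setT (\1_(`]0%R, +oo[%classic : set R) : R -> R) by exact: measurable_indic.
  have mh : measurable_fun setT h.
    have m1 : measurable_fun setT (fun z : R * R => \1_(`]0%R, +oo[%classic : set R) (z.1 - x * z.2) : R).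
      by apply: (measurableT_comp mI); mfun.
    have m2 : measurable_fun setT (fun z : R * R => \1_(`]0%R, +oo[%classic : set R) z.2 : R).
      by apply: (measurableT_comp mI); mfun.
    by rewrite /h; mfun.
  have h0 z : (0 <= h z)%E by rewrite lee_fin mulr_ge0// indicE.
  rewrite -[X in P X]setIT -integral_indic//; last by apply: measurableI; exact: mpre.
  transitivity (\int[P]_w h (W w, V w))%E.
    apply: eq_integral => w _; rewrite /h !indicE/= in_setI inV; congr (_%:E).
    rewrite !posE; case: (ltP 0 (V w)) => v0; last by rewrite andbF mulr0.
    rewrite andbT mulr1 (_ : (w \in U @^-1` _) = (0 < W w - x * V w))//.
    by apply/idP/idP; rewrite inE/= in_itv/= andbT subr_gt0 /U ltr_pdivlMr.
  rewrite (indep_integral mW mV WV mh h0) [RHS]integral_mkcond.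
  apply: eq_integral => w _; rewrite patchE inV /h/=.
  under eq_integral do rewrite [\1__ (V w)]indicE posE.
  case: (ltP 0 (V w)) => v0; last by rewrite integral0_eq// => w' _; rewrite mulr0.
  under eq_integral do rewrite mulr1.
  have xv : 0 <= x * V w by rewrite mulr_ge0// ltW.
  transitivity (P (W @^-1` `]x * V w, +oo[)).
    rewrite -[X in P X]setIT -integral_indic//; last exact: mpre.
    apply: eq_integral => w' _; rewrite !indicE posE (_ : (w' \in W @^-1` _) = (0 < W w' - x * V w))//.
    by apply/idP/idP; rewrite inE/= in_itv/= andbT subr_gt0.
  rewrite expW// (_ : _ `&` _ = `]x * V w, +oo[%classic); last first.
    apply/seteqP; split => y; first by case.
    by rewrite /= !in_itv/= !andbT => xy; split=> //; apply: le_trans xv (ltW xy).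
  transitivity (\int[mu]_(y in `](x * V w)%R, +oo[) (expR (- (1 * y)))%:E)%E.
    by apply: eq_integral => y _; rewrite mul1r.
  by rewrite integral_expRN// divr1 mul1r mulrC.
have fin x : (law P mU' `]x, +oo[%classic < +oo)%E.
  apply: (@le_lt_trans _ _ 1%E); last exact: ltry.
  exact: probability_le1.
(* [gg_law] is a bare set function; it is matched with a density measure so that uniqueness of
   measures applies. *)
pose g : measurableTypeR R -> R := gg_density r a m \_ `[0, +oo[.
have g0 y : 0 <= g y.
  rewrite /g patchE; case: ifP => // _.
  by rewrite /gg_density !mulr_ge0 ?expR_ge0 ?powR_ge0 ?normr_ge0 ?invr_ge0// ltW// Gammaf_gt0.
have mg : measurable_fun setT g.
  apply/(measurable_restrictT _ _).1; first exact: measurable_itv.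
  by apply: measurable_funTS; rewrite /gg_density; mfun.
have gE A : density_measure mu mg g0 A = gg_law r a m A.
  rewrite /gg_law integral_mkcondr; apply: eq_integral => y _.
  by rewrite /g !patchE; case: ifP.
move=> A mA; rewrite -gE.
apply: (measure_unique_rays (m1 := law P mU')) => // x; rewrite gE.
(* For x < 0 both tails equal 1, since both already do at x = 0. *)
have [x0|x0] := ltP x 0; last exact: tail.
rewrite gg_law_neg//; apply/eqP; rewrite eq_le probability_le1//=.
rewrite -(gg_law0 r0 r1 m0 a0) -tail//.
apply: le_measure; rewrite ?inE; [exact: mpre..|].
by move=> w /=; rewrite !in_itv/= !andbT; exact: lt_trans.
Qed.

End product_representation.

(** * Convexity of mixed exponential tails *)

Section not_mixed.
Context {R : realType}.
Notation mu := (@lebesgue_measure R).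

Lemma Gammaf_ge0 (r : R) : 0 <= Gammaf r.
Proof. by apply: Rintegral_ge0 => t _; rewrite mulr_ge0 ?powR_ge0 ?expR_ge0. Qed.

Lemma gg_density_ge0 (r a m x : R) : 0 <= gg_density r a m x.
Proof. by rewrite /gg_density !mulr_ge0 ?expR_ge0 ?powR_ge0 ?normr_ge0 ?invr_ge0 ?Gammaf_ge0. Qed.

Lemma measurable_gg_density (r a m : R) : measurable_fun setT (gg_density r a m).
Proof. by rewrite /gg_density; mfun. Qed.

Lemma gg_law_split (r a m x y : R) : 0 <= x -> x <= y ->
  gg_law r a m `]x, +oo[%classic =
  (\int[mu]_(z in `]x, y]) (gg_density r a m z)%:E + gg_law r a m `]y, +oo[%classic)%E.
Proof.
move=> x0 xy; have pos z : 0 <= z -> `]z, +oo[%classic `&` `[0, +oo[%classic = `]z, +oo[%classic :> set R.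
  move=> z0; apply/seteqP; split => w; first by case.
  by rewrite /= !in_itv/= !andbT => zw; split=> //; apply: le_trans z0 (ltW zw).
rewrite /gg_law !pos ?(le_trans x0 xy)//.
have -> : `]x, +oo[%classic = `]x, y]%classic `|` `]y, +oo[%classic :> set (measurableTypeR R).
  by apply: itv_bndbnd_setU; rewrite ?bnd_simp.
rewrite ge0_integral_setU//; try exact: measurable_itv.
- by apply: measurable_funTS; apply/measurable_EFinP; exact: measurable_gg_density.
- by move=> z _; rewrite lee_fin gg_density_ge0.
- apply/disj_setPRL => z /=; rewrite !in_itv/= !andbT => yz; apply/negP.
  by rewrite negb_and -!ltNge yz orbT.
Qed.

Lemma gg_not_mixed_exponential (r a m : R) : 0 < a -> 0 < r -> 0 < m -> 1 < a * r ->
  ~ mixed_exponential (gg_law r a m).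
Proof.
move=> a0 r0 m0 ar1 [H [H1 HE]].
have b0 : 0 < a * r - 1 by rewrite subr_gt0.
set b := a * r - 1 in b0.
have [c c0 fE] : exists2 c, 0 <= c &
    forall y, gg_density r a m y = c * y `^ b * expR (- (m * y `^ a)).
  exists (`|a| * m `^ r / Gammaf r) => //.
  by rewrite !mulr_ge0 ?powR_ge0 ?normr_ge0 ?invr_ge0 ?Gammaf_ge0.
pose D : set R := `]0, +oo[%classic.
have mD : measurable D by exact: measurable_itv.
have inD z : D z -> 0 < z by rewrite /D/= in_itv/= andbT.
pose T x := gg_law r a m `]x, +oo[%classic.
have T0 : T 0 = 1%E.
  rewrite /T HE// -[RHS]H1 -[RHS]mul1e -integral_cst//.
  by apply: eq_integral => z _; rewrite mulr0 oppr0 expR0.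
have iH x : 0 <= x -> H.-integrable D (EFin \o (fun z => expR (- (z * x)))).
  move=> x0; apply: (@le_integrableR _ _ _ H _ _ (cst 1)) => //.
  - by apply: measurable_funTS; mfun.
  - by move=> z /inD z0; rewrite ger0_norm ?expR_ge0// -expR0 ler_expR oppr_le0 mulr_ge0 ?(ltW z0).
  - exact: finite_measure_integrable_cst.
have Tfin x : 0 <= x -> T x \is a fin_num.
  by move=> x0; rewrite /T HE//; exact: (integrable_fin_num mD (iH x x0)).
(* The right-hand side minus the left-hand side is the H-mean of (1 - exp (- z)) (1 - exp (- z h)),
   a product of nonnegative factors. *)
have convex h : 0 <= h -> (T 1%R + T h <= T 0%R + T (1 + h)%R)%E.
  move=> h0; have h1 : 0 <= 1 + h by rewrite addr_ge0.
  rewrite /T !HE// -!integralD//; try exact: iH.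
  apply: le_integral => //; try by apply: integrableD => //; exact: iH.
  move=> z; rewrite inE => /inD z0; rewrite -!EFinD lee_fin mulr0 oppr0 expR0 mulr1.
  rewrite mulrDr mulr1 opprD expRD -subr_ge0.
  have -> : 1 + expR (- z) * expR (- (z * h)) - (expR (- z) + expR (- (z * h))) =
    (1 - expR (- z)) * (1 - expR (- (z * h))) by ring.
  by rewrite mulr_ge0// subr_ge0 -expR0 ler_expR oppr_le0 ?mulr_ge0 ?(ltW z0).
have mI (x y : R) : measurable (`]x, y]%classic : set (measurableTypeR R)) by exact: measurable_itv.
have mfI (x y : R) : measurable_fun (`]x, y]%classic : set (measurableTypeR R)) (fun z => (gg_density r a m z)%:E).
  by apply: measurable_funTS; apply/measurable_EFinP; exact: measurable_gg_density.
(* Here r may exceed 1, where [Gammaf_gt0] does not apply. Positivity follows from the total mass 1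
   that the mixture provides: c = 0 would make the law vanish. *)
have c_gt0 : 0 < c.
  rewrite lt_neqAle c0 andbT; apply/eqP => ce.
  have : T 0 = 0%E.
    by rewrite /T/gg_law integral0_eq// => y _; rewrite fE -ce !mul0r.
  by rewrite T0 => /eqP; rewrite onee_eq0.
(* Chosen so that h^b = exp (- (m 2^a + 1)) is less than exp (- m 2^a). The former times c bounds
   the density from above on ]0, h], the latter times c from below on ]1, 1 + h], which lies in
   [1, 2] because h <= 1. *)
pose h := expR (- ((m * 2 `^ a + 1) / b)).
have h0 : 0 < h by exact: expR_gt0.
have h1 : h <= 1.
  by rewrite -expR0 ler_expR oppr_le0 divr_ge0 ?(ltW b0)// addr_ge0// mulr_ge0 ?powR_ge0// ltW.
have hb : h `^ b < expR (- (m * 2 `^ a)).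
  by rewrite -expRM mulNr divfK ?gt_eqF// ltr_expR ltrN2 ltrDl.
have intc k x y : x < y -> (\int[mu]_(z in `]x, y]) (cst k%:E z) = (k * (y - x))%:E)%E.
  move=> xy; apply: etrans (integral_cst mu (mI x y) k%:E) _.
  rewrite [X in (_ * X)%E](_ : _ = (y - x)%:E) -?EFinM//.
  by rewrite [LHS](lebesgue_measure_itv `]x, y])/= lte_fin xy EFinB.
have up : (\int[mu]_(z in `]0%R, h]) (gg_density r a m z)%:E <= (c * h `^ b * h)%:E)%E.
  apply: (@le_trans _ _ (\int[mu]_(z in `]0%R, h]) (cst (c * h `^ b)%:E z))%E).
    apply: ge0_le_integral => //.
    - by move=> z _; rewrite lee_fin gg_density_ge0.
    - move=> z; rewrite /= in_itv/= => /andP[z0 zh]; rewrite lee_fin fE.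
      rewrite -[leRHS]mulr1 ler_pM ?mulr_ge0 ?powR_ge0 ?expR_ge0//.
        by rewrite ler_wpM2l// ge0_ler_powR ?nnegrE ?(ltW b0) ?(ltW z0) ?(ltW h0).
      by rewrite -expR0 ler_expR oppr_le0 mulr_ge0 ?powR_ge0// ltW.
  by rewrite intc// subr0.
have low : ((c * expR (- (m * 2 `^ a)) * h)%:E <= \int[mu]_(z in `]1%R, (1 + h)%R]) (gg_density r a m z)%:E)%E.
  apply: (@le_trans _ _ (\int[mu]_(z in `]1%R, (1 + h)%R]) (cst (c * expR (- (m * 2 `^ a)))%:E z))%E).
    by rewrite intc ?ltrDl// addrAC subrr add0r.
  apply: ge0_le_integral => //.
  - by move=> z _; rewrite lee_fin mulr_ge0 ?expR_ge0.
  - move=> z; rewrite /= in_itv/= => /andP[z1 zh]; have z0 : 0 < z by apply: lt_trans z1.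
    rewrite lee_fin fE ler_pM ?expR_ge0//.
      rewrite -[leLHS]mulr1 ler_wpM2l//.
      have one : (1 : R) = 1 `^ b by rewrite powR1.
      by rewrite [leLHS]one ge0_ler_powR ?nnegrE ?(ltW b0) ?(ltW z1) ?(ltW z0).
    rewrite ler_expR lerN2 ler_wpM2l ?(ltW m0)// ge0_ler_powR ?nnegrE ?(ltW a0) ?(ltW z0)//.
    by apply: le_trans zh _; rewrite [leRHS](_ : 2 = 1 + 1)// lerD2l.
(* Splitting the tails at h and at 1 + h, the terms [T h] and [T (1 + h)] cancel. What remains says
   that the mass of ]1, 1 + h] is at most that of ]0, h], against the two bounds above. *)
have := convex h (ltW h0).
rewrite [T 0](gg_law_split r a m (lexx 0) (ltW h0)).
rewrite [T 1](@gg_law_split r a m 1 (1 + h)) ?lerDl ?(ltW h0)//.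
rewrite -!/(T _) addeAC leeD2rE ?Tfin ?addr_ge0 ?(ltW h0)//.
rewrite leeD2rE ?Tfin ?addr_ge0 ?(ltW h0)// => I10.
have := le_trans low (le_trans I10 up); rewrite lee_fin ler_pM2r// ler_pM2l//.
by rewrite leNgt hb.
Qed.

End not_mixed.

Theorem theorem1 (R : realType) :
  (* (i) *)
  (forall (a r mu : R), 0 < a -> a <= 1 -> 0 < r -> r < 1 -> 0 < mu ->
     mixed_exponential (gg_law r a mu) /\
     forall (d : measure_display) (T : measurableType d) (P : probability T R)
            (W S Z : T -> R),
       measurable_fun setT W -> measurable_fun setT S -> measurable_fun setT Z ->
       indep3 P W S Z ->
       is_std_exponential P W ->
       is_stable_one_sided P a S ->
       is_Z_law P r mu Z ->
       forall A : set R, measurable A ->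
         P ((fun w => W w / (S w * Z w `^ (1 / a))) @^-1` A) = gg_law r a mu A)
  /\
  (* (ii) *)
  (forall (a r mu : R), 0 < a -> 0 < r -> 0 < mu -> 1 < a * r ->
     ~ mixed_exponential (gg_law r a mu)).
Proof.
split=> [a r mu a0 a1 r0 r1 mu0|a r mu]; last exact: gg_not_mixed_exponential.
split=> [|d T P W S Z]; first exact: gg_mixed_exponential.
exact: gg_product_representation.
Qed.
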